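(* Let $0<q<1$ and let $(\mathcal{A}(S^4_q),\mathcal{H},D,\gamma)$ be the spectral triple described in the context. In the region $\mathrm{Re}\,s>2$ the dimension spectrum $\Sigma$ of this spectral triple consists of the two points $\{3,4\}$, which are simple poles of the zeta-functions. The top residue coincides with the integral on the subspace of classical points of $S^4_q$, that is, for all $a\in\mathcal{A}(S^4_q)$, $$\mathrm{Res}_{s=0}\mathrm{Tr}_{\mathcal{H}}\big(a|D|^{-4}|D|^{-s}\big)=\frac{2}{3\pi}\int_0^{2\pi}\sigma(a)(\theta)\,\mathrm{d}\theta,$$ with $\sigma:\mathcal{A}(S^4_q)\to\mathcal{A}(S^1)$ the $*$-algebra morphism defined by $\sigma(x_0)=\sigma(x_1)=0$ and $\sigma(x_2)=u$, where $u(\theta):=e^{i\theta}$ is the unitary generator of the algebra $\mathcal{A}(S^1)$ of trigonometric polynomials on the circle.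
   Context: Notation: $\mathbb{N}=\{0,1,2,\dots\}$, $[z]:=(q^z-q^{-z})/(q-q^{-1})$. The algebra: $\mathcal{A}=\mathcal{A}(S^4_q)$ is the unital $*$-algebra generated by $x_0=x_0^*$, $x_1,x_2,x_1^*,x_2^*$ with relations $x_ix_j=q^2x_jx_i$ for $0\le i<j\le 2$; $x_i^*x_j=q^2x_jx_i^*$ for $i\neq j$; $[x_1^*,x_1]=(1-q^4)x_0^2$; $[x_2^*,x_2]=x_1^*x_1-q^4x_1x_1^*$; $x_0^2+x_1x_1^*+x_2x_2^*=1$. Spectral triple: $\mathcal{H}=\mathcal{H}_+\oplus\mathcal{H}_-$ with grading $\gamma=\pm1$ on $\mathcal{H}_\pm$ and $D|l,m_1,m_2;j\rangle_\pm=(l+\frac32)|l,m_1,m_2;j\rangle_\mp$, with bases and representation of $\mathcal{A}$ given below. It is a regular spectral triple of metric dimension $4$. Dimension spectrum: let $\delta(T)=[|D|,T]$ and let $\Psi^0$ be the algebra generated by $\bigcup_{k\in\mathbb{N}}\delta^k(\mathcal{A}\cup[D,\mathcal{A}])$. For $a\in\Psi^0$, $\zeta_a(s):=\mathrm{Tr}_{\mathcal{H}}(a|D|^{-s})$ is holomorphic for $\mathrm{Re}\,s>4$. The dimension spectrum is the countable set $\Sigma$ of singularities: all $\zeta_a$, $a\in\Psi^0$, extend meromorphically with poles as unique singularities, and $\Sigma$ is the union of these singularities over all $a\in\Psi^0$. The claim about the region $\mathrm{Re}\,s>2$ refers to meromorphic extensions to, and singularities in, the half plane $\{\mathrm{Re}\,s>2\}$.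 Chiral spinor representations: $\mathcal{H}_\pm$ has orthonormal basis $|l,m_1,m_2;j\rangle_\pm$ with $l\in\mathbb{N}+\frac12$, $j=\frac12,\frac32,\ldots,l$, $j-|m_1|\in\mathbb{N}$, $l+\frac12-j-|m_2|\in\mathbb{N}$. Kets with inadmissible labels are $0$. In each coefficient with indices $(l,j,m_2)$, $\epsilon=\frac12(-1)^{l+\frac12-j-m_2}$ is computed from those same indices. The bounded $*$-representation on $\mathcal{H}_\pm$ is \begin{align*} x_0|l,m_1,m_2;j\rangle_\pm &=A^+_{j,m_1}C^+_{l,j,m_2}|l+1,m_1,m_2;j+1\rangle_\pm \mp A^+_{j,m_1}C^0_{l,j,m_2}|l,m_1,m_2;j+1\rangle_\pm +A^+_{j,m_1}C^-_{l,j,m_2}|l-1,m_1,m_2;j+1\rangle_\pm \\ &\quad +A^0_{j,m_1}H^+_{l,j,m_2}|l+1,m_1,m_2;j\rangle_\pm \pm A^0_{j,m_1}H^0_{l,j,m_2}|l,m_1,m_2;j\rangle_\pm +A^0_{j,m_1}H^+_{l-1,j,m_2}|l-1,m_1,m_2;j\rangle_\pm \\ &\quad +A^+_{j-1,m_1}C^-_{l+1,j-1,m_2}|l+1,m_1,m_2;j-1\rangle_\pm \mp A^+_{j-1,m_1}C^0_{l,j-1,m_2}|l,m_1,m_2;j-1\rangle_\pm +A^+_{j-1,m_1}C^+_{l-1,j-1,m_2}|l-1,m_1,m_2;j-1\rangle_\pm,\\ x_1|l,m_1,m_2;j\rangle_\pm &=B^+_{j,m_1}C^+_{l,j,m_2}|l+1,m_1+1,m_2;j+1\rangle_\pm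 \mp B^+_{j,m_1}C^0_{l,j,m_2}|l,m_1+1,m_2;j+1\rangle_\pm +B^+_{j,m_1}C^-_{l,j,m_2}|l-1,m_1+1,m_2;j+1\rangle_\pm \\ &\quad +B^0_{j,m_1}H^+_{l,j,m_2}|l+1,m_1+1,m_2;j\rangle_\pm \pm B^0_{j,m_1}H^0_{l,j,m_2}|l,m_1+1,m_2;j\rangle_\pm +B^0_{j,m_1}H^+_{l-1,j,m_2}|l-1,m_1+1,m_2;j\rangle_\pm \\ &\quad +B^-_{j,m_1}C^-_{l+1,j-1,m_2}|l+1,m_1+1,m_2;j-1\rangle_\pm \mp B^-_{j,m_1}C^0_{l,j-1,m_2}|l,m_1+1,m_2;j-1\rangle_\pm +B^-_{j,m_1}C^+_{l-1,j-1,m_2}|l-1,m_1+1,m_2;j-1\rangle_\pm,\\ x_2|l,m_1,m_2;j\rangle_\pm &=D^+_{l,j,m_2}|l+1,m_1,m_2+1;j\rangle_\pm \pm D^0_{l,j,m_2}|l,m_1,m_2+1;j\rangle_\pm +D^-_{l,j,m_2}|l-1,m_1,m_2+1;j\rangle_\pm, \end{align*} with \begin{align*} A^+_{j,m_1} &=q^{m_1-1}\frac{\sqrt{[j+m_1+1][j-m_1+1]}}{[2j+2]},\qquad A^0_{j,m_1} =q^{-2}\frac{q^{j+m_1+1}[2][j-m_1]-[2j]}{[2j][2j+2]},\\ B^+_{j,m_1} &=q^{-j+m_1-1/2}\frac{\sqrt{[j+m_1+1][j+m_1+2]}}{[2j+2]},\qquad B^0_{j,m_1} =(1+q^2)q^{m_1-1/2}\frac{\sqrt{[j-m_1][j+m_1+1]}}{[2j][2j+2]},\\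 B^-_{j,m_1} &=-q^{j+m_1+1/2}\frac{\sqrt{[j-m_1][j-m_1-1]}}{[2j]},\\ C^+_{l,j,m_2} &=-q^{m_2-1-\epsilon}\frac{\sqrt{[l+j+m_2+3+\epsilon][l+j-m_2+3-\epsilon]}}{[2l+4]},\\ C^0_{l,j,m_2} &=[4\epsilon]\,q^{2\epsilon l+m_2-1+3\epsilon}\frac{\sqrt{[l+\frac12+j-2\epsilon m_2+2][l+\frac12-j-2\epsilon m_2]}}{[2l+2][2l+4]},\\ C^-_{l,j,m_2} &=-q^{m_2-1+\epsilon}\frac{\sqrt{[l-j+m_2-\epsilon][l-j-m_2+\epsilon]}}{[2l+2]},\\ H^+_{l,j,m_2} &=q^{m_2-1+\epsilon(2j+1)}\frac{\sqrt{[l+2\epsilon j-m_2+2+\epsilon][l-2\epsilon j+m_2+2-\epsilon]}}{[2l+4]},\\ H^0_{l,j,m_2} &=\frac{[l-\epsilon(2j+1)-m_2+1][l-\epsilon(2j+1)+m_2+2]-q^{-2}[l+\epsilon(2j+1)-m_2+2][l+\epsilon(2j+1)+m_2+1]}{[2l+2][2l+4]},\\ D^+_{l,j,m_2} &=q^{-l+m_2-3/2}\frac{\sqrt{[l+j+m_2+3+\epsilon][l-j+m_2+2-\epsilon]}}{[2l+4]},\\ D^0_{l,j,m_2} &=[2]q^{m_2+1/2}\frac{\sqrt{[l-2\epsilon j-m_2+1-\epsilon][l-2\epsilon j+m_2+2-\epsilon]}}{[2l+2][2l+4]},\\ D^-_{l,j,m_2} &=-q^{l+m_2+3/2}\frac{\sqrt{[l-j-m_2+\epsilon][l+j-m_2+1-\epsilon]}}{[2l+2]}.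 \end{align*} *)

(* Defs.v *)
From Stdlib Require Import Reals ZArith Bool Lia Lra FunctionalExtensionality.
From Coquelicot Require Import Coquelicot.

Open Scope R_scope.

Inductive generator := X0 | X1 | X2.

Definition gen_index (x : generator) : nat :=
  match x with X0 => 0 | X1 => 1 | X2 => 2 end.

(** Elements of the algebra are represented by *-polynomials in the generators,
    taken up to the congruence [sphere_eq q]: the least congruence containing
    the laws of a unital *-algebra over [C] and the defining relations. *)
Inductive star_poly :=
| Gen (x : generator)
| Scalar (c : C)
| Add (a b : star_poly)
| Mul (a b : star_poly)
| Star (a : star_poly).

Definition Scale (c : C) (a : star_poly) : star_poly := Mul (Scalar c) a.
Definition Sub (a b : star_poly) : star_poly := Add a (Scale (- (1))%C b).

Inductive sphere_eq (q : R) : star_poly -> star_poly -> Prop :=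
| law_refl a : sphere_eq q a a
| law_sym a b : sphere_eq q a b -> sphere_eq q b a
| law_trans a b c : sphere_eq q a b -> sphere_eq q b c -> sphere_eq q a c
| law_cong_add a a' b b' :
    sphere_eq q a a' -> sphere_eq q b b' -> sphere_eq q (Add a b) (Add a' b')
| law_cong_mul a a' b b' :
    sphere_eq q a a' -> sphere_eq q b b' -> sphere_eq q (Mul a b) (Mul a' b')
| law_cong_star a a' : sphere_eq q a a' -> sphere_eq q (Star a) (Star a')
| law_addA a b c : sphere_eq q (Add a (Add b c)) (Add (Add a b) c)
| law_addC a b : sphere_eq q (Add a b) (Add b a)
| law_add0 a : sphere_eq q (Add (Scalar 0) a) a
| law_addN a : sphere_eq q (Sub a a) (Scalar 0)
| law_mulA a b c : sphere_eq q (Mul a (Mul b c)) (Mul (Mul a b) c)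
| law_mul1l a : sphere_eq q (Mul (Scalar 1) a) a
| law_mul1r a : sphere_eq q (Mul a (Scalar 1)) a
| law_mulDl a b c : sphere_eq q (Mul (Add a b) c) (Add (Mul a c) (Mul b c))
| law_mulDr a b c : sphere_eq q (Mul a (Add b c)) (Add (Mul a b) (Mul a c))
| law_scalarD c d : sphere_eq q (Scalar (c + d)%C) (Add (Scalar c) (Scalar d))
| law_scalarM c d : sphere_eq q (Scalar (c * d)%C) (Mul (Scalar c) (Scalar d))
| law_scalar_central c a : sphere_eq q (Mul (Scalar c) a) (Mul a (Scalar c))
| law_starK a : sphere_eq q (Star (Star a)) a
| law_starD a b : sphere_eq q (Star (Add a b)) (Add (Star a) (Star b))
| law_starM a b : sphere_eq q (Star (Mul a b)) (Mul (Star b) (Star a))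
| law_star_scalar c : sphere_eq q (Star (Scalar c)) (Scalar (Cconj c))
| rel_x0_selfadjoint : sphere_eq q (Star (Gen X0)) (Gen X0)
| rel_xx x y : (gen_index x < gen_index y)%nat ->
    sphere_eq q (Mul (Gen x) (Gen y)) (Scale (RtoC (q ^ 2)) (Mul (Gen y) (Gen x)))
| rel_xsx x y : x <> y ->
    sphere_eq q (Mul (Star (Gen x)) (Gen y))
                (Scale (RtoC (q ^ 2)) (Mul (Gen y) (Star (Gen x))))
| rel_comm1 :
    sphere_eq q
      (Sub (Mul (Star (Gen X1)) (Gen X1)) (Mul (Gen X1) (Star (Gen X1))))
      (Scale (RtoC (1 - q ^ 4)) (Mul (Gen X0) (Gen X0)))
| rel_comm2 :
    sphere_eq q
      (Sub (Mul (Star (Gen X2)) (Gen X2)) (Mul (Gen X2) (Star (Gen X2))))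
      (Sub (Mul (Star (Gen X1)) (Gen X1))
           (Scale (RtoC (q ^ 4)) (Mul (Gen X1) (Star (Gen X1)))))
| rel_sphere :
    sphere_eq q
      (Add (Add (Mul (Gen X0) (Gen X0)) (Mul (Gen X1) (Star (Gen X1))))
           (Mul (Gen X2) (Star (Gen X2))))
      (Scalar 1).

(** The *-morphism onto trigonometric polynomials on the circle, as functions of
    the angle. *)
Fixpoint classical_points (a : star_poly) (theta : R) : C :=
  match a with
  | Gen X0 | Gen X1 => 0%C
  | Gen X2 => (cos theta, sin theta)
  | Scalar c => c
  | Add a b => (classical_points a theta + classical_points b theta)%C
  | Mul a b => (classical_points a theta * classical_points b theta)%C
  | Star a => Cconj (classical_points a theta)
  end.

Lemma classical_points_compat (q : R) (a b : star_poly) :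
  sphere_eq q a b -> forall theta, classical_points a theta = classical_points b theta.
Proof.
intros H theta.
assert (Hcs := sin2_cos2 theta); unfold Rsqr in Hcs.
induction H; simpl; try congruence;
  try (apply injective_projections; simpl; ring).
- destruct x, y; simpl in *; try lia;
    apply injective_projections; simpl; ring.
- destruct x, y; simpl in *; try congruence;
    apply injective_projections; simpl; ring.
- apply injective_projections; simpl; [|ring].
  rewrite <- Hcs; ring.
Qed.

(** [Label s l m1 m2 j] holds the *doubled* labels: it stands for
    |l/2, m1/2, m2/2; j/2>, of chirality + when [s] is [true] and - otherwise. *)
Record label := Label { chirality : bool; lab_l : Z; lab_m1 : Z; lab_m2 : Z; lab_j : Z }.

Definition half (d : Z) : R := IZR d / 2.

Definition admissible (k : label) : bool :=
  let '(Label _ l m1 m2 j) := k in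
  (Z.odd l && Z.odd j && (1 <=? j) && (j <=? l)
   && Z.even (j - Z.abs m1) && (0 <=? j - Z.abs m1)
   && Z.even (l + 1 - j - Z.abs m2) && (0 <=? l + 1 - j - Z.abs m2))%Z.

Definition label_at (s : bool) (n p a b : nat) : label :=
  Label s (2 * Z.of_nat n + 1)
          (2 * Z.of_nat a - (2 * Z.of_nat p + 1))
          (2 * Z.of_nat b - (2 * (Z.of_nat n - Z.of_nat p) + 1))
          (2 * Z.of_nat p + 1).

Lemma admissibleP (s : bool) (l m1 m2 j : Z) :
  admissible (Label s l m1 m2 j) = true <->
  (exists n : nat, half l = INR n + / 2) /\
  ((exists n : nat, half j = INR n + / 2) /\ half j <= half l) /\
  (exists n : nat, half j - Rabs (half m1) = INR n) /\
  (exists n : nat, half l + / 2 - half j - Rabs (half m2) = INR n).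
Proof.
assert (Habs : forall z, Rabs (half z) = IZR (Z.abs z) / 2).
{ intros z; unfold half, Rdiv; rewrite Rabs_mult, <- abs_IZR.
  rewrite (Rabs_pos_eq (/ 2)) by lra; reflexivity. }
assert (Hodd : forall z, (exists n : nat, half z = INR n + / 2) <->
                         (exists n : nat, z = 2 * Z.of_nat n + 1)%Z).
{ intros z; unfold half; split; intros [n Hn]; exists n.
  - rewrite INR_IZR_INZ in Hn; apply eq_IZR.
    rewrite plus_IZR, mult_IZR; lra.
  - rewrite INR_IZR_INZ; subst z; rewrite plus_IZR, mult_IZR; lra. }
assert (Heven : forall z, (exists n : nat, IZR z / 2 = INR n) <->
                          (exists n : nat, z = 2 * Z.of_nat n)%Z).
{ intros z; split; intros [n Hn]; exists n.
  - rewrite INR_IZR_INZ in Hn; apply eq_IZR.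
    rewrite mult_IZR; lra.
  - rewrite INR_IZR_INZ; subst z; rewrite mult_IZR; lra. }
assert (E1 : half j - Rabs (half m1) = IZR (j - Z.abs m1) / 2).
{ rewrite Habs, minus_IZR; unfold half; lra. }
assert (E2 : half l + / 2 - half j - Rabs (half m2)
             = IZR (l + 1 - j - Z.abs m2) / 2).
{ rewrite Habs, !minus_IZR, plus_IZR; unfold half; lra. }
rewrite E1, E2, !Hodd, !Heven.
assert (E3 : half j <= half l <-> (j <= l)%Z).
{ unfold half; split; intros H.
  - apply le_IZR; lra.
  - apply IZR_le in H; lra. }
rewrite E3; unfold admissible.
rewrite !andb_true_iff, !Z.odd_spec, !Z.even_spec, !Z.leb_le.
split.
- intros [[[[[[[[x Hx] [y Hy]] H1] H2] [z Hz]] H3] [t Ht]] H4].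
  repeat split; try lia;
    [exists (Z.to_nat x) | exists (Z.to_nat y) | exists (Z.to_nat z)
    | exists (Z.to_nat t)]; lia.
- intros [[x Hx] [[[y Hy] H1] [[z Hz] [t Ht]]]].
  repeat split; try lia;
    [exists (Z.of_nat x) | exists (Z.of_nat y) | exists (Z.of_nat z)
    | exists (Z.of_nat t)]; lia.
Qed.

Lemma admissible_label_at (k : label) :
  admissible k = true <->
  exists s n p a b, (p <= n /\ a <= 2 * p + 1 /\ b <= 2 * (n - p) + 1)%nat /\
                    k = label_at s n p a b.
Proof.
destruct k as [s l m1 m2 j]; unfold admissible, label_at.
rewrite !andb_true_iff, !Z.odd_spec, !Z.even_spec, !Z.leb_le.
split.
- intros [[[[[[[[x Hx] [y Hy]] H1] H2] [z Hz]] H3] [t Ht]] H4].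
  exists s, (Z.to_nat x), (Z.to_nat y), (Z.to_nat ((m1 + j) / 2)),
    (Z.to_nat ((m2 + l + 1 - j) / 2)).
  assert (exists u, m1 + j = 2 * u)%Z as [u Hu].
  { destruct (Z.abs_eq_or_opp m1) as [E | E]; [exists (j - z)%Z | exists z]; lia. }
  assert (exists v, m2 + l + 1 - j = 2 * v)%Z as [v Hv].
  { destruct (Z.abs_eq_or_opp m2) as [E | E];
      [exists (l + 1 - j - t)%Z | exists t]; lia. }
  rewrite Hu, Hv, !(Z.mul_comm 2), !Z.div_mul by lia.
  split; [lia | f_equal; lia].
- intros (s' & n & p & a & b & H & E).
  assert (El := f_equal lab_l E); assert (E1 := f_equal lab_m1 E).
  assert (E2 := f_equal lab_m2 E); assert (Ej := f_equal lab_j E).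
  cbv beta iota delta [lab_l lab_m1 lab_m2 lab_j] in El, E1, E2, Ej; clear E.
  repeat split; try lia.
  + exists (Z.of_nat n); lia.
  + exists (Z.of_nat p); lia.
  + destruct (Z.abs_eq_or_opp m1);
      [exists (2 * Z.of_nat p + 1 - Z.of_nat a)%Z | exists (Z.of_nat a)]; lia.
  + destruct (Z.abs_eq_or_opp m2);
      [exists (2 * (Z.of_nat n - Z.of_nat p) + 1 - Z.of_nat b)%Z
      | exists (Z.of_nat b)]; lia.
Qed.

(** Sum over the finitely many admissible labels with l = n + 1/2. *)
Definition level_sum {G : AbelianMonoid} (F : label -> G) (n : nat) : G :=
  sum_n (fun p =>
    sum_n (fun a =>
      sum_n (fun b => plus (F (label_at true n p a b)) (F (label_at false n p a b)))
        (2 * (n - p) + 1))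
      (2 * p + 1))
    n.

Definition absolutely_summable (F : label -> C) : Prop :=
  ex_series (level_sum (fun k => Cmod (F k))).

Definition total (F : label -> C) : C :=
  (Series (level_sum (fun k => Re (F k))), Series (level_sum (fun k => Im (F k)))).

(** A vector is given by its coordinates in the orthonormal basis of kets; the
    Hilbert space [inH] is l^2 of the admissible labels. *)
Definition vec := label -> C.

Definition inH (f : vec) : Prop :=
  (forall k, admissible k = false -> f k = 0%C) /\
  ex_series (level_sum (fun k => Cmod (f k) ^ 2)).

Definition norm_sq (f : vec) : R := Series (level_sum (fun k => Cmod (f k) ^ 2)).

Definition inner (f g : vec) : C := total (fun k => (Cconj (f k) * g k)%C).

Definition vadd (f g : vec) : vec := fun k => (f k + g k)%C.
Definition vscal (c : C) (f : vec) : vec := fun k => (c * f k)%C.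

Definition label_eqb (k k' : label) : bool :=
  (eqb (chirality k) (chirality k') && Z.eqb (lab_l k) (lab_l k')
   && Z.eqb (lab_m1 k) (lab_m1 k') && Z.eqb (lab_m2 k) (lab_m2 k')
   && Z.eqb (lab_j k) (lab_j k')).

Definition ket_of (k : label) : vec :=
  fun k' => if (admissible k && label_eqb k k')%bool then 1%C else 0%C.

Definition ket (s : bool) (l m1 m2 j : Z) : vec := ket_of (Label s l m1 m2 j).

Definition op := vec -> vec.

Definition op_comp (T S : op) : op := fun f => T (S f).

(** Only the action on [inH] is meaningful. *)
Definition op_eq (T S : op) : Prop := forall f, inH f -> T f = S f.

Definition bounded_op (T : op) : Prop :=
  (forall f, inH f -> inH (T f)) /\
  (forall f g, inH f -> inH g -> T (vadd f g) = vadd (T f) (T g)) /\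
  (forall c f, inH f -> T (vscal c f) = vscal c (T f)) /\
  (exists M : R, forall f, inH f -> norm_sq (T f) <= M * norm_sq f).

Definition is_adjoint (T S : op) : Prop :=
  forall f g, inH f -> inH g -> inner (S f) g = inner f (T g).

(** [S] is the bounded extension of the commutator [N T - T N], where [N] is
    unbounded with domain the [f] in H such that [N f] is in H, and this domain
    is preserved by [T]. *)
Definition is_commutator (N T S : op) : Prop :=
  bounded_op T /\ bounded_op S /\
  forall f, inH f -> inH (N f) ->
    inH (N (T f)) /\ forall k, S f k = (N (T f) k - T (N f) k)%C.

(** x^z for x > 0. *)
Definition cpower (x : R) (z : C) : C :=
  (exp (Re z * ln x) * cos (Im z * ln x), exp (Re z * ln x) * sin (Im z * ln x)).

Definition eigenvalue (k : label) : R := half (lab_l k) + 3 / 2.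

Definition flip (k : label) : label :=
  Label (negb (chirality k)) (lab_l k) (lab_m1 k) (lab_m2 k) (lab_j k).

Definition Dirac : op := fun f k => (RtoC (eigenvalue k) * f (flip k))%C.

Definition grading : op :=
  fun f k => (RtoC (if chirality k then 1 else -1) * f k)%C.

Definition absD : op := fun f k => (RtoC (eigenvalue k) * f k)%C.

Definition absD_power (z : C) : op := fun f k => (cpower (eigenvalue k) z * f k)%C.

Lemma Dirac_ket (s : bool) (l m1 m2 j : Z) :
  Dirac (ket s l m1 m2 j) = vscal (RtoC (half l + 3 / 2)) (ket (negb s) l m1 m2 j).
Proof.
apply functional_extensionality; intros [s' l' m1' m2' j'].
unfold Dirac, vscal, ket, ket_of, flip, eigenvalue, label_eqb.
cbn [chirality lab_l lab_m1 lab_m2 lab_j].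
replace (eqb s (negb s')) with (eqb (negb s) s') by (destruct s, s'; reflexivity).
destruct (Z.eqb_spec l l') as [-> | Hl]; [reflexivity |].
assert (E : forall b1 b2 b3 b4 b5, (b1 && (b2 && false && b3 && b4 && b5) = false)%bool)
  by (intros [] [] [] [] []; reflexivity).
now rewrite !E, !Cmult_0_r.
Qed.

Lemma absD_absD (f : vec) : absD (absD f) = Dirac (Dirac f).
Proof.
apply functional_extensionality; intros [s l m1 m2 j].
unfold absD, Dirac, flip, eigenvalue; simpl; now rewrite negb_involutive.
Qed.

Lemma grading_Dirac (f : vec) : grading (Dirac f) = vscal (- (1))%C (Dirac (grading f)).
Proof.
apply functional_extensionality; intros [[] l m1 m2 j];
  unfold grading, Dirac, vscal, flip, eigenvalue; simpl;
  apply injective_projections; simpl; ring.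
Qed.

Definition qnum (q z : R) : R := (Rpower q z - Rpower q (- z)) / (q - / q).

Section Coefficients.

Variable q : R.

Local Notation "[ z ]" := (qnum q z).
Local Notation "'q^' z" := (Rpower q z) (at level 1, z at level 0).

(** The arguments [l], [j], [m1], [m2] below are doubled labels. *)

Definition eps (l j m2 : Z) : R :=
  / 2 * (if Z.even ((l + 1 - j - m2) / 2) then 1 else -1).

Definition A_p (dj dm1 : Z) : R :=
  let j := half dj in let m1 := half dm1 in
  q^(m1 - 1) * (sqrt ([j + m1 + 1] * [j - m1 + 1]) / [2 * j + 2]).

Definition A_0 (dj dm1 : Z) : R :=
  let j := half dj in let m1 := half dm1 in
  q^(-2) * ((q^(j + m1 + 1) * [2] * [j - m1] - [2 * j]) / ([2 * j] * [2 * j + 2])).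

Definition B_p (dj dm1 : Z) : R :=
  let j := half dj in let m1 := half dm1 in
  q^(- j + m1 - 1 / 2) * (sqrt ([j + m1 + 1] * [j + m1 + 2]) / [2 * j + 2]).

Definition B_0 (dj dm1 : Z) : R :=
  let j := half dj in let m1 := half dm1 in
  (1 + q ^ 2) * q^(m1 - 1 / 2) *
  (sqrt ([j - m1] * [j + m1 + 1]) / ([2 * j] * [2 * j + 2])).

Definition B_m (dj dm1 : Z) : R :=
  let j := half dj in let m1 := half dm1 in
  - q^(j + m1 + 1 / 2) * (sqrt ([j - m1] * [j - m1 - 1]) / [2 * j]).

Definition C_p (dl dj dm2 : Z) : R :=
  let l := half dl in let j := half dj in let m2 := half dm2 in
  let e := eps dl dj dm2 in
  - q^(m2 - 1 - e) *
  (sqrt ([l + j + m2 + 3 + e] * [l + j - m2 + 3 - e]) / [2 * l + 4]).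

Definition C_0 (dl dj dm2 : Z) : R :=
  let l := half dl in let j := half dj in let m2 := half dm2 in
  let e := eps dl dj dm2 in
  [4 * e] * q^(2 * e * l + m2 - 1 + 3 * e) *
  (sqrt ([l + 1 / 2 + j - 2 * e * m2 + 2] * [l + 1 / 2 - j - 2 * e * m2])
   / ([2 * l + 2] * [2 * l + 4])).

Definition C_m (dl dj dm2 : Z) : R :=
  let l := half dl in let j := half dj in let m2 := half dm2 in
  let e := eps dl dj dm2 in
  - q^(m2 - 1 + e) *
  (sqrt ([l - j + m2 - e] * [l - j - m2 + e]) / [2 * l + 2]).

Definition H_p (dl dj dm2 : Z) : R :=
  let l := half dl in let j := half dj in let m2 := half dm2 in
  let e := eps dl dj dm2 in
  q^(m2 - 1 + e * (2 * j + 1)) *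
  (sqrt ([l + 2 * e * j - m2 + 2 + e] * [l - 2 * e * j + m2 + 2 - e]) / [2 * l + 4]).

Definition H_0 (dl dj dm2 : Z) : R :=
  let l := half dl in let j := half dj in let m2 := half dm2 in
  let e := eps dl dj dm2 in
  ([l - e * (2 * j + 1) - m2 + 1] * [l - e * (2 * j + 1) + m2 + 2]
   - q^(-2) * [l + e * (2 * j + 1) - m2 + 2] * [l + e * (2 * j + 1) + m2 + 1])
  / ([2 * l + 2] * [2 * l + 4]).

Definition D_p (dl dj dm2 : Z) : R :=
  let l := half dl in let j := half dj in let m2 := half dm2 in
  let e := eps dl dj dm2 in
  q^(- l + m2 - 3 / 2) *
  (sqrt ([l + j + m2 + 3 + e] * [l - j + m2 + 2 - e]) / [2 * l + 4]).

Definition D_0 (dl dj dm2 : Z) : R :=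
  let l := half dl in let j := half dj in let m2 := half dm2 in
  let e := eps dl dj dm2 in
  [2] * q^(m2 + 1 / 2) *
  (sqrt ([l - 2 * e * j - m2 + 1 - e] * [l - 2 * e * j + m2 + 2 - e])
   / ([2 * l + 2] * [2 * l + 4])).

Definition D_m (dl dj dm2 : Z) : R :=
  let l := half dl in let j := half dj in let m2 := half dm2 in
  let e := eps dl dj dm2 in
  - q^(l + m2 + 3 / 2) *
  (sqrt ([l - j - m2 + e] * [l + j - m2 + 1 - e]) / [2 * l + 2]).

End Coefficients.

Declare Scope vec_scope.
Delimit Scope vec_scope with vec.
Notation "u + v" := (vadd u v) : vec_scope.
Notation "r *: v" := (vscal (RtoC r%R) v%vec) (at level 40) : vec_scope.

(** Value of x0, x1, x2 on |l/2, m1/2, m2/2; j/2>, with sign s; the labels being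
    doubled, a shift by one is a shift by 2. *)
Definition x0_ket (q : R) (s : bool) (l m1 m2 j : Z) : vec :=
  let pm := if s then 1 else -1 in
  ( (A_p q j m1 * C_p q l j m2) *: ket s (l + 2) m1 m2 (j + 2)
  + (- pm * (A_p q j m1 * C_0 q l j m2)) *: ket s l m1 m2 (j + 2)
  + (A_p q j m1 * C_m q l j m2) *: ket s (l - 2) m1 m2 (j + 2)
  + (A_0 q j m1 * H_p q l j m2) *: ket s (l + 2) m1 m2 j
  + (pm * (A_0 q j m1 * H_0 q l j m2)) *: ket s l m1 m2 j
  + (A_0 q j m1 * H_p q (l - 2) j m2) *: ket s (l - 2) m1 m2 j
  + (A_p q (j - 2) m1 * C_m q (l + 2) (j - 2) m2) *: ket s (l + 2) m1 m2 (j - 2)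
  + (- pm * (A_p q (j - 2) m1 * C_0 q l (j - 2) m2)) *: ket s l m1 m2 (j - 2)
  + (A_p q (j - 2) m1 * C_p q (l - 2) (j - 2) m2) *: ket s (l - 2) m1 m2 (j - 2)
  )%vec.

Definition x1_ket (q : R) (s : bool) (l m1 m2 j : Z) : vec :=
  let pm := if s then 1 else -1 in
  ( (B_p q j m1 * C_p q l j m2) *: ket s (l + 2) (m1 + 2) m2 (j + 2)
  + (- pm * (B_p q j m1 * C_0 q l j m2)) *: ket s l (m1 + 2) m2 (j + 2)
  + (B_p q j m1 * C_m q l j m2) *: ket s (l - 2) (m1 + 2) m2 (j + 2)
  + (B_0 q j m1 * H_p q l j m2) *: ket s (l + 2) (m1 + 2) m2 j
  + (pm * (B_0 q j m1 * H_0 q l j m2)) *: ket s l (m1 + 2) m2 j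
  + (B_0 q j m1 * H_p q (l - 2) j m2) *: ket s (l - 2) (m1 + 2) m2 j
  + (B_m q j m1 * C_m q (l + 2) (j - 2) m2) *: ket s (l + 2) (m1 + 2) m2 (j - 2)
  + (- pm * (B_m q j m1 * C_0 q l (j - 2) m2)) *: ket s l (m1 + 2) m2 (j - 2)
  + (B_m q j m1 * C_p q (l - 2) (j - 2) m2) *: ket s (l - 2) (m1 + 2) m2 (j - 2)
  )%vec.

Definition x2_ket (q : R) (s : bool) (l m1 m2 j : Z) : vec :=
  let pm := if s then 1 else -1 in
  ( D_p q l j m2 *: ket s (l + 2) m1 (m2 + 2) j
  + (pm * D_0 q l j m2) *: ket s l m1 (m2 + 2) j
  + D_m q l j m2 *: ket s (l - 2) m1 (m2 + 2) j
  )%vec.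

(** [pi] is the bounded unital *-representation of the algebra on H given on
    the basis by the formulas above; these conditions determine it. *)
Record spinor_representation (q : R) (pi : star_poly -> op) : Prop := {
  rep_bounded : forall a, bounded_op (pi a);
  rep_compat : forall a b, sphere_eq q a b -> op_eq (pi a) (pi b);
  rep_scalar : forall c, op_eq (pi (Scalar c)) (vscal c);
  rep_add : forall a b, op_eq (pi (Add a b)) (fun f => vadd (pi a f) (pi b f));
  rep_mul : forall a b, op_eq (pi (Mul a b)) (op_comp (pi a) (pi b));
  rep_star : forall a, is_adjoint (pi a) (pi (Star a));
  rep_x0 : forall s l m1 m2 j, admissible (Label s l m1 m2 j) = true ->
    pi (Gen X0) (ket s l m1 m2 j) = x0_ket q s l m1 m2 j;
  rep_x1 : forall s l m1 m2 j, admissible (Label s l m1 m2 j) = true ->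
    pi (Gen X1) (ket s l m1 m2 j) = x1_ket q s l m1 m2 j;
  rep_x2 : forall s l m1 m2 j, admissible (Label s l m1 m2 j) = true ->
    pi (Gen X2) (ket s l m1 m2 j) = x2_ket q s l m1 m2 j
}.

(** [delta_iter k T S] : S = delta^k(T), where delta(T) = [|D|, T]. *)
Fixpoint delta_iter (k : nat) (T S : op) : Prop :=
  match k with
  | O => bounded_op T /\ bounded_op S /\ op_eq T S
  | Datatypes.S k' => exists T', delta_iter k' T T' /\ is_commutator absD T' S
  end.

Definition in_A_or_DA (pi : star_poly -> op) (T : op) : Prop :=
  exists a : star_poly, op_eq T (pi a) \/ is_commutator Dirac (pi a) T.

Inductive Psi0 (pi : star_poly -> op) : op -> Prop :=
| Psi0_gen k T S : in_A_or_DA pi T -> delta_iter k T S -> Psi0 pi S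
| Psi0_add T S : Psi0 pi T -> Psi0 pi S -> Psi0 pi (fun f => vadd (T f) (S f))
| Psi0_scal c T : Psi0 pi T -> Psi0 pi (fun f => vscal c (T f))
| Psi0_comp T S : Psi0 pi T -> Psi0 pi S -> Psi0 pi (op_comp T S).

(** Trace in the orthonormal basis of kets: the coordinate [T (ket_of k) k] is
    the diagonal matrix element <k|T|k>. *)
Definition is_trace (T : op) (t : C) : Prop :=
  absolutely_summable (fun k => T (ket_of k) k) /\
  t = total (fun k => T (ket_of k) k).

Definition holomorphic_at (F : C -> C) (p : C) : Prop :=
  locally p (fun s : C => ex_derive F s).

Definition pole_of_order (F : C -> C) (p : C) (n : nat) : Prop :=
  (1 <= n)%nat /\
  exists g : C -> C, holomorphic_at g p /\ g p <> 0%C /\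
    locally' p (fun s : C => F s = (g s / Cpow (s - p) n)%C).

Definition is_pole (F : C -> C) (p : C) : Prop := exists n, pole_of_order F p n.

Definition meromorphic_on (U : C -> Prop) (F : C -> C) : Prop :=
  forall p, U p -> holomorphic_at F p \/ is_pole F p.

Definition is_residue (F : C -> C) (p r : C) : Prop :=
  exists (h : C -> C) (m : nat) (c : nat -> C), holomorphic_at h p /\
    locally' p (fun s : C =>
      F s = (h s + r / (s - p) + sum_n (fun k => c k / Cpow (s - p) (k + 2)) m)%C).

(** [F] is a meromorphic function on the half plane Re s > x0 that extends
    s |-> Tr(T |D|^{-s}), the latter being given by a convergent trace for
    Re s > x1. *)
Definition zeta_extension (x0 x1 : R) (T : op) (F : C -> C) : Prop :=
  meromorphic_on (fun s => x0 < Re s) F /\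
  forall s : C, x1 < Re s -> is_trace (op_comp T (absD_power (- s)%C)) (F s).

(** The singularities in Re s > x0 of the functions [Z T], [T] in Psi^0. *)
Definition dimension_spectrum (pi : star_poly -> op) (Z : op -> C -> C) (x0 : R)
    (p : C) : Prop :=
  x0 < Re p /\ exists T, Psi0 pi T /\ is_pole (Z T) p.

(* Main.v *)
Require Import Defs.
From Stdlib Require Import Reals ZArith Lia Lra List FunctionalExtensionality ClassicalEpsilon.
From Coquelicot Require Import Coquelicot.
Import ListNotations.

Open Scope R_scope.

(** The kets of eigenvalue N = l + 3/2 are indexed by j and by the distances j + m1 and l - j + m2 of
    m1 and m2 to the lower ends of their ranges. Up to matrix coefficients of size
    O(q^j + q^(j + m1) q^(l - j + m2)), every element of Psi^0 is a finite sum of shifts whose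
    coefficients are functions f + g(l - j + m2), with f constant and g exponentially small; only the
    shifts by multiples of (l, m2) -> (l + 1, m2 + 1) have f <> 0. Indeed x0 is negligible, x1 is a
    shift with f = 0 and x2 is the basic shift with f = 1; the two chiral representations agree up to
    O(q^(2l)), so commutators with D bring nothing new. The constants f multiply under composition:
    on the algebra they are the Fourier coefficients of the restriction to the classical points.

    Summing diagonal entries over the eigenspace gives (4/3) f N^3 + b N^2 + O(N), hence
    Tr(T |D|^(-s)) = (4/3) f zeta(s - 3) + b zeta(s - 2) + (holomorphic for Re s > 2). The zeta
    function is continued to Re w > -1 by the trapezoidal rule. The identity has f = 1, and x1^* x1
    has f = 0 and b <> 0, so that both poles occur. *)

(** Shifts with a non-negligible coefficient therefore keep the distances of [m1] and [m2] to the
    upper ends of their ranges, so that they are cut off only at small [j] or at a lower end. A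
    defect at small [j] is [O(q^j)], and one at the lower end of [m2] is absorbed by [g]. One at the
    lower end of [m1] is negligible only when multiplied by [q^(l - j + m2)]; hence a constant
    [f <> 0] is allowed only for shifts fixing [j], which then fix [m1] as well.

    The pole at 3 is obtained without computing [b]: the diagonal entries of [x1^* x1] are squared
    norms, so nothing can cancel the quadratically many entries at the lowest [m2].

    The factor [2 / (3 PI)] is [4 / 3] divided by the length [2 PI] of the circle, because [f] is a
    mean value. *)

(** * Complex differentiability and exclusion of poles *)

Lemma Cmod_le_Rabs (z : C) : Cmod z <= Rabs (Re z) + Rabs (Im z).
Proof.
unfold Cmod; fold (Re z) (Im z).
apply Rsqr_incr_0_var; [|pose proof (Rabs_pos (Re z)); pose proof (Rabs_pos (Im z)); lra].
rewrite Rsqr_sqrt by nra.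
assert (H := Rsqr_abs (Re z)); assert (H' := Rsqr_abs (Im z)); unfold Rsqr in *.
pose proof (Rabs_pos (Re z)); pose proof (Rabs_pos (Im z)); nra.
Qed.

Lemma Rabs_Im_le_Cmod (z : C) : Rabs (Im z) <= Cmod z.
Proof. generalize (Rmax_Cmod z); apply Rle_trans, Rmax_r. Qed.

Lemma Cmod_minus_le (y z : C) : Cmod (y - z) <= Cmod y + Cmod z.
Proof. unfold Cminus; rewrite <- (Cmod_opp z); apply Cmod_triangle. Qed.

Lemma Cmod_minus_ge (y z : C) : Cmod y - Cmod z <= Cmod (y - z).
Proof.
replace y with ((y - z) + z)%C at 1 by ring.
pose proof (Cmod_triangle (y - z) z); lra.
Qed.

Lemma Re_le_abs_add (z h : C) : Re z - Cmod h <= Re (z + h) <= Re z + Cmod h.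
Proof.
rewrite re_plus; pose proof (re_le_Cmod h) as H.
apply Rabs_le_between in H; lra.
Qed.

(** A quadratic remainder is stronger than differentiability, but it passes to majorized series
    without Cauchy's theorem. *)
Definition cdiff_with (F : C -> C) (s l : C) : Prop :=
  exists K d : R, 0 <= K /\ 0 < d /\
    forall h : C, Cmod h < d -> Cmod (F (s + h)%C - F s - h * l)%C <= K * Cmod h ^ 2.

Definition cdiff (F : C -> C) (s : C) : Prop := exists l, cdiff_with F s l.

Lemma cdiff_ex_derive (F : C -> C) (s : C) :
  cdiff F s -> @ex_derive C_AbsRing C_NormedModule F s.
Proof.
intros [l (K & d & HK & Hd & H)]; exists l; split.
- apply (@is_linear_scal_l C_AbsRing C_NormedModule).
- intros x Hx; apply (@is_filter_lim_locally_unique C_AbsRing (AbsRing_NormedModule C_AbsRing)) in Hx; subst x.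
  intros eps.
  assert (Heps := cond_pos eps).
  assert (Hd' : 0 < Rmin d (eps / (K + 1))).
  { apply Rmin_pos; [lra|apply Rdiv_lt_0_compat; lra]. }
  exists (mkposreal _ Hd'); intros y Hy.
  change (Cmod (y - s)%C < Rmin d (eps / (K + 1))) in Hy.
  change (Cmod (F y - F s - (y - s) * l)%C <= eps * Cmod (y - s)%C).
  specialize (H (y - s)%C).
  assert (Ey : forall a b : C, (a + (b - a))%C = b) by (intros; ring).
  rewrite Ey in H.
  assert (H1 : Cmod (y - s)%C < d) by (apply Rlt_le_trans with (1 := Hy), Rmin_l).
  assert (H2 : Cmod (y - s)%C < eps / (K + 1)) by (apply Rlt_le_trans with (1 := Hy), Rmin_r).
  specialize (H H1).
  apply Rle_trans with (1 := H).
  apply Rmult_lt_compat_r with (r := K + 1) in H2; [|lra].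
  replace (eps / (K + 1) * (K + 1)) with (pos eps) in H2 by (field; lra).
  pose proof (Cmod_ge_0 (y - s)%C) as H3; nra.
Qed.

Lemma locally_C_cmod (s : C) (P : C -> Prop) (d : R) :
  0 < d -> (forall t, Cmod (t - s)%C < d -> P t) -> @locally C_UniformSpace s P.
Proof.
intros Hd H; apply locally_C; exists (mkposreal _ Hd); intros y Hy; apply H; exact Hy.
Qed.

Lemma locally_C_cmod_inv (s : C) (P : C -> Prop) :
  @locally C_UniformSpace s P -> exists d, 0 < d /\ forall t, Cmod (t - s)%C < d -> P t.
Proof.
intros H; apply locally_C in H; destruct H as [d H].
exists d; split; [apply cond_pos|]; intros t Ht; apply H; exact Ht.
Qed.

Lemma cdiff_ext_loc (F G : C -> C) (s : C) (d : R) :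
  0 < d -> (forall h, Cmod h < d -> F (s + h)%C = G (s + h)%C) -> cdiff F s -> cdiff G s.
Proof.
intros Hd E [l (K & e & HK & He & H)]; exists l, K, (Rmin d e).
repeat split; [exact HK|apply Rmin_pos; assumption|].
intros h Hh; rewrite <- E by (apply Rlt_le_trans with (1 := Hh), Rmin_l).
replace (G s) with (F s).
- apply H, Rlt_le_trans with (1 := Hh), Rmin_r.
- rewrite <- (Cplus_0_r s); apply E; rewrite Cmod_0; lra.
Qed.

Lemma cdiff_const (c s : C) : cdiff (fun _ => c) s.
Proof.
exists 0%C, 0, 1; repeat split; try lra; intros h _.
replace (c - c - h * 0)%C with (RtoC 0) by ring; rewrite Cmod_0; lra.
Qed.

Lemma cdiff_id (s : C) : cdiff (fun z => z) s.
Proof.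
exists 1%C, 0, 1; repeat split; try lra; intros h _.
replace (s + h - s - h * 1)%C with (RtoC 0) by ring; rewrite Cmod_0; lra.
Qed.

Lemma cdiff_plus (F G : C -> C) (s : C) :
  cdiff F s -> cdiff G s -> cdiff (fun z => F z + G z)%C s.
Proof.
intros [l (K & d & HK & Hd & H)] [l' (K' & d' & HK' & Hd' & H')].
exists (l + l')%C, (K + K'), (Rmin d d'); repeat split; [lra|now apply Rmin_pos|].
intros h Hh.
specialize (H h (Rlt_le_trans _ _ _ Hh (Rmin_l _ _))).
specialize (H' h (Rlt_le_trans _ _ _ Hh (Rmin_r _ _))).
replace (F (s + h) + G (s + h) - (F s + G s) - h * (l + l'))%C
  with ((F (s + h) - F s - h * l) + (G (s + h) - G s - h * l'))%C by ring.
eapply Rle_trans; [apply Cmod_triangle|]; lra.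
Qed.

Lemma cdiff_mult (F G : C -> C) (s : C) :
  cdiff F s -> cdiff G s -> cdiff (fun z => F z * G z)%C s.
Proof.
intros [l (K & d & HK & Hd & H)] [l' (K' & d' & HK' & Hd' & H')].
set (A := Cmod l + K).
(* The radius is capped by 1 so that [Cmod h ^ 2 <= Cmod h]: each factor is then Lipschitz at [s],
   and the product of the two increments is quadratic. *)
exists (l * G s + F s * l')%C,
  (K * Cmod (G s) + Cmod (F s) * K' + A * (Cmod l' + K')), (Rmin 1 (Rmin d d')).
pose proof (Cmod_ge_0 (F s)); pose proof (Cmod_ge_0 (G s)).
pose proof (Cmod_ge_0 l); pose proof (Cmod_ge_0 l').
repeat split; [unfold A; nra|repeat apply Rmin_pos; lra|].
intros h Hh.
assert (Hh1 : Cmod h < 1) by (apply Rlt_le_trans with (1 := Hh), Rmin_l).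
assert (Hh2 : Cmod h < Rmin d d') by (apply Rlt_le_trans with (1 := Hh), Rmin_r).
specialize (H h (Rlt_le_trans _ _ _ Hh2 (Rmin_l _ _))).
specialize (H' h (Rlt_le_trans _ _ _ Hh2 (Rmin_r _ _))).
pose proof (Cmod_ge_0 h) as Hh0.
assert (Ha : Cmod (F (s + h) - F s)%C <= A * Cmod h).
{ replace (F (s + h) - F s)%C with ((F (s + h) - F s - h * l) + h * l)%C by ring.
  eapply Rle_trans; [apply Cmod_triangle|]; rewrite Cmod_mult; unfold A.
  assert (K * Cmod h ^ 2 <= K * Cmod h) by (apply Rmult_le_compat_l; nra). nra. }
assert (Hb : Cmod (G (s + h) - G s)%C <= (Cmod l' + K') * Cmod h).
{ replace (G (s + h) - G s)%C with ((G (s + h) - G s - h * l') + h * l')%C by ring.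
  eapply Rle_trans; [apply Cmod_triangle|]; rewrite Cmod_mult.
  assert (K' * Cmod h ^ 2 <= K' * Cmod h) by (apply Rmult_le_compat_l; nra). nra. }
replace (F (s + h) * G (s + h) - F s * G s - h * (l * G s + F s * l'))%C
  with ((F (s + h) - F s - h * l) * G s + F s * (G (s + h) - G s - h * l')
        + (F (s + h) - F s) * (G (s + h) - G s))%C by ring.
eapply Rle_trans; [apply Cmod_triangle|].
eapply Rle_trans; [apply Rplus_le_compat_r, Cmod_triangle|].
rewrite !Cmod_mult.
assert (Cmod (F (s + h) - F s)%C * Cmod (G (s + h) - G s)%C
        <= (A * Cmod h) * ((Cmod l' + K') * Cmod h)).
{ apply Rmult_le_compat; try apply Cmod_ge_0; assumption. }
nra.
Qed.

Lemma cdiff_shift (F : C -> C) (s c : C) :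
  cdiff F (s + c)%C -> cdiff (fun z => F (z + c)%C) s.
Proof.
intros [l (K & d & HK & Hd & H)]; exists l, K, d; repeat split; [exact HK|exact Hd|].
intros h Hh; specialize (H h Hh).
now replace (s + h + c)%C with (s + c + h)%C by ring.
Qed.

Lemma cdiff_inv (s : C) : s <> 0%C -> cdiff (fun z => / z)%C s.
Proof.
intros Hs; assert (H0 : 0 < Cmod s) by now apply Cmod_gt_0.
assert (Hi : 0 < / Cmod s) by now apply Rinv_0_lt_compat.
(* The remainder is exactly [h^2 / ((s + h) s^2)], and [Cmod (s + h) >= Cmod s / 2] on this disc. *)
exists (- (/ s * / s))%C, (2 * (/ Cmod s) ^ 3), (Cmod s / 2); repeat split.
- assert (0 < (/ Cmod s) ^ 3) by now apply pow_lt. lra.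
- lra.
- intros h Hh.
  assert (Hsh : Cmod s / 2 <= Cmod (s + h)%C).
  { pose proof (Cmod_minus_ge s (- h)%C) as H1; rewrite Cmod_opp in H1.
    replace (s - - h)%C with (s + h)%C in H1 by ring; lra. }
  assert (Hn : (s + h)%C <> 0%C) by (apply Cmod_gt_0; lra).
  replace (/ (s + h) - / s - h * - (/ s * / s))%C
    with (h * h * (/ (s + h) * / s * / s))%C by (field; split; assumption).
  rewrite !Cmod_mult, !Cmod_inv by assumption.
  assert (Hb : / Cmod (s + h)%C <= 2 * / Cmod s).
  { replace (2 * / Cmod s) with (/ (Cmod s / 2)) by (field; lra).
    apply Rinv_le_contravar; lra. }
  pose proof (Cmod_ge_0 h).
  assert (H2 : 0 <= Cmod h * Cmod h * (/ Cmod s * / Cmod s)) by nra.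
  pose proof (Rmult_le_compat_l _ _ _ H2 Hb); nra.
Qed.

Lemma cdiff_bounded (F : C -> C) (s : C) :
  cdiff F s -> exists K d, 0 < d /\ forall h, Cmod h < d -> Cmod (F (s + h)%C) <= K.
Proof.
intros [l (K & d & HK & Hd & H)].
exists (Cmod (F s) + Cmod l * d + K * d ^ 2), d; split; [exact Hd|].
intros h Hh; specialize (H h Hh).
replace (F (s + h)%C) with ((F (s + h) - F s - h * l) + (F s + h * l))%C by ring.
eapply Rle_trans; [apply Cmod_triangle|].
pose proof (Cmod_triangle (F s) (h * l)%C) as Ht; rewrite Cmod_mult in Ht.
pose proof (Cmod_ge_0 h); pose proof (Cmod_ge_0 l).
assert (K * Cmod h ^ 2 <= K * d ^ 2) by (apply Rmult_le_compat_l; [lra|apply pow_incr; lra]).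
nra.
Qed.

Lemma holomorphic_near_nonzero (g : C -> C) (p : C) :
  holomorphic_at g p -> g p <> 0%C ->
  exists e d, 0 < e /\ 0 < d /\ forall t, Cmod (t - p)%C < d -> e <= Cmod (g t).
Proof.
intros Hg Hgp.
assert (H0 : 0 < Cmod (g p)) by now apply Cmod_gt_0.
assert (Hc := ex_derive_continuous (V := C_NormedModule) g p
                (@locally_singleton C_UniformSpace p _ Hg)).
(* A ball of the uniform structure of [C] bounds the modulus only up to a factor [sqrt 2 <= 2], so
   this radius still leaves half of [Cmod (g p)]. *)
assert (He : 0 < Cmod (g p) / 4) by lra.
specialize (Hc (@ball C_UniformSpace (g p) (mkposreal _ He))
              (locally_ball (g p) (mkposreal _ He))).
destruct Hc as [d Hd]; exists (Cmod (g p) / 4), d.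
repeat split; [exact He|apply cond_pos|].
intros t Ht; specialize (Hd t Ht).
apply C_NormedModule_mixin_compat2 in Hd.
change (Cmod (g t - g p)%C < sqrt 2 * (Cmod (g p) / 4)) in Hd.
assert (Hs : sqrt 2 <= 2).
{ rewrite <- (sqrt_square 2) at 2 by lra; apply sqrt_le_1_alt; lra. }
assert (Hm := Cmod_minus_ge (g p) (g p - g t)%C).
replace (g p - (g p - g t))%C with (g t) in Hm by ring.
replace (Cmod (g p - g t)%C) with (Cmod (g t - g p)%C) in Hm.
- nra.
- rewrite <- Cmod_opp; f_equal; ring.
Qed.

(** Near a pole the modulus is at least [e / r^n] at distance [r], while differentiability keeps it
    bounded; a single test point [p + r] is enough for the contradiction, for every order at
    once. *)
Lemma cdiff_not_pole (F : C -> C) (p : C) : cdiff F p -> ~ is_pole F p.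
Proof.
intros HF (n & Hn & g & Hg & Hgp & Hl).
destruct (cdiff_bounded _ _ HF) as (K & d & Hd & HK).
destruct (holomorphic_near_nonzero _ _ Hg Hgp) as (e & d' & He & Hd' & Hge).
destruct (locally_C_cmod_inv _ _ Hl) as (d'' & Hd'' & HF').
set (K' := Rabs K + 1).
assert (HK' : 1 <= K') by (unfold K'; pose proof (Rabs_pos K); lra).
(* Besides staying within the three discs, [r < 1] gives [r ^ n <= r], and [r <= e / (2 * K')] makes
   [e / r] exceed the bound [K]. *)
set (r := Rmin (Rmin (d / 2) (d' / 2)) (Rmin (d'' / 2) (Rmin (1 / 2) (e / (2 * K'))))).
assert (Hr : 0 < r).
{ unfold r; repeat apply Rmin_pos; try lra; apply Rdiv_lt_0_compat; lra. }
assert (Hr1 : r <= d / 2) by (unfold r; eapply Rle_trans; [apply Rmin_l|apply Rmin_l]).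
assert (Hr2 : r <= d' / 2) by (unfold r; eapply Rle_trans; [apply Rmin_l|apply Rmin_r]).
assert (Hr3 : r <= d'' / 2) by (unfold r; eapply Rle_trans; [apply Rmin_r|apply Rmin_l]).
assert (Hr4 : r <= 1 / 2).
{ unfold r; eapply Rle_trans; [apply Rmin_r|eapply Rle_trans; [apply Rmin_r|apply Rmin_l]]. }
assert (Hr5 : r <= e / (2 * K')).
{ unfold r; eapply Rle_trans; [apply Rmin_r|eapply Rle_trans; [apply Rmin_r|apply Rmin_r]]. }
assert (Hmr : Cmod (RtoC r) = r) by (rewrite Cmod_R; apply Rabs_pos_eq; lra).
assert (E : (p + r - p)%C = RtoC r) by ring.
assert (Hrn : RtoC r <> 0%C) by (apply Cmod_gt_0; lra).
assert (H1 : Cmod (F (p + r)%C) <= K) by (apply HK; lra).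
assert (H2 : e <= Cmod (g (p + r)%C)) by (apply Hge; rewrite E; lra).
assert (H3 : F (p + r)%C = (g (p + r) / Cpow (p + r - p) n)%C).
{ apply HF'; [rewrite E; lra|].
  intros Heq; apply Hrn; rewrite <- E, Heq; ring. }
rewrite H3, E, Cmod_div, Cmod_pow, Hmr in H1 by now apply Cpow_nz.
assert (Hpow : r ^ n <= r).
{ destruct n as [|n]; [lia|]; simpl.
  assert (r ^ n <= 1 ^ n) by (apply pow_incr; lra). rewrite pow1 in H; nra. }
assert (Hp0 : 0 < r ^ n) by now apply pow_lt.
apply Rmult_le_compat_r with (r := r ^ n) in H1; [|lra].
replace (Cmod (g (p + r)%C) / r ^ n * r ^ n) with (Cmod (g (p + r)%C)) in H1 by (field; lra).
assert (HK2 : K <= K') by (unfold K'; pose proof (Rle_abs K); lra).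
apply Rmult_le_compat_r with (r := 2 * K') in Hr5; [|lra].
replace (e / (2 * K') * (2 * K')) with e in Hr5 by (field; lra).
nra.
Qed.

(** * Series of complex numbers *)

Definition CSeries (u : nat -> C) : C :=
  (Series (fun n => Re (u n)), Series (fun n => Im (u n))).

Lemma Re_sum_n (u : nat -> C) (n : nat) : Re (sum_n u n) = sum_n (fun i => Re (u i)) n.
Proof. induction n as [|n IH]; [now rewrite !sum_O|]; rewrite !sum_Sn, <- IH; reflexivity. Qed.

Lemma Im_sum_n (u : nat -> C) (n : nat) : Im (sum_n u n) = sum_n (fun i => Im (u i)) n.
Proof. induction n as [|n IH]; [now rewrite !sum_O|]; rewrite !sum_Sn, <- IH; reflexivity. Qed.

Definition abs_conv (u : nat -> C) : Prop := ex_series (fun n => Cmod (u n)).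

Lemma abs_conv_Re (u : nat -> C) : abs_conv u -> ex_series (fun n => Re (u n)).
Proof.
intros H; apply (@ex_series_le R_AbsRing R_CompleteNormedModule) with (2 := H).
intros n; apply re_le_Cmod.
Qed.

Lemma abs_conv_Im (u : nat -> C) : abs_conv u -> ex_series (fun n => Im (u n)).
Proof.
intros H; apply (@ex_series_le R_AbsRing R_CompleteNormedModule) with (2 := H).
intros n; apply Rabs_Im_le_Cmod.
Qed.

Lemma ex_series_le_R (u v : nat -> R) :
  (forall n, 0 <= u n <= v n) -> ex_series v -> ex_series u.
Proof.
intros H; apply (@ex_series_le R_AbsRing R_CompleteNormedModule).
intros n; change (Rabs (u n) <= v n); rewrite Rabs_pos_eq; apply H.
Qed.

Lemma abs_conv_le (u : nat -> C) (v : nat -> R) :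
  (forall n, Cmod (u n) <= v n) -> ex_series v -> abs_conv u.
Proof. intros H; apply ex_series_le_R; intros n; split; [apply Cmod_ge_0|apply H]. Qed.

Lemma abs_conv_plus (u v : nat -> C) :
  abs_conv u -> abs_conv v -> abs_conv (fun n => u n + v n)%C.
Proof.
intros Hu Hv; apply abs_conv_le with (fun n => Cmod (u n) + Cmod (v n)).
- intros n; apply Cmod_triangle.
- apply (ex_series_plus (V := R_NormedModule)); assumption.
Qed.

Lemma abs_conv_scal (c : C) (u : nat -> C) : abs_conv u -> abs_conv (fun n => c * u n)%C.
Proof.
intros Hu; apply abs_conv_le with (fun n => Cmod c * Cmod (u n)).
- intros n; rewrite Cmod_mult; lra.
- apply (ex_series_scal (V := R_NormedModule)); assumption.
Qed.

Lemma CSeries_ext (u v : nat -> C) : (forall n, u n = v n) -> CSeries u = CSeries v.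
Proof. intros H; unfold CSeries; f_equal; apply Series_ext; intros n; now rewrite H. Qed.

Lemma CSeries_plus (u v : nat -> C) : abs_conv u -> abs_conv v ->
  CSeries (fun n => u n + v n)%C = (CSeries u + CSeries v)%C.
Proof.
intros Hu Hv; unfold CSeries.
rewrite (Series_ext _ (fun n => Re (u n) + Re (v n))) by (intros n; apply re_plus).
rewrite (Series_ext (fun n => Im (u n + v n)%C) (fun n => Im (u n) + Im (v n)))
  by (intros n; apply im_plus).
rewrite !Series_plus by (apply abs_conv_Re || apply abs_conv_Im; assumption).
reflexivity.
Qed.

Lemma CSeries_scal (c : C) (u : nat -> C) : abs_conv u ->
  CSeries (fun n => c * u n)%C = (c * CSeries u)%C.
Proof.
intros Hu; unfold CSeries.
rewrite (Series_ext _ (fun n => Re c * Re (u n) - Im c * Im (u n))) by (intros n; apply re_mult).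
rewrite (Series_ext (fun n => Im (c * u n)%C) (fun n => Re c * Im (u n) + Im c * Re (u n)))
  by (intros n; apply im_mult).
pose proof (abs_conv_Re _ Hu); pose proof (abs_conv_Im _ Hu).
rewrite Series_minus, Series_plus, !Series_scal_l
  by (apply (ex_series_scal (V := R_NormedModule)); assumption).
reflexivity.
Qed.

Lemma CSeries_minus (u v : nat -> C) : abs_conv u -> abs_conv v ->
  CSeries (fun n => u n - v n)%C = (CSeries u - CSeries v)%C.
Proof.
intros Hu Hv.
rewrite (CSeries_ext _ (fun n => u n + (- (1)) * v n)%C) by (intros; ring).
rewrite CSeries_plus, CSeries_scal; [ring|assumption|assumption|now apply abs_conv_scal].
Qed.

(** The factor 2 comes from bounding the real and the imaginary part separately. *)
Lemma Cmod_CSeries_le (u : nat -> C) (v : nat -> R) :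
  (forall n, Cmod (u n) <= v n) -> ex_series v -> Cmod (CSeries u) <= 2 * Series v.
Proof.
intros H Hv.
assert (Hb : forall w : nat -> R, (forall n, Rabs (w n) <= v n) -> Rabs (Series w) <= Series v).
{ intros w Hw; eapply Rle_trans; [apply Series_Rabs|].
  - apply ex_series_le_R with v; [|exact Hv]; intros n; split; [apply Rabs_pos|apply Hw].
  - apply Series_le; [|exact Hv]; intros n; split; [apply Rabs_pos|apply Hw]. }
eapply Rle_trans; [apply Cmod_le_Rabs|].
assert (Rabs (Re (CSeries u)) <= Series v).
{ apply Hb; intros n; eapply Rle_trans; [apply re_le_Cmod|apply H]. }
assert (Rabs (Im (CSeries u)) <= Series v).
{ apply Hb; intros n; eapply Rle_trans; [apply Rabs_Im_le_Cmod|apply H]. }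
lra.
Qed.

(** Quadratic remainders can be summed termwise, so one summable majorant for values, derivatives
    and remainders does the work of the theorem on uniform limits of holomorphic functions. *)
Lemma CSeries_cdiff (f f' : nat -> C -> C) (s : C) (M : nat -> R) (d : R) :
  0 < d -> ex_series M ->
  (forall n, Cmod (f' n s) <= M n) ->
  (forall n h, Cmod h < d -> Cmod (f n (s + h)%C) <= M n) ->
  (forall n h, Cmod h < d ->
     Cmod (f n (s + h)%C - f n s - h * f' n s)%C <= M n * Cmod h ^ 2) ->
  cdiff (fun z => CSeries (fun n => f n z)) s.
Proof.
intros Hd HM H1 H2 H3.
assert (HM0 : 0 <= Series M).
{ assert (E0 : Series (fun n : nat => 0) = 0).
  { apply is_series_unique, filterlim_ext with (fun _ : nat => 0).
    - intros n; rewrite sum_n_const; ring.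
    - apply filterlim_const. }
  rewrite <- E0; apply Series_le; [|exact HM].
  intros n; split; [lra|]; eapply Rle_trans; [apply Cmod_ge_0|apply (H1 n)]. }
exists (CSeries (fun n => f' n s)), (2 * Series M), d.
repeat split; [lra|exact Hd|].
assert (C1 : abs_conv (fun n => f' n s)) by (apply abs_conv_le with M; assumption).
assert (C2 : forall h, Cmod h < d -> abs_conv (fun n => f n (s + h)%C)).
{ intros h Hh; apply abs_conv_le with M; [intros n; now apply H2|exact HM]. }
assert (C3 : abs_conv (fun n => f n s)).
{ assert (H0 : Cmod (RtoC 0) < d) by now rewrite Cmod_0.
  specialize (C2 _ H0); now rewrite Cplus_0_r in C2. }
intros h Hh.
rewrite <- (CSeries_minus _ _ (C2 h Hh) C3), <- CSeries_scal by exact C1.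
rewrite <- CSeries_minus.
- eapply Rle_trans; [apply Cmod_CSeries_le with (v := fun n => M n * Cmod h ^ 2)|].
  + intros n; now apply H3.
  + now apply (ex_series_scal_r (Cmod h ^ 2) M).
  + rewrite Series_scal_r; lra.
- apply abs_conv_le with (fun n => M n + M n).
  + intros n; eapply Rle_trans; [apply Cmod_minus_le|].
    specialize (H2 n); apply Rplus_le_compat; [now apply H2|].
    rewrite <- (Cplus_0_r s); apply H2; now rewrite Cmod_0.
  + now apply (ex_series_plus (V := R_NormedModule)).
- now apply abs_conv_scal.
Qed.

(** * Taylor bounds, complex powers and their series *)

Lemma MVT_from_zero (f df : R -> R) (y : R) :
  (forall x, is_derive f x (df x)) ->
  exists c, Rabs c <= Rabs y /\ f y - f 0 = df c * y.
Proof.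
intros H; destruct (MVT_gen f 0 y df) as (c & Hc & E).
- intros x _; apply H.
- intros x _; apply continuity_pt_filterlim, (ex_derive_continuous (V := R_NormedModule)).
  exists (df x); apply H.
- exists c; split; [|now rewrite Rminus_0_r in E].
  unfold Rmin, Rmax in Hc; destruct (Rle_dec 0 y);
    [rewrite !Rabs_pos_eq | rewrite !Rabs_left1]; lra.
Qed.

Lemma exp_le (x y : R) : x <= y -> exp x <= exp y.
Proof. intros [H| ->]; [apply Rlt_le, exp_increasing; exact H|lra]. Qed.

Lemma exp_le_abs (c x : R) : Rabs c <= Rabs x -> exp c <= exp (Rabs x).
Proof. intros H; apply exp_le; pose proof (Rle_abs c); lra. Qed.

Lemma exp_minus_1_bound (x : R) : Rabs (exp x - 1) <= Rabs x * exp (Rabs x).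
Proof.
destruct (MVT_from_zero exp exp x) as (c & Hc & E); [intros; apply is_derive_exp|].
rewrite exp_0 in E; rewrite E, Rabs_mult, Rmult_comm.
apply Rmult_le_compat_l; [apply Rabs_pos|].
rewrite Rabs_pos_eq by (apply Rlt_le, exp_pos); now apply exp_le_abs.
Qed.

Lemma exp_minus_1_minus_x_bound (x : R) : Rabs (exp x - 1 - x) <= x ^ 2 * exp (Rabs x).
Proof.
destruct (MVT_from_zero (fun t => exp t - t) (fun t => exp t - 1) x) as (c & Hc & E).
- intros t; auto_derive; [exact I|ring].
- rewrite exp_0 in E; replace (exp x - 1 - x) with ((exp c - 1) * x) by lra.
  rewrite Rabs_mult, <- (pow2_abs x).
  pose proof (exp_minus_1_bound c); pose proof (exp_le_abs _ _ Hc).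
  pose proof (exp_le_abs _ _ (Req_le _ _ (Rabs_Rabsolu c))) as Hcc.
  pose proof (Rabs_pos c); pose proof (Rabs_pos x); pose proof (exp_pos (Rabs x)).
  assert (exp (Rabs c) <= exp (Rabs x)) by (now apply exp_le).
  assert (Rabs c * exp (Rabs c) <= Rabs x * exp (Rabs x))
    by (apply Rmult_le_compat; try lra; apply Rlt_le, exp_pos).
  nra.
Qed.

Lemma sin_bound_abs (y : R) : Rabs (sin y) <= Rabs y.
Proof.
destruct (MVT_from_zero sin cos y) as (c & Hc & E); [intros; apply is_derive_sin|].
rewrite sin_0, Rminus_0_r in E; rewrite E, Rabs_mult.
pose proof (Rabs_pos y); assert (Rabs (cos c) <= 1) by (apply Rabs_le, COS_bound); nra.
Qed.

Lemma cos_minus_1_bound (y : R) : Rabs (cos y - 1) <= y ^ 2 /\ Rabs (cos y - 1) <= Rabs y.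
Proof.
destruct (MVT_from_zero cos (fun t => - sin t) y) as (c & Hc & E); [intros; apply is_derive_cos|].
rewrite cos_0 in E; rewrite E, Rabs_mult, Rabs_Ropp, <- (pow2_abs y).
pose proof (Rabs_pos y); pose proof (sin_bound_abs c).
assert (Rabs (sin c) <= 1) by (apply Rabs_le, SIN_bound); split; nra.
Qed.

Lemma sin_minus_bound (y : R) : Rabs (sin y - y) <= y ^ 2.
Proof.
destruct (MVT_from_zero (fun t => sin t - t) (fun t => cos t - 1) y) as (c & Hc & E).
- intros t; auto_derive; [exact I|ring].
- rewrite sin_0 in E; replace (sin y - y) with ((cos c - 1) * y) by lra.
  rewrite Rabs_mult, <- (pow2_abs y); pose proof (Rabs_pos y).
  pose proof (proj2 (cos_minus_1_bound c)); nra.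
Qed.

(** The complex exponential appears in the component form to which [cpower] unfolds; both components
    reduce to real bounds from the mean value theorem. *)
Lemma cexp_taylor (x y : R) :
  Cmod ((exp x * cos y, exp x * sin y)%R - 1 - (x, y)%R)%C
  <= 4 * Cmod (x, y) ^ 2 * exp (Rabs x).
Proof.
eapply Rle_trans; [apply Cmod_le_Rabs|].
rewrite Cmod2_alt; cbn [Re Im fst snd Cminus Cplus Copp RtoC].
replace (exp x * cos y + - (1) + - x) with ((exp x - 1 - x) + exp x * (cos y - 1)) by ring.
replace (exp x * sin y + - 0 + - y) with ((exp x - 1) * sin y + (sin y - y)) by ring.
pose proof (Rabs_triang (exp x - 1 - x) (exp x * (cos y - 1))) as H1.
pose proof (Rabs_triang ((exp x - 1) * sin y) (sin y - y)) as H2.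
rewrite Rabs_mult in H1, H2; rewrite (Rabs_pos_eq (exp x)) in H1 by (apply Rlt_le, exp_pos).
pose proof (exp_minus_1_minus_x_bound x) as H3; pose proof (exp_minus_1_bound x) as H4.
pose proof (proj1 (cos_minus_1_bound y)) as H5; pose proof (sin_minus_bound y) as H6.
pose proof (sin_bound_abs y) as H7.
assert (H8 : 1 <= exp (Rabs x)) by (rewrite <- exp_0; apply exp_le, Rabs_pos).
assert (H9 := exp_le_abs x x (Rle_refl _)); assert (H10 := exp_pos x).
rewrite <- (pow2_abs x) in H3; rewrite <- (pow2_abs y) in H5, H6.
rewrite <- (pow2_abs x), <- (pow2_abs y).
set (E := exp (Rabs x)) in *; set (X := Rabs x) in *; set (Y := Rabs y) in *.
assert (0 <= X) by apply Rabs_pos; assert (0 <= Y) by apply Rabs_pos.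
assert (exp x * Rabs (cos y - 1) <= E * Y ^ 2)
  by (apply Rmult_le_compat; try lra; apply Rabs_pos).
assert (Rabs (exp x - 1) * Rabs (sin y) <= X * E * Y)
  by (apply Rmult_le_compat; try lra; apply Rabs_pos).
assert (Y ^ 2 <= E * Y ^ 2) by nra.
assert (2 * (X * Y) <= X ^ 2 + Y ^ 2) by (pose proof (pow2_ge_0 (X - Y)); nra).
nra.
Qed.

Lemma cpower_plus (x : R) (a b : C) : cpower x (a + b) = (cpower x a * cpower x b)%C.
Proof.
unfold cpower; rewrite re_plus, im_plus, !Rmult_plus_distr_r, exp_plus, cos_plus, sin_plus.
unfold Cmult; simpl; f_equal; ring.
Qed.

Lemma cpower_R (x a : R) : cpower x (RtoC a) = RtoC (Rpower x a).
Proof.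
unfold cpower, Rpower; simpl; rewrite Rmult_0_l, cos_0, sin_0; unfold RtoC; f_equal; ring.
Qed.

Lemma cpower_nat (x : R) (n : nat) : 0 < x -> cpower x (RtoC (INR n)) = RtoC (x ^ n).
Proof. intros Hx; now rewrite cpower_R, Rpower_pow. Qed.

Lemma Cmod_cpower (x : R) (z : C) : Cmod (cpower x z) = Rpower x (Re z).
Proof.
unfold cpower, Cmod, Rpower; simpl.
set (e := exp (Re z * ln x)); set (t := Im z * ln x).
replace (e * cos t * (e * cos t * 1) + e * sin t * (e * sin t * 1))
  with (e² * ((sin t)² + (cos t)²)) by (unfold Rsqr; ring).
rewrite sin2_cos2, Rmult_1_r; apply sqrt_Rsqr, Rlt_le, exp_pos.
Qed.

Lemma ln_ge_0 (x : R) : 1 <= x -> 0 <= ln x.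
Proof. intros H; rewrite <- ln_1; destruct H as [H| ->]; [apply Rlt_le, ln_increasing; lra|lra]. Qed.

Lemma Rpower_le_exponent (x a b : R) : 1 <= x -> a <= b -> Rpower x a <= Rpower x b.
Proof. intros Hx Hab; unfold Rpower; apply exp_le, Rmult_le_compat_r; [now apply ln_ge_0|exact Hab]. Qed.

Lemma Rpower_pos (x a : R) : 0 < Rpower x a.
Proof. apply exp_pos. Qed.

Lemma ln_le_Rpower (x r : R) : 0 < r -> 1 <= x -> ln x <= Rpower x r / r.
Proof.
intros Hr Hx; apply Rmult_le_reg_r with r; [exact Hr|].
replace (Rpower x r / r * r) with (Rpower x r) by (field; lra).
unfold Rpower; pose proof (exp_ineq1_le (r * ln x)); lra.
Qed.

Definition cpower_deriv (x : R) (z : C) : C := (- ln x * cpower x (- z))%C.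

(** Logarithms are traded for small powers: [(ln x)^2] costs [x^r], and a perturbation [h] of the
    exponent costs another [x^r], whence [- Re s + 2 * r]. The summands [16 / r^2], [2 / r] and 1
    serve the remainder, the derivative and the value, so that one [M] can be fed to
    [CSeries_cdiff]. *)
Lemma cpower_majorants (x r : R) (s : C) : 0 < r -> 1 <= x ->
  let M := (16 / r ^ 2 + 2 / r + 1) * Rpower x (- Re s + 2 * r) in
  Cmod (cpower_deriv x s) <= M /\
  (forall h, Cmod h < r -> Cmod (cpower x (- (s + h))) <= M) /\
  (forall h, Cmod h < r ->
     Cmod (cpower x (- (s + h)) - cpower x (- s) - h * cpower_deriv x s)%C <= M * Cmod h ^ 2).
Proof.
intros Hr Hx; cbv zeta.
set (P := Rpower x (- Re s + 2 * r)).
assert (HP : 0 < P) by apply exp_pos.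
assert (Hc : 0 < 16 / r ^ 2) by (apply Rdiv_lt_0_compat; [lra|now apply pow_lt]).
assert (Hc' : 0 < 2 / r) by (apply Rdiv_lt_0_compat; lra).
assert (Hl := ln_ge_0 x Hx).
assert (Hl' := ln_le_Rpower x (r / 2) ltac:(lra) Hx).
assert (Hl2 : ln x ^ 2 <= 4 / r ^ 2 * Rpower x r).
{ replace (4 / r ^ 2 * Rpower x r) with ((Rpower x (r / 2) / (r / 2)) ^ 2).
  - apply pow_incr; lra.
  - replace r with (r / 2 + r / 2) at 4 by field.
    rewrite Rpower_plus; field; lra. }
assert (Hle : forall a, a <= - Re s + 2 * r -> Rpower x a <= P)
  by (intros a Ha; now apply Rpower_le_exponent).
repeat split.
- unfold cpower_deriv; rewrite Cmod_mult, Cmod_opp, Cmod_R, Cmod_cpower, Rabs_pos_eq, re_opp by exact Hl.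
  apply Rle_trans with (Rpower x (r / 2) / (r / 2) * Rpower x (- Re s)).
  + apply Rmult_le_compat_r; [apply Rlt_le, exp_pos|exact Hl'].
  + replace (Rpower x (r / 2) / (r / 2) * Rpower x (- Re s))
      with (2 / r * (Rpower x (r / 2) * Rpower x (- Re s))) by (field; lra).
    rewrite <- Rpower_plus.
    assert (Rpower x (r / 2 + - Re s) <= P) by (apply Hle; lra).
    nra.
- intros h Hh; rewrite Cmod_cpower, re_opp.
  assert (Rpower x (- Re (s + h)) <= P).
  { apply Hle; pose proof (Re_le_abs_add s h); lra. }
  nra.
- intros h Hh; unfold cpower_deriv.
  replace (- (s + h))%C with (- s + - h)%C by ring; rewrite cpower_plus.
  replace (cpower x (- s) * cpower x (- h) - cpower x (- s) - h * (- ln x * cpower x (- s)))%C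
    with (cpower x (- s) * (cpower x (- h) - 1 - (- h * ln x)))%C by ring.
  rewrite Cmod_mult, Cmod_cpower, re_opp.
  assert (Ht := cexp_taylor (Re (- h) * ln x) (Im (- h) * ln x)).
  fold (cpower x (- h)) in Ht.
  replace (Re (- h) * ln x, Im (- h) * ln x) with (- h * ln x)%C in Ht
    by (apply injective_projections; simpl; ring).
  rewrite Cmod_mult, Cmod_R, Cmod_opp, (Rabs_pos_eq (ln x)) in Ht by exact Hl.
  assert (He : exp (Rabs (Re (- h) * ln x)) <= Rpower x r).
  { unfold Rpower; apply exp_le; rewrite Rabs_mult, (Rabs_pos_eq (ln x)) by exact Hl.
    apply Rmult_le_compat_r; [exact Hl|].
    pose proof (re_le_Cmod (- h)) as H0; rewrite Cmod_opp in H0; lra. }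
  assert (Hh0 := Cmod_ge_0 h).
  assert (Hb : 4 * (Cmod h * ln x) ^ 2 * exp (Rabs (Re (- h) * ln x))
               <= 16 / r ^ 2 * Cmod h ^ 2 * (Rpower x r * Rpower x r)).
  { replace (16 / r ^ 2 * Cmod h ^ 2 * (Rpower x r * Rpower x r))
      with (4 * (Cmod h ^ 2 * (4 / r ^ 2 * Rpower x r)) * Rpower x r) by (field; lra).
    apply Rmult_le_compat; [| apply Rlt_le, exp_pos | | exact He].
    - apply Rmult_le_pos; [lra|apply pow2_ge_0].
    - rewrite Rpow_mult_distr; apply Rmult_le_compat_l; [lra|].
      apply Rmult_le_compat_l; [apply pow2_ge_0|exact Hl2]. }
  apply Rle_trans with (Rpower x (- Re s) * (16 / r ^ 2 * Cmod h ^ 2 * (Rpower x r * Rpower x r))).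
  + apply Rmult_le_compat_l; [apply Rlt_le, exp_pos|lra].
  + replace (Rpower x (- Re s) * (16 / r ^ 2 * Cmod h ^ 2 * (Rpower x r * Rpower x r)))
      with (16 / r ^ 2 * Cmod h ^ 2 * (Rpower x (- Re s) * (Rpower x r * Rpower x r))) by ring.
    rewrite <- !Rpower_plus.
    replace (- Re s + (r + r)) with (- Re s + 2 * r) by ring; fold P.
    assert (0 <= P * Cmod h ^ 2) by (apply Rmult_le_pos; [lra|apply pow2_ge_0]).
    nra.
Qed.

Lemma Rpower_opp_lim (t : R) : 0 < t -> is_lim_seq (fun n => Rpower (INR n + 1) (- t)) 0.
Proof.
intros Ht; apply is_lim_seq_spec; intros eps.
set (A := exp (- ln eps / t)).
destruct (INR_unbounded A) as [N HN]; exists N; intros n Hn.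
rewrite Rminus_0_r, Rabs_pos_eq by (apply Rlt_le, exp_pos).
assert (HA : 0 < A) by apply exp_pos.
apply le_INR in Hn.
assert (H1 : ln A < ln (INR n + 1)) by (apply ln_increasing; lra).
unfold A in H1; rewrite ln_exp in H1.
apply Rmult_lt_compat_r with (r := t) in H1; [|exact Ht].
replace (- ln eps / t * t) with (- ln eps) in H1 by (field; lra).
unfold Rpower; rewrite <- (exp_ln eps) by apply cond_pos.
apply exp_increasing; lra.
Qed.

Lemma is_derive_Rpower (a x : R) : 0 < x ->
  is_derive (fun t => Rpower t a) x (a * Rpower x (a - 1)).
Proof.
intros Hx; unfold Rpower; auto_derive; [exact Hx|].
replace ((a - 1) * ln x) with (a * ln x + - ln x) by ring.
rewrite exp_plus, exp_Ropp, exp_ln by exact Hx; field; lra.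
Qed.

Lemma Rpower_antitone (x y a : R) : 0 < x <= y -> 0 <= a -> Rpower y (- a) <= Rpower x (- a).
Proof.
intros [Hx Hxy] Ha; unfold Rpower; apply exp_le.
assert (ln x <= ln y) by (destruct Hxy as [Hxy| ->]; [apply Rlt_le, ln_increasing; lra|lra]).
nra.
Qed.

Lemma is_series_telescope (u : nat -> R) (l : R) :
  is_lim_seq u l -> is_series (fun n => u n - u (S n)) (u O - l).
Proof.
intros H; apply (is_lim_seq_ext (fun n => u O - u (S n)) _ (Finite (u O - l))).
- intros n; induction n as [|n IH]; [now rewrite sum_O|].
  rewrite sum_Sn, <- IH; unfold plus; simpl; ring.
- apply is_lim_seq_minus'; [apply is_lim_seq_const|].
  now apply is_lim_seq_incr_1 with (u := u).
Qed.

(** Integral test by telescoping: the mean value theorem bounds [(n + 2)^(-a)] by [((n + 1)^(1 - a)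
    - (n + 2)^(1 - a)) / (a - 1)]. *)
Lemma ex_series_Rpower (a : R) : 1 < a -> ex_series (fun n => Rpower (INR n + 1) (- a)).
Proof.
intros Ha; apply (ex_series_incr_1 (fun n => Rpower (INR n + 1) (- a))).
set (u := fun n => Rpower (INR n + 1) (- (a - 1))).
apply ex_series_le_R with (fun n => / (a - 1) * (u n - u (S n))).
- intros n; split; [apply Rlt_le, exp_pos|].
  apply Rmult_le_reg_l with (a - 1); [lra|].
  replace ((a - 1) * (/ (a - 1) * (u n - u (S n)))) with (u n - u (S n)) by (field; lra).
  assert (Hn := pos_INR n).
  destruct (MVT_gen (fun t => Rpower t (- (a - 1))) (INR n + 1) (INR (S n) + 1)
             (fun x => - (a - 1) * Rpower x (- (a - 1) - 1))) as (c & Hc & E).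
  + intros x Hx; apply (is_derive_Rpower (- (a - 1))).
    rewrite S_INR, Rmin_left in Hx; lra.
  + intros x Hx; apply continuity_pt_filterlim.
    apply (ex_derive_continuous (V := R_NormedModule) (fun t => Rpower t (- (a - 1)))).
    exists (- (a - 1) * Rpower x (- (a - 1) - 1)); apply (is_derive_Rpower (- (a - 1))).
    rewrite S_INR, Rmin_left in Hx; lra.
  + unfold u; rewrite S_INR in *.
    rewrite Rmin_left, Rmax_right in Hc by lra.
    assert (H1 : Rpower (INR n + 1 + 1) (- a) <= Rpower c (- a)) by (apply Rpower_antitone; lra).
    replace (- (a - 1) - 1) with (- a) in E by ring.
    nra.
- apply (ex_series_scal (V := R_NormedModule)); eexists; apply is_series_telescope with (l := 0).
  apply Rpower_opp_lim; lra.
Qed.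

Lemma ex_series_Rpower_shift (a : R) (k : nat) : 1 < a ->
  ex_series (fun n => Rpower (INR n + INR (S k)) (- a)).
Proof.
intros Ha; apply ex_series_ext with (fun n => Rpower (INR (k + n) + 1) (- a)).
- intros n; rewrite S_INR, plus_INR; f_equal; ring.
- apply -> (ex_series_incr_n (fun n => Rpower (INR n + 1) (- a))); now apply ex_series_Rpower.
Qed.


(** This disposes of the error terms: traces of size [O(N)] on the eigenspaces give a function
    regular for [Re s > 2], which is where the half plane of the theorem comes from. *)
Lemma dirichlet_cdiff (e : nat -> C) (K : R) (s : C) :
  (forall n, Cmod (e n) <= K * (INR n + 2)) -> 2 < Re s ->
  cdiff (fun z => CSeries (fun n => e n * cpower (INR n + 2) (- z))%C) s.
Proof.
intros He Hs.
(* A third of the margin: after losing 1 to the coefficients and [2 * r] to the majorant, the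
   exponent is still [1 + r]. *)
set (r := (Re s - 2) / 3); assert (Hr : 0 < r) by (unfold r; lra).
set (c := 16 / r ^ 2 + 2 / r + 1).
assert (HK : forall n z M, Cmod z <= c * Rpower (INR n + 2) (- Re s + 2 * r) * M -> 0 <= M ->
  Cmod (e n * z)%C <= K * c * Rpower (INR n + 2) (- (Re s - 2 * r - 1)) * M).
{ intros n z M Hz HM; rewrite Cmod_mult.
  replace (- (Re s - 2 * r - 1)) with (1 + (- Re s + 2 * r)) by ring.
  assert (Hn := pos_INR n).
  rewrite Rpower_plus, Rpower_1 by lra.
  apply Rle_trans with ((K * (INR n + 2)) * (c * Rpower (INR n + 2) (- Re s + 2 * r) * M)).
  - apply Rmult_le_compat; try apply Cmod_ge_0; [apply He|exact Hz].
  - apply Req_le; ring. }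
assert (Hm := fun n => cpower_majorants (INR n + 2) r s Hr
                ltac:(pose proof (pos_INR n); lra)).
cbv zeta in Hm; fold c in Hm.
apply CSeries_cdiff with (f' := fun n z => (e n * cpower_deriv (INR n + 2) z)%C)
  (M := fun n => K * c * Rpower (INR n + 2) (- (Re s - 2 * r - 1))) (d := r); [exact Hr| | | |].
- apply (ex_series_scal (V := R_NormedModule)).
  apply (ex_series_Rpower_shift (Re s - 2 * r - 1) 1); unfold r; lra.
- intros n; destruct (Hm n) as (H1 & _ & _).
  rewrite <- (Rmult_1_r (K * c * _)); apply HK; lra.
- intros n h Hh; destruct (Hm n) as (_ & H1 & _); specialize (H1 h Hh).
  rewrite <- (Rmult_1_r (K * c * _)); apply HK; lra.
- intros n h Hh; destruct (Hm n) as (_ & _ & H1); specialize (H1 h Hh).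
  replace (e n * cpower (INR n + 2) (- (s + h)) - e n * cpower (INR n + 2) (- s)
           - h * (e n * cpower_deriv (INR n + 2) s))%C
    with (e n * (cpower (INR n + 2) (- (s + h)) - cpower (INR n + 2) (- s)
           - h * cpower_deriv (INR n + 2) s))%C by ring.
  apply HK; [exact H1|apply pow2_ge_0].
Qed.

(** * Integrals over the unit interval, and the continuation of the zeta function *)

Definition CInt (f : R -> C) : C :=
  (RInt (fun t => Re (f t)) 0 1, RInt (fun t => Im (f t)) 0 1).

Definition Ccont01 (f : R -> C) : Prop := forall t, 0 <= t <= 1 ->
  continuous (fun t => Re (f t)) t /\ continuous (fun t => Im (f t)) t.

Lemma Ccont01_ex_RInt (f : R -> C) : Ccont01 f ->
  ex_RInt (fun t => Re (f t)) 0 1 /\ ex_RInt (fun t => Im (f t)) 0 1.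
Proof.
intros H; split; apply (ex_RInt_continuous (V := R_CompleteNormedModule)); intros t Ht;
  rewrite Rmin_left, Rmax_right in Ht by lra; apply (H t Ht).
Qed.

Lemma Ccont01_scal (c : C) (f : R -> C) : Ccont01 f -> Ccont01 (fun t => c * f t)%C.
Proof.
intros H t Ht; destruct (H t Ht) as [H1 H2]; split.
- apply (continuous_ext (fun t => minus (scal (Re c) (Re (f t))) (scal (Im c) (Im (f t))))).
  + intros x; now rewrite re_mult.
  + apply (continuous_minus (V := R_NormedModule));
      apply (continuous_scal_r (V := R_NormedModule)); assumption.
- apply (continuous_ext (fun t => plus (scal (Re c) (Im (f t))) (scal (Im c) (Re (f t))))).
  + intros x; now rewrite im_mult.
  + apply (continuous_plus (V := R_NormedModule));
      apply (continuous_scal_r (V := R_NormedModule)); assumption.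
Qed.

Lemma CInt_scal (c : C) (f : R -> C) : Ccont01 f -> CInt (fun t => c * f t)%C = (c * CInt f)%C.
Proof.
intros H; apply Ccont01_ex_RInt in H; destruct H as [H1 H2]; unfold CInt.
rewrite (RInt_ext _ (fun t => minus (scal (Re c) (Re (f t))) (scal (Im c) (Im (f t)))))
  by (intros; now rewrite re_mult).
rewrite (RInt_ext (fun t => Im (c * f t)%C)
          (fun t => plus (scal (Re c) (Im (f t))) (scal (Im c) (Re (f t)))))
  by (intros; now rewrite im_mult).
rewrite (RInt_minus (V := R_CompleteNormedModule)), (RInt_plus (V := R_CompleteNormedModule)),
  !(RInt_scal (V := R_CompleteNormedModule)); try assumption; [reflexivity| | | |];
  now apply (ex_RInt_scal (V := R_NormedModule)).
Qed.

Lemma CInt_minus (f g : R -> C) : Ccont01 f -> Ccont01 g ->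
  CInt (fun t => f t - g t)%C = (CInt f - CInt g)%C.
Proof.
intros H H'; apply Ccont01_ex_RInt in H, H'; destruct H, H'; unfold CInt.
rewrite (RInt_ext _ (fun t => minus (Re (f t)) (Re (g t)))) by reflexivity.
rewrite (RInt_ext (fun t => Im (f t - g t)%C) (fun t => minus (Im (f t)) (Im (g t))))
  by reflexivity.
rewrite !(RInt_minus (V := R_CompleteNormedModule)) by assumption; reflexivity.
Qed.

Lemma Ccont01_minus (f g : R -> C) : Ccont01 f -> Ccont01 g -> Ccont01 (fun t => f t - g t)%C.
Proof.
intros H H' t Ht; destruct (H t Ht), (H' t Ht); split;
  [apply (continuous_minus (V := R_NormedModule) (fun t => Re (f t)) (fun t => Re (g t)))
  |apply (continuous_minus (V := R_NormedModule) (fun t => Im (f t)) (fun t => Im (g t)))];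
  assumption.
Qed.

Lemma Cmod_CInt_le (f : R -> C) (M : R) :
  Ccont01 f -> (forall t, 0 <= t <= 1 -> Cmod (f t) <= M) -> Cmod (CInt f) <= 2 * M.
Proof.
intros Hf H; apply Ccont01_ex_RInt in Hf; destruct Hf as [H1 H2].
assert (Hb : forall g : R -> R, ex_RInt g 0 1 -> (forall t, 0 <= t <= 1 -> Rabs (g t) <= M) ->
             Rabs (RInt g 0 1) <= M).
{ intros g Hg Hgb; rewrite <- (Rmult_1_l M); replace 1 with (1 - 0) at 2 by ring.
  apply abs_RInt_le_const; [lra|exact Hg|exact Hgb]. }
eapply Rle_trans; [apply Cmod_le_Rabs|].
assert (Rabs (Re (CInt f)) <= M).
{ apply Hb; [exact H1|]; intros t Ht; eapply Rle_trans; [apply re_le_Cmod|now apply H]. }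
assert (Rabs (Im (CInt f)) <= M).
{ apply Hb; [exact H2|]; intros t Ht; eapply Rle_trans; [apply Rabs_Im_le_Cmod|now apply H]. }
lra.
Qed.

Definition is_Cderive (F : R -> C) (t : R) (l : C) : Prop :=
  is_derive (fun t => Re (F t)) t (Re l) /\ is_derive (fun t => Im (F t)) t (Im l).

Lemma is_Cderive_plus (F G : R -> C) (t : R) (a b : C) :
  is_Cderive F t a -> is_Cderive G t b -> is_Cderive (fun t => F t + G t)%C t (a + b)%C.
Proof.
intros [H1 H2] [H3 H4]; split;
  [apply (is_derive_plus (V := R_NormedModule) (fun t => Re (F t)) (fun t => Re (G t)))
  |apply (is_derive_plus (V := R_NormedModule) (fun t => Im (F t)) (fun t => Im (G t)))];
  assumption.
Qed.

Lemma is_Cderive_mult (F G : R -> C) (t : R) (a b : C) :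
  is_Cderive F t a -> is_Cderive G t b ->
  is_Cderive (fun t => F t * G t)%C t (a * G t + F t * b)%C.
Proof.
intros [H1 H2] [H3 H4]; split.
- apply (is_derive_ext (fun t => minus (mult (Re (F t)) (Re (G t))) (mult (Im (F t)) (Im (G t)))));
    [intros; now rewrite re_mult|].
  rewrite re_plus, !re_mult.
  replace (Re a * Re (G t) - Im a * Im (G t) + (Re (F t) * Re b - Im (F t) * Im b))
    with (minus (plus (mult (Re a) (Re (G t))) (mult (Re (F t)) (Re b)))
           (plus (mult (Im a) (Im (G t))) (mult (Im (F t)) (Im b))))
    by (unfold minus, plus, opp, mult; simpl; ring).
  apply (is_derive_minus (V := R_NormedModule)); apply (is_derive_mult (K := R_AbsRing));
    try assumption; intros; apply Rmult_comm.
- apply (is_derive_ext (fun t => plus (mult (Re (F t)) (Im (G t))) (mult (Im (F t)) (Re (G t)))));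
    [intros; now rewrite im_mult|].
  rewrite im_plus, !im_mult.
  replace (Re a * Im (G t) + Im a * Re (G t) + (Re (F t) * Im b + Im (F t) * Re b))
    with (plus (plus (mult (Re a) (Im (G t))) (mult (Re (F t)) (Im b)))
           (plus (mult (Im a) (Re (G t))) (mult (Im (F t)) (Re b))))
    by (unfold plus, mult; simpl; ring).
  apply (is_derive_plus (V := R_NormedModule)); apply (is_derive_mult (K := R_AbsRing));
    try assumption; intros; apply Rmult_comm.
Qed.

Lemma is_Cderive_RtoC (f : R -> R) (t l : R) :
  is_derive f t l -> is_Cderive (fun t => RtoC (f t)) t (RtoC l).
Proof.
intros H; split; [exact H|].
apply (is_derive_const (V := R_NormedModule) 0 t).
Qed.

Lemma is_Cderive_cpower (x t : R) (w : C) : 0 < x + t ->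
  is_Cderive (fun t => cpower (x + t) w) t (w * cpower (x + t) (w - 1))%C.
Proof.
intros H.
assert (E : cpower (x + t) (w - 1) = (cpower (x + t) w * / (x + t))%C).
{ unfold Cminus; rewrite cpower_plus; f_equal.
  change (- (1))%C with (Copp (RtoC 1)); rewrite <- RtoC_opp, cpower_R, Rpower_Ropp, Rpower_1 by exact H.
  rewrite <- RtoC_plus, RtoC_inv by lra; reflexivity. }
rewrite E, <- RtoC_plus, <- RtoC_inv by lra.
unfold cpower; split; simpl; auto_derive; try exact H; try lra; unfold Re, Im; field; lra.
Qed.

Lemma is_Cderive_Ccont (F f : R -> C) :
  (forall t, 0 <= t <= 1 -> is_Cderive F t (f t)) -> Ccont01 F.
Proof.
intros H t Ht; destruct (H t Ht) as [H1 H2]; split;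
  apply (ex_derive_continuous (V := R_NormedModule)); eexists; eassumption.
Qed.

Lemma CInt_derive (F f : R -> C) :
  (forall t, 0 <= t <= 1 -> is_Cderive F t (f t)) -> Ccont01 f -> CInt f = (F 1 - F 0)%C.
Proof.
intros H Hf; unfold CInt.
assert (Hm : forall t, Rmin 0 1 <= t <= Rmax 0 1 -> 0 <= t <= 1)
  by (intros t; rewrite Rmin_left, Rmax_right; lra).
apply injective_projections; cbn [fst snd]; apply is_RInt_unique.
- apply (is_RInt_derive (V := R_CompleteNormedModule) (fun t => Re (F t)));
    intros t Ht; [apply H|apply Hf]; now apply Hm.
- apply (is_RInt_derive (V := R_CompleteNormedModule) (fun t => Im (F t)));
    intros t Ht; [apply H|apply Hf]; now apply Hm.
Qed.

(** It vanishes at both ends and has second derivative [-1], so two integrations by parts leave only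
    endpoint values of the integrand's second primitive. *)
Definition kernel (t : R) : R := t * (1 - t) / 2.

Definition kernel_power (x : R) (z : C) (t : R) : C := (kernel t * cpower (x + t) (- z))%C.

Definition kernel_deriv (x : R) (z : C) (t : R) : C := (kernel t * cpower_deriv (x + t) z)%C.

Lemma is_Cderive_kernel_power (x t : R) (z : C) : 0 < x -> 0 <= t ->
  is_Cderive (kernel_power x z) t
    (((1 - 2 * t) / 2)%R * cpower (x + t) (- z) + kernel t * (- z * cpower (x + t) (- z - 1)))%C.
Proof.
intros Hx Ht.
apply (is_Cderive_mult (fun t => RtoC (kernel t)) (fun t => cpower (x + t) (- z))).
- apply is_Cderive_RtoC; unfold kernel; auto_derive; [exact I|field].
- apply is_Cderive_cpower; lra.
Qed.

Lemma kernel_power_cont (x : R) (z : C) : 0 < x -> Ccont01 (kernel_power x z).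
Proof.
intros Hx; eapply is_Cderive_Ccont; intros t Ht; now apply is_Cderive_kernel_power.
Qed.

Lemma kernel_deriv_cont (x : R) (z : C) : 0 < x -> Ccont01 (kernel_deriv x z).
Proof.
intros Hx; eapply is_Cderive_Ccont; intros t Ht; unfold kernel_deriv, cpower_deriv.
apply (is_Cderive_mult (fun t => RtoC (kernel t))).
- apply is_Cderive_RtoC with (l := (1 - 2 * t) / 2); unfold kernel; auto_derive; [exact I|field].
- apply (is_Cderive_mult (fun t => - ln (x + t))%C).
  + replace (fun t0 : R => (- ln (x + t0))%C) with (fun t0 : R => RtoC (- ln (x + t0)))
      by (apply functional_extensionality; intros; apply RtoC_opp).
    apply is_Cderive_RtoC with (l := - / (x + t)); auto_derive; [lra|field; lra].
  + apply is_Cderive_cpower; lra.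
Qed.

(** Trapezoidal rule for [x^(-w)] on a unit interval, with Peano kernel remainder. *)
Lemma trapezoid_cpower (x : R) (w : C) : 0 < x ->
  ((1 - w) * w * (w + 1) * CInt (kernel_power x (w + 2)))%C =
  ((1 - w) * (cpower x (- w) + cpower (x + 1) (- w)) * / 2
   - (cpower (x + 1) (1 - w) - cpower x (1 - w)))%C.
Proof.
intros Hx.
rewrite <- CInt_scal by now apply kernel_power_cont.
(* An explicit primitive found by integrating by parts twice. Its first summand vanishes at both
   ends, the second gives the trapezoid and the third the exact integral of the power. *)
rewrite (CInt_derive (fun t =>
  (1 - w) * (- w) * kernel_power x (w + 1) t
  + (- (1 - w) * (((1 - 2 * t) / 2)%R * cpower (x + t) (- w)) + (- (1)) * cpower (x + t) (1 - w)))%C).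
- unfold kernel_power, kernel.
  replace (0 * (1 - 0) / 2) with 0 by field; replace (1 * (1 - 1) / 2) with 0 by field.
  replace ((1 - 2 * 1) / 2) with (- / 2) by field; replace ((1 - 2 * 0) / 2) with (/ 2) by field.
  rewrite Rplus_0_r, RtoC_opp, RtoC_inv by lra; field.
- intros t Ht.
  assert (H1 := is_Cderive_kernel_power x t (w + 1) Hx (proj1 Ht)).
  assert (Hxt : 0 < x + t) by lra.
  assert (H2 := is_Cderive_cpower x t (- w) Hxt).
  assert (H3 := is_Cderive_cpower x t (1 - w) Hxt).
  assert (H4 : is_Cderive (fun t => RtoC ((1 - 2 * t) / 2)) t (RtoC (- (1))))
    by (apply is_Cderive_RtoC; auto_derive; [exact I|field]).
  assert (Hc : forall c : C, is_Cderive (fun _ => c) t 0%C)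
    by (intros c; split; apply (is_derive_const (V := R_NormedModule))).
  assert (H := is_Cderive_plus _ _ _ _ _
    (is_Cderive_mult _ _ _ _ _ (Hc ((1 - w) * (- w))%C) H1)
    (is_Cderive_plus _ _ _ _ _
       (is_Cderive_mult _ _ _ _ _ (Hc (- (1 - w))%C) (is_Cderive_mult _ _ _ _ _ H4 H2))
       (is_Cderive_mult _ _ _ _ _ (Hc (- (1))%C) H3))).
  cbv beta in H.
  replace (- (w + 1))%C with (- w - 1)%C in H by ring.
  replace (1 - w - 1)%C with (- w)%C in H by ring.
  replace (- w - 1 - 1)%C with (- (w + 2))%C in H by ring.
  eapply eq_ind with (P := fun l => is_Cderive _ t l); [exact H|].
  unfold kernel_power; rewrite RtoC_opp; ring.
- apply Ccont01_scal, kernel_power_cont, Hx.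
Qed.

Lemma Rpower_shift_le (n : nat) (t a : R) : 0 <= t -> 0 <= a ->
  Rpower (INR n + 1 + t) (- a) <= Rpower (INR n + 1) (- a).
Proof. intros Ht Ha; apply Rpower_antitone; pose proof (pos_INR n); lra. Qed.

Lemma kernel_bound (t : R) : 0 <= t <= 1 -> 0 <= kernel t <= 1.
Proof. intros H; unfold kernel; nra. Qed.

Definition zeta_tail (z : C) : C := CSeries (fun n => CInt (kernel_power (INR n + 1) z)).

(** Integration against the kernel preserves the majorants of the powers, since [kernel t <= 1] and
    [x + t >= x]. Convergence for [Re s > 1] reaches [Re w > -1] once the argument is [w + 2]. *)
Lemma zeta_tail_majorant (s : C) : 1 < Re s -> exists (r : R) (M : nat -> R),
  0 < r /\ ex_series M /\
  (forall n, Cmod (CInt (kernel_deriv (INR n + 1) s)) <= M n) /\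
  (forall n h, Cmod h < r -> Cmod (CInt (kernel_power (INR n + 1) (s + h))) <= M n) /\
  (forall n h, Cmod h < r ->
     Cmod (CInt (kernel_power (INR n + 1) (s + h)) - CInt (kernel_power (INR n + 1) s)
           - h * CInt (kernel_deriv (INR n + 1) s))%C <= M n * Cmod h ^ 2).
Proof.
intros Hs; set (r := (Re s - 1) / 3); assert (Hr : 0 < r) by (unfold r; lra).
set (c := 16 / r ^ 2 + 2 / r + 1).
assert (Hc : 0 < c).
{ unfold c; assert (0 < 16 / r ^ 2) by (apply Rdiv_lt_0_compat; [lra|now apply pow_lt]).
  assert (0 < 2 / r) by (apply Rdiv_lt_0_compat; lra); lra. }
exists r, (fun n => 2 * (c * Rpower (INR n + 1) (- (Re s - 2 * r)))).
assert (Hm := fun n t (Ht : 0 <= t <= 1) => cpower_majorants (INR n + 1 + t) r s Hr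
                ltac:(pose proof (pos_INR n); lra)).
cbv zeta in Hm; fold c in Hm.
assert (HM : forall n t z m, 0 <= t <= 1 -> 0 <= m ->
  Cmod z <= c * Rpower (INR n + 1 + t) (- Re s + 2 * r) * m ->
  Cmod (kernel t * z)%C <= c * Rpower (INR n + 1) (- (Re s - 2 * r)) * m).
{ intros n t z m Ht Hm0 Hz; rewrite Cmod_mult, Cmod_R.
  assert (Hk := kernel_bound t Ht); rewrite Rabs_pos_eq by lra.
  assert (H1 : Rpower (INR n + 1 + t) (- (Re s - 2 * r)) <= Rpower (INR n + 1) (- (Re s - 2 * r)))
    by (apply Rpower_shift_le; unfold r; lra).
  replace (- Re s + 2 * r) with (- (Re s - 2 * r)) in Hz by ring.
  assert (H2 : c * Rpower (INR n + 1 + t) (- (Re s - 2 * r)) * m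
               <= c * Rpower (INR n + 1) (- (Re s - 2 * r)) * m).
  { apply Rmult_le_compat_r; [exact Hm0|]; apply Rmult_le_compat_l; lra. }
  pose proof (Cmod_ge_0 z); nra. }
assert (Hpos : forall n, 0 < INR n + 1) by (intros n; pose proof (pos_INR n); lra).
repeat split.
- exact Hr.
- apply (ex_series_scal (V := R_NormedModule)), (ex_series_scal (V := R_NormedModule)).
  apply ex_series_Rpower; unfold r; lra.
- intros n; apply Cmod_CInt_le; [now apply kernel_deriv_cont|]; intros t Ht.
  destruct (Hm n t Ht) as (H1 & _ & _).
  rewrite <- (Rmult_1_r (c * _)); apply HM; [exact Ht|lra|now rewrite Rmult_1_r].
- intros n h Hh; apply Cmod_CInt_le; [now apply kernel_power_cont|]; intros t Ht.
  destruct (Hm n t Ht) as (_ & H1 & _).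
  rewrite <- (Rmult_1_r (c * _)); apply HM; [exact Ht|lra|rewrite Rmult_1_r; now apply H1].
- intros n h Hh.
  assert (C1 := kernel_power_cont (INR n + 1) (s + h) (Hpos n)).
  assert (C2 := kernel_power_cont (INR n + 1) s (Hpos n)).
  assert (C3 := kernel_deriv_cont (INR n + 1) s (Hpos n)).
  rewrite <- (CInt_scal h _ C3), <- (CInt_minus _ _ C1 C2).
  rewrite <- (CInt_minus _ _ (Ccont01_minus _ _ C1 C2) (Ccont01_scal h _ C3)).
  rewrite Rmult_assoc; apply Cmod_CInt_le.
  + exact (Ccont01_minus _ _ (Ccont01_minus _ _ C1 C2) (Ccont01_scal h _ C3)).
  + intros t Ht; destruct (Hm n t Ht) as (_ & _ & H1).
    unfold kernel_power, kernel_deriv.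
    replace (kernel t * cpower (INR n + 1 + t) (- (s + h)) - kernel t * cpower (INR n + 1 + t) (- s)
             - h * (kernel t * cpower_deriv (INR n + 1 + t) s))%C
      with (kernel t * (cpower (INR n + 1 + t)%R (- (s + h)) - cpower (INR n + 1 + t)%R (- s)
             - h * cpower_deriv (INR n + 1 + t)%R s))%C by ring.
    apply HM; [exact Ht|apply pow2_ge_0|now apply H1].
Qed.

Lemma zeta_tail_cdiff (s : C) : 1 < Re s -> cdiff zeta_tail s.
Proof.
intros Hs; destruct (zeta_tail_majorant s Hs) as (r & M & Hr & HM & H1 & H2 & H3).
exact (CSeries_cdiff (fun n z => CInt (kernel_power (INR n + 1) z))
         (fun n z => CInt (kernel_deriv (INR n + 1) z)) s M r Hr HM H1 H2 H3).
Qed.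

Lemma zeta_tail_abs_conv (s : C) : 1 < Re s ->
  abs_conv (fun n => CInt (kernel_power (INR n + 1) s)).
Proof.
intros Hs; destruct (zeta_tail_majorant s Hs) as (r & M & Hr & HM & _ & H2 & _).
apply abs_conv_le with M; [intros n|exact HM].
rewrite <- (Cplus_0_r s); apply H2; now rewrite Cmod_0.
Qed.

Lemma Cmod_lim_Re_Im (u : nat -> C) : is_lim_seq (fun n => Cmod (u n)) 0 ->
  is_lim_seq (fun n => Re (u n)) 0 /\ is_lim_seq (fun n => Im (u n)) 0.
Proof.
intros H; split; apply is_lim_seq_abs_0;
  apply is_lim_seq_le_le with (fun _ => 0) (fun n => Cmod (u n));
  try exact H; try apply is_lim_seq_const; intros n; split;
  try apply Rabs_pos; [apply re_le_Cmod|apply Rabs_Im_le_Cmod].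
Qed.

Lemma CSeries_telescope (u : nat -> C) : is_lim_seq (fun n => Cmod (u n)) 0 ->
  CSeries (fun n => u n - u (S n))%C = u O.
Proof.
intros H; apply Cmod_lim_Re_Im in H; destruct H as [H1 H2].
apply injective_projections; cbn [CSeries fst snd]; apply is_series_unique.
- apply is_series_telescope in H1; rewrite Rminus_0_r in H1; exact H1.
- apply is_series_telescope in H2; rewrite Rminus_0_r in H2; exact H2.
Qed.

Lemma zeta_terms_abs_conv (w : C) (k : nat) : 1 < Re w ->
  abs_conv (fun n => cpower (INR n + INR (S k)) (- w)).
Proof.
intros Hw; apply abs_conv_le with (fun n => Rpower (INR n + INR (S k)) (- Re w)).
- intros n; rewrite Cmod_cpower, re_opp; lra.
- now apply ex_series_Rpower_shift.
Qed.

(** The continuation of [Sum_(n >= 2) n^(-w)], minus its polar part [1 / (w - 1)]. *)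
Definition zeta_regular (w : C) : C := (- / 2 + w * (w + 1) * zeta_tail (w + 2))%C.

Lemma zeta_regular_cdiff (w : C) : -1 < Re w -> cdiff zeta_regular w.
Proof.
intros Hw; unfold zeta_regular; apply cdiff_plus; [apply cdiff_const|].
apply cdiff_mult.
- apply (cdiff_mult (fun z => z) (fun z => z + 1)%C); [apply cdiff_id|].
  apply cdiff_plus; [apply cdiff_id|apply cdiff_const].
- apply cdiff_shift, zeta_tail_cdiff; rewrite re_plus, re_RtoC; lra.
Qed.

(** The trapezoidal identity is summed over the intervals starting at 1, 2, and so on: the powers
    [1 - w] telescope to 1, the endpoint values give [1 + 2 * S2], and the resulting linear equation
    is solved for [S2]. *)
Lemma zeta_continuation (w : C) : 1 < Re w ->
  CSeries (fun n => cpower (INR n + 2) (- w)) = (/ (w - 1) + zeta_regular w)%C.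
Proof.
intros Hw; set (S2 := CSeries (fun n => cpower (INR n + 2) (- w))).
assert (A1 := zeta_terms_abs_conv w 0 Hw); assert (A2 := zeta_terms_abs_conv w 1 Hw).
change (INR 1) with 1 in A1; change (INR 2) with 2 in A2.
assert (Hw2 : 1 < Re (w + 2)%C) by (rewrite re_plus, re_RtoC; lra).
assert (A3 := zeta_tail_abs_conv _ Hw2).
assert (E1 : CSeries (fun n => cpower (INR n + 1) (- w)) = (1 + S2)%C).
{ unfold S2, CSeries.
  rewrite (Series_incr_1 _ (abs_conv_Re _ A1)), (Series_incr_1 _ (abs_conv_Im _ A1)).
  change (INR 0) with 0; rewrite Rplus_0_l.
  replace (cpower 1 (- w)) with (RtoC 1)
    by (unfold cpower; rewrite ln_1, !Rmult_0_r, exp_0, cos_0, sin_0; unfold RtoC; f_equal; ring).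
  unfold Cplus; simpl fst; simpl snd; f_equal; f_equal; apply Series_ext; intros n;
    rewrite S_INR; now replace (INR n + 1 + 1) with (INR n + 2) by ring. }
set (u := fun n => cpower (INR n + 1) (1 - w)).
assert (E2 : CSeries (fun n => u n - u (S n))%C = 1%C).
{ rewrite CSeries_telescope.
  - unfold u, cpower; simpl INR; rewrite Rplus_0_l, ln_1, !Rmult_0_r, exp_0, cos_0, sin_0.
    unfold RtoC; f_equal; ring.
  - apply is_lim_seq_ext with (fun n => Rpower (INR n + 1) (- (Re w - 1))).
    + intros n; unfold u; rewrite Cmod_cpower; f_equal.
      unfold Cminus; rewrite re_plus, re_opp, re_RtoC; ring.
    + apply Rpower_opp_lim; lra. }
(* Absolute convergence of the telescoping series is read off the trapezoidal identity itself, whose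
   other terms are already under control. *)
assert (A4 : abs_conv (fun n => u n - u (S n))%C).
{ assert (E : forall n, (u n - u (S n) = (1 - w) * w * (w + 1) * CInt (kernel_power (INR n + 1) (w + 2))
            + (- ((1 - w) * / 2)) * (cpower (INR n + 1)%R (- w) + cpower (INR n + 2)%R (- w)))%C).
  { intros n; rewrite trapezoid_cpower by (pose proof (pos_INR n); lra).
    unfold u; rewrite S_INR; replace (INR n + 1 + 1) with (INR n + 2) by ring; ring. }
  unfold abs_conv; eapply ex_series_ext; [intros n; rewrite E; reflexivity|].
  apply abs_conv_plus; apply abs_conv_scal; [exact A3|]; now apply abs_conv_plus. }
assert (E3 : ((1 - w) * w * (w + 1) * zeta_tail (w + 2)
              = (1 - w) * / 2 * (1 + S2 + S2) + 1)%C).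
{ unfold zeta_tail; rewrite <- CSeries_scal by exact A3.
  transitivity ((1 - w) * / 2 * (CSeries (fun n => cpower (INR n + 1)%R (- w)) + S2)
                + CSeries (fun n => u n - u (S n)))%C; [|now rewrite E1, E2].
  unfold S2.
  rewrite <- CSeries_plus by assumption.
  rewrite <- CSeries_scal by (now apply abs_conv_plus).
  rewrite <- CSeries_plus; [|now apply abs_conv_scal, abs_conv_plus|exact A4].
  apply CSeries_ext; intros n; rewrite trapezoid_cpower by (pose proof (pos_INR n); lra).
  unfold u; rewrite S_INR; replace (INR n + 1 + 1) with (INR n + 2) by ring; ring. }
assert (Hn : (1 - w)%C <> 0%C).
{ intros E; apply (f_equal Re) in E; simpl in E; unfold Re in Hw; lra. }
assert (Hn' : (w - 1)%C <> 0%C).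
{ intros E; apply Hn; replace (1 - w)%C with (- (w - 1))%C by ring; rewrite E; ring. }
unfold zeta_regular.
assert (E4 : S2 = (- / (1 - w) * (1 - (1 - w) * w * (w + 1) * zeta_tail (w + 2)) - / 2)%C).
{ rewrite E3; field; exact Hn. }
rewrite E4; field; split; assumption.
Qed.

(** * Finite combinations of kets *)

Lemma label_eq_inv (s s' : bool) (l m1 m2 j l' m1' m2' j' : Z) :
  Label s l m1 m2 j = Label s' l' m1' m2' j' ->
  s = s' /\ l = l' /\ m1 = m1' /\ m2 = m2' /\ j = j'.
Proof. intros E; injection E; auto. Qed.

(** With integer coordinates, unlike the natural numbers of [admissible_label_at], admissibility of
    a shifted label becomes linear arithmetic. *)
Lemma admissible_coordinates (s : bool) (l m1 m2 j : Z) :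
  admissible (Label s l m1 m2 j) = true <->
  exists n p a b : Z, (0 <= p /\ 0 <= a <= 2 * p + 1 /\ 0 <= b <= 2 * (n - p) + 1 /\
    l = 2 * n + 1 /\ j = 2 * p + 1 /\ m1 = 2 * a - j /\ m2 = 2 * b - (l - j + 1))%Z.
Proof.
rewrite admissible_label_at; unfold label_at; split.
- intros (s' & n & p & a & b & H & E); apply label_eq_inv in E.
  exists (Z.of_nat n), (Z.of_nat p), (Z.of_nat a), (Z.of_nat b). lia.
- intros (n & p & a & b & H).
  exists s, (Z.to_nat n), (Z.to_nat p), (Z.to_nat a), (Z.to_nat b).
  split; [lia|f_equal; lia].
Qed.

Lemma label_eqb_eq (k k' : label) : label_eqb k k' = true <-> k = k'.
Proof.
destruct k, k'; unfold label_eqb; simpl.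
rewrite !Bool.andb_true_iff, Bool.eqb_true_iff, !Z.eqb_eq.
split; [intros ((((-> & ->) & ->) & ->) & ->); reflexivity|].
intros E; injection E; repeat split; assumption.
Qed.

Lemma ket_of_same (k : label) : admissible k = true -> ket_of k k = 1%C.
Proof. intros H; unfold ket_of; rewrite H, (proj2 (label_eqb_eq k k) eq_refl); reflexivity. Qed.

Lemma ket_of_other (k k' : label) : k <> k' -> ket_of k k' = 0%C.
Proof.
intros H; unfold ket_of; destruct (label_eqb k k') eqn:E.
- now apply label_eqb_eq in E.
- now rewrite Bool.andb_false_r.
Qed.

Lemma ket_of_inadmissible (k : label) : admissible k = false -> ket_of k = fun _ => 0%C.
Proof. intros H; apply functional_extensionality; intros k'; unfold ket_of; now rewrite H. Qed.

Lemma ket_of_at_inadmissible (k k' : label) : admissible k' = false -> ket_of k k' = 0%C.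
Proof.
intros H; destruct (excluded_middle_informative (k = k')) as [<-|N].
- now rewrite ket_of_inadmissible.
- now apply ket_of_other.
Qed.

Lemma sum_n_zero {G : AbelianMonoid} (u : nat -> G) (n : nat) :
  (forall i, (i <= n)%nat -> u i = zero) -> sum_n u n = zero.
Proof.
induction n as [|n IH]; intros H; [rewrite sum_O; apply H; lia|].
rewrite sum_Sn, IH, H, plus_zero_l by (try lia; intros; apply H; lia); reflexivity.
Qed.

Lemma sum_n_single {G : AbelianMonoid} (u : nat -> G) (n i : nat) : (i <= n)%nat ->
  (forall i', (i' <= n)%nat -> i' <> i -> u i' = zero) -> sum_n u n = u i.
Proof.
induction n as [|n IH]; intros Hi H.
- replace i with O by lia; apply sum_O.
- rewrite sum_Sn; destruct (Nat.eq_dec i (S n)) as [->|N].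
  + rewrite sum_n_zero, plus_zero_l; [reflexivity|]; intros; apply H; lia.
  + rewrite IH, (H (S n)), plus_zero_r by (try lia; intros; apply H; lia); reflexivity.
Qed.

Lemma label_at_admissible (s : bool) (n p a b : nat) :
  (p <= n)%nat -> (a <= 2 * p + 1)%nat -> (b <= 2 * (n - p) + 1)%nat ->
  admissible (label_at s n p a b) = true.
Proof. intros; apply admissible_label_at; exists s, n, p, a, b; auto. Qed.

Lemma label_at_inj (s s' : bool) (n p a b n' p' a' b' : nat) :
  label_at s n p a b = label_at s' n' p' a' b' ->
  s = s' /\ n = n' /\ p = p' /\ a = a' /\ b = b'.
Proof.
intros H; apply label_eq_inv in H; repeat split; try tauto; lia.
Qed.

Lemma level_sum_zero {G : AbelianMonoid} (F : label -> G) (n : nat) :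
  (forall k, admissible k = true -> lab_l k = (2 * Z.of_nat n + 1)%Z -> F k = zero) ->
  level_sum F n = zero.
Proof.
intros H; apply sum_n_zero; intros p Hp; apply sum_n_zero; intros a Ha.
apply sum_n_zero; intros b Hb.
rewrite !H, plus_zero_l; [reflexivity|..];
  try reflexivity; now apply label_at_admissible.
Qed.

Lemma level_sum_single {G : AbelianMonoid} (F : label -> G) (s : bool) (n p a b : nat) :
  (p <= n)%nat -> (a <= 2 * p + 1)%nat -> (b <= 2 * (n - p) + 1)%nat ->
  (forall k, admissible k = true -> k <> label_at s n p a b -> F k = zero) ->
  level_sum F n = F (label_at s n p a b).
Proof.
intros Hp Ha Hb H; unfold level_sum.
rewrite (sum_n_single _ n p Hp).
- rewrite (sum_n_single _ _ a Ha).
  + rewrite (sum_n_single _ _ b Hb).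
    * destruct s; [rewrite (H (label_at false n p a b))|rewrite (H (label_at true n p a b))];
        try apply plus_zero_r; try apply plus_zero_l; try (now apply label_at_admissible);
        intros E; apply label_at_inj in E; destruct E; discriminate.
    * intros b' Hb' Nb; rewrite !H, plus_zero_l; try reflexivity;
        try (now apply label_at_admissible); intros E; apply label_at_inj in E; tauto.
  + intros a' Ha' Na; apply sum_n_zero; intros b' Hb'; rewrite !H, plus_zero_l; try reflexivity;
      try (now apply label_at_admissible); intros E; apply label_at_inj in E; tauto.
- intros p' Hp' Np; apply sum_n_zero; intros a' Ha'; apply sum_n_zero; intros b' Hb'.
  rewrite !H, plus_zero_l; try reflexivity;
    try (now apply label_at_admissible); intros E; apply label_at_inj in E; tauto.
Qed.

Lemma is_series_single (u : nat -> R) (n : nat) :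
  (forall i, i <> n -> u i = 0) -> is_series u (u n).
Proof.
intros H; apply filterlim_ext_loc with (fun _ => u n).
- exists n; intros N HN; symmetry; apply (sum_n_single (G := R_AbelianMonoid) u N n HN); intros i _ Hi; now apply H.
- apply filterlim_const.
Qed.

Lemma is_series_level_single (F : label -> R) (k : label) : admissible k = true ->
  (forall k', admissible k' = true -> k' <> k -> F k' = 0) -> is_series (level_sum F) (F k).
Proof.
intros Hk H; apply admissible_label_at in Hk.
destruct Hk as (s & n & p & a & b & (Hp & Ha & Hb) & ->).
rewrite <- (level_sum_single (G := R_AbelianMonoid) F s n p a b Hp Ha Hb H).
apply is_series_single; intros i Hi; apply (level_sum_zero (G := R_AbelianMonoid)); intros k' Hk' El.
apply H; [exact Hk'|]; intros ->; cbn [lab_l label_at] in El; lia.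
Qed.

Lemma ex_series_level_finite (F : label -> R) (N : Z) :
  (forall k, admissible k = true -> (N < lab_l k)%Z -> F k = 0) -> ex_series (level_sum F).
Proof.
intros H; apply (ex_series_incr_n _ (Z.to_nat N)); exists 0.
assert (E : forall i, level_sum F (Z.to_nat N + i) = 0).
{ intros i; apply (level_sum_zero (G := R_AbelianMonoid)); intros k Hk El; apply H; [exact Hk|lia]. }
apply filterlim_ext with (fun _ : nat => 0).
- intros n; symmetry; apply (sum_n_zero (G := R_AbelianMonoid)); intros i _; apply E.
- apply filterlim_const.
Qed.

Lemma inH_finite (f : vec) (N : Z) : (forall k, admissible k = false -> f k = 0%C) ->
  (forall k, (N < lab_l k)%Z -> f k = 0%C) -> inH f.
Proof.
intros H1 H2; split; [exact H1|]; apply ex_series_level_finite with N.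
intros k _ Hk; rewrite H2, Cmod_0 by exact Hk; ring.
Qed.

Lemma inH_zero : inH (fun _ => 0%C).
Proof. now apply inH_finite with 0%Z. Qed.

(** * Sums of weighted shifts and operations on them *)

(** The components shift the true labels, hence the factor 2 in [move]. The flip of chirality is
    there for commutators with [Dirac]. *)
Record displacement := Displacement { sh_flip : bool; sh_l : Z; sh_m1 : Z; sh_m2 : Z; sh_j : Z }.

Definition move (v : displacement) (k : label) : label :=
  Label (xorb (sh_flip v) (chirality k)) (lab_l k + 2 * sh_l v) (lab_m1 k + 2 * sh_m1 v)
        (lab_m2 k + 2 * sh_m2 v) (lab_j k + 2 * sh_j v).

Definition sh_add (v w : displacement) : displacement :=
  Displacement (xorb (sh_flip v) (sh_flip w)) (sh_l v + sh_l w) (sh_m1 v + sh_m1 w)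
        (sh_m2 v + sh_m2 w) (sh_j v + sh_j w).

Definition sh_opp (v : displacement) : displacement :=
  Displacement (sh_flip v) (- sh_l v) (- sh_m1 v) (- sh_m2 v) (- sh_j v).

Definition sh_toggle (v : displacement) : displacement :=
  Displacement (negb (sh_flip v)) (sh_l v) (sh_m1 v) (sh_m2 v) (sh_j v).

Ltac label_cbn :=
  cbn [chirality lab_l lab_m1 lab_m2 lab_j sh_flip sh_l sh_m1 sh_m2 sh_j].

Lemma move_add (v w : displacement) (k : label) : move (sh_add v w) k = move v (move w k).
Proof.
unfold move, sh_add; label_cbn; f_equal; [|lia..].
now destruct (sh_flip v), (sh_flip w), (chirality k).
Qed.

Lemma move_opp_l (v : displacement) (k : label) : move (sh_opp v) (move v k) = k.
Proof.
destruct k as [s l m1 m2 j]; unfold move, sh_opp; label_cbn; f_equal; [|lia..].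
now destruct (sh_flip v), s.
Qed.

Lemma move_opp_r (v : displacement) (k : label) : move v (move (sh_opp v) k) = k.
Proof.
destruct k as [s l m1 m2 j]; unfold move, sh_opp; label_cbn; f_equal; [|lia..].
now destruct (sh_flip v), s.
Qed.

Lemma move_flip (v : displacement) (k : label) : move v (flip k) = flip (move v k).
Proof.
unfold move, flip; label_cbn; f_equal; now destruct (sh_flip v), (chirality k).
Qed.

Lemma move_toggle (v : displacement) (k : label) : move (sh_toggle v) k = flip (move v k).
Proof.
unfold move, sh_toggle, flip; label_cbn; f_equal; now destruct (sh_flip v), (chirality k).
Qed.

Lemma admissible_flip (k : label) : admissible (flip k) = admissible k.
Proof. now destruct k. Qed.

Arguments admissible : simpl never.
Arguments move : simpl never.

(** [t_symbol] carries the leading constant of [t_coef], so that symbols are multiplied, scaled and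
    conjugated along with the coefficients; [good] states how the two are related. *)
Record term := Term { t_shift : displacement; t_coef : label -> C; t_symbol : C }.

Definition apply_terms (L : list term) (k : label) : vec :=
  fold_right (fun t f => vadd (vscal (t_coef t k) (ket_of (move (t_shift t) k))) f)
    (fun _ => 0%C) L.

(** Only kets are tested: the trace sees nothing else, and since their images are finite
    combinations, composition requires linearity but no continuity. *)
Definition represents (T : op) (L : list term) : Prop :=
  forall k, admissible k = true -> T (ket_of k) = apply_terms L k.

Lemma apply_terms_app (L L' : list term) (k : label) :
  apply_terms (L ++ L') k = vadd (apply_terms L k) (apply_terms L' k).
Proof.
apply functional_extensionality; intros k'.
induction L as [|t L IH]; simpl; unfold vadd in *; [ring|]; rewrite IH; ring.
Qed.

Lemma inH_ket (k : label) : inH (ket_of k).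
Proof.
apply inH_finite with (lab_l k).
- intros k' H; now apply ket_of_at_inadmissible.
- intros k' H; apply ket_of_other; intros ->; lia.
Qed.

Lemma inH_scal_ket (c : C) (k : label) : inH (vscal c (ket_of k)).
Proof.
apply inH_finite with (lab_l k).
- intros k' H; unfold vscal; rewrite ket_of_at_inadmissible by exact H; ring.
- intros k' H; unfold vscal; rewrite ket_of_other; [ring|]; intros ->; lia.
Qed.

Lemma inH_apply_terms (L : list term) (k : label) : inH (apply_terms L k).
Proof.
assert (exists N, forall k', (N < lab_l k')%Z -> apply_terms L k k' = 0%C) as [N HN].
{ induction L as [|t L [N IH]]; [now exists 0%Z|].
  exists (Z.max N (lab_l (move (t_shift t) k))); intros k' Hk'; simpl; unfold vadd, vscal.
  rewrite IH by lia; rewrite ket_of_other; [ring|]; intros <-; lia. }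
apply inH_finite with N; [|exact HN].
intros k' Hk'; clear HN; induction L as [|t L IH]; [reflexivity|].
simpl; unfold vadd, vscal; fold (apply_terms L k).
rewrite ket_of_at_inadmissible, IH by exact Hk'; ring.
Qed.

Definition lin_op (T : op) : Prop :=
  (forall f, inH f -> inH (T f)) /\
  (forall f g, inH f -> inH g -> T (vadd f g) = vadd (T f) (T g)) /\
  (forall c f, inH f -> T (vscal c f) = vscal c (T f)).

Lemma bounded_lin_op (T : op) : bounded_op T -> lin_op T.
Proof. intros (H1 & H2 & H3 & _); repeat split; assumption || apply H1; assumption. Qed.

Lemma lin_op_zero (T : op) : lin_op T -> T (fun _ => 0%C) = fun _ => 0%C.
Proof.
intros (_ & _ & H).
replace (fun _ : label => RtoC 0) with (vscal 0 (fun _ : label => RtoC 0)) at 1.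
- rewrite H by exact inH_zero; apply functional_extensionality; intros k; unfold vscal; ring.
- apply functional_extensionality; intros k; unfold vscal; ring.
Qed.

Lemma lin_op_apply_terms (T : op) (L : list term) (k : label) : lin_op T ->
  T (apply_terms L k) =
  fold_right (fun t f => vadd (vscal (t_coef t k) (T (ket_of (move (t_shift t) k)))) f)
    (fun _ => 0%C) L.
Proof.
intros HT; assert (HT' := HT); destruct HT' as (_ & H2 & H3).
induction L as [|t L IH]; simpl; [now apply lin_op_zero|].
rewrite H2, H3 by (apply inH_scal_ket || apply inH_ket || apply (inH_apply_terms L)).
now rewrite IH.
Qed.

(** The guard reflects that kets with inadmissible labels are 0: a path through such a ket
    contributes nothing, even when its endpoint is admissible. *)
Definition term_mul (t s : term) : term :=
  Term (sh_add (t_shift t) (t_shift s))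
    (fun k => if admissible (move (t_shift s) k)
              then (t_coef t (move (t_shift s) k) * t_coef s k)%C else 0%C)
    (t_symbol t * t_symbol s)%C.

Definition terms_mul (L L' : list term) : list term :=
  flat_map (fun s => map (fun t => term_mul t s) L) L'.

Lemma represents_comp (T S : op) (L L' : list term) : lin_op T ->
  represents T L -> represents S L' -> represents (op_comp T S) (terms_mul L L').
Proof.
intros HT H H' k Hk; unfold op_comp; rewrite H' by exact Hk.
rewrite lin_op_apply_terms by exact HT; clear H'.
induction L' as [|s L' IH]; [reflexivity|].
simpl; rewrite apply_terms_app, IH; f_equal.
apply functional_extensionality; intros k'.
destruct (admissible (move (t_shift s) k)) eqn:E.
- rewrite H by exact E; clear IH H.
  induction L as [|t L IH]; simpl; unfold vadd, vscal in *; [ring|].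
  rewrite <- IH, E, move_add; fold (apply_terms L (move (t_shift s) k)); ring.
- rewrite ket_of_inadmissible, lin_op_zero by assumption; clear IH H.
  induction L as [|t L IH]; simpl; unfold vadd, vscal in *; [ring|].
  rewrite <- IH, E; ring.
Qed.

Definition term_scal (c : C) (t : term) : term :=
  Term (t_shift t) (fun k => c * t_coef t k)%C (c * t_symbol t)%C.

Lemma represents_scal (c : C) (T : op) (L : list term) :
  represents T L -> represents (fun f => vscal c (T f)) (map (term_scal c) L).
Proof.
intros H k Hk; rewrite H by exact Hk; apply functional_extensionality; intros k'; clear H.
unfold vscal; induction L as [|t L IH]; simpl; unfold vadd, vscal in *; [ring|].
rewrite <- IH; fold (apply_terms L k); ring.
Qed.

Lemma represents_add (T S : op) (L L' : list term) : represents T L -> represents S L' ->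
  represents (fun f => vadd (T f) (S f)) (L ++ L').
Proof. intros H H' k Hk; rewrite H, H', apply_terms_app by exact Hk; reflexivity. Qed.

Lemma represents_ext (T S : op) (L : list term) :
  op_eq T S -> represents T L -> represents S L.
Proof. intros E H k Hk; rewrite <- E by apply inH_ket; now apply H. Qed.

Lemma total_single (F : label -> C) (k : label) : admissible k = true ->
  (forall k', k' <> k -> F k' = 0%C) -> total F = F k.
Proof.
intros Hk H; unfold total; rewrite (surjective_pairing (F k)); f_equal.
- apply is_series_unique, (is_series_level_single (fun k => Re (F k)) k Hk).
  intros k' _ N; now rewrite H.
- apply is_series_unique, (is_series_level_single (fun k => Im (F k)) k Hk).
  intros k' _ N; now rewrite H.
Qed.

Lemma adjoint_entry (T S : op) (k k' : label) : is_adjoint T S ->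
  admissible k = true -> admissible k' = true ->
  S (ket_of k) k' = Cconj (T (ket_of k') k).
Proof.
intros H Hk Hk'; specialize (H (ket_of k) (ket_of k') (inH_ket k) (inH_ket k')).
unfold inner in H.
rewrite (total_single _ k' Hk'), (total_single _ k Hk) in H.
- rewrite !ket_of_same in H by assumption.
  rewrite <- (Cconj_conj (S (ket_of k) k')); f_equal.
  rewrite <- (Cmult_1_r (Cconj _)), H.
  replace (Cconj 1) with (RtoC 1); [ring|].
  unfold Cconj, RtoC; simpl; f_equal; ring.
- intros x Hx; rewrite ket_of_other by congruence.
  replace (Cconj 0) with (RtoC 0); [ring|].
  unfold Cconj, RtoC; simpl; f_equal; ring.
- intros x Hx; rewrite (ket_of_other k') by congruence; ring.
Qed.

Definition term_adj (t : term) : term :=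
  Term (sh_opp (t_shift t)) (fun k => Cconj (t_coef t (move (sh_opp (t_shift t)) k)))
    (Cconj (t_symbol t)).

Lemma Cconj_0 : Cconj 0 = 0%C.
Proof. unfold Cconj, RtoC; simpl; f_equal; ring. Qed.

Lemma Cconj_1 : Cconj 1 = 1%C.
Proof. unfold Cconj, RtoC; simpl; f_equal; ring. Qed.

Lemma represents_adj (T S : op) (L : list term) : lin_op S -> is_adjoint T S ->
  represents T L -> represents S (map term_adj L).
Proof.
intros HS HA H k Hk; apply functional_extensionality; intros k'.
destruct (admissible k') eqn:Hk'.
- rewrite (adjoint_entry T S) by assumption; rewrite H by exact Hk'; clear H.
  induction L as [|t L IH]; [apply Cconj_0|].
  simpl; unfold vadd, vscal; rewrite Cplus_conj, Cmult_conj, <- IH; f_equal.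
  unfold term_adj; simpl.
  destruct (excluded_middle_informative (move (t_shift t) k' = k)) as [E|N].
  + rewrite <- E, move_opp_l, !ket_of_same, Cconj_1 by (rewrite ?E; assumption); reflexivity.
  + rewrite !ket_of_other, Cconj_0; [ring| |exact N].
    intros E; apply N; rewrite <- E; apply move_opp_r.
- rewrite (proj1 (inH_apply_terms _ k)) by exact Hk'.
  apply (proj1 HS (ket_of k) (inH_ket k)), Hk'.
Qed.

Lemma inH_diagonal_ket (w : label -> C) (k : label) :
  (fun k' => (w k' * ket_of k k')%C) = vscal (w k) (ket_of k).
Proof.
apply functional_extensionality; intros k'; unfold vscal.
destruct (excluded_middle_informative (k = k')) as [->|N]; [reflexivity|].
rewrite ket_of_other by exact N; ring.
Qed.

Lemma absD_ket_of (k : label) : absD (ket_of k) = vscal (RtoC (eigenvalue k)) (ket_of k).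
Proof. apply (inH_diagonal_ket (fun k => RtoC (eigenvalue k))). Qed.

Lemma ket_of_flip (k k' : label) : ket_of (flip k) k' = ket_of k (flip k').
Proof.
unfold ket_of; rewrite admissible_flip; do 2 f_equal.
destruct k as [s l m1 m2 j], k' as [s' l' m1' m2' j']; unfold label_eqb, flip; simpl.
now destruct s, s'.
Qed.

Lemma Dirac_ket_of (k : label) : Dirac (ket_of k) = vscal (RtoC (eigenvalue k)) (ket_of (flip k)).
Proof.
change (eigenvalue k) with (eigenvalue (flip k)).
rewrite <- (inH_diagonal_ket (fun k' => RtoC (eigenvalue k')) (flip k)).
apply functional_extensionality; intros k'; unfold Dirac.
now rewrite ket_of_flip.
Qed.

(** [absD] is diagonal and the shift changes its eigenvalue by [sh_l], so the commutator multiplies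
    the term by this integer. *)
Definition term_delta (t : term) : term := term_scal (RtoC (IZR (sh_l (t_shift t)))) t.

Lemma eigenvalue_move (v : displacement) (k : label) :
  eigenvalue (move v k) = eigenvalue k + IZR (sh_l v).
Proof. unfold eigenvalue, half, move; cbn [lab_l]; rewrite plus_IZR, mult_IZR; field. Qed.

Lemma represents_delta (T S : op) (L : list term) : is_commutator absD T S ->
  represents T L -> represents S (map term_delta L).
Proof.
intros (HT & _ & H) HL k Hk; apply functional_extensionality; intros k'.
apply bounded_lin_op in HT; destruct HT as (_ & _ & HT).
assert (Hin : inH (absD (ket_of k))) by (rewrite absD_ket_of; apply inH_scal_ket).
rewrite (proj2 (H _ (inH_ket k) Hin)), absD_ket_of, HT, HL by (assumption || apply inH_ket).
unfold absD; clear; unfold vscal.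
induction L as [|t L IH]; simpl; unfold vadd, vscal; [ring|].
rewrite <- IH; fold (apply_terms L k).
destruct (excluded_middle_informative (move (t_shift t) k = k')) as [<-|N].
- rewrite eigenvalue_move, RtoC_plus; ring.
- rewrite ket_of_other by exact N; ring.
Qed.

(** [Dirac] is [absD] combined with the exchange of chiralities. Moving it past a shift yields the
    change of eigenvalue and, multiplied by the unbounded eigenvalue, the discrepancy between the
    two chiral coefficients. *)
Definition term_dirac (t : term) : term :=
  Term (sh_toggle (t_shift t))
    (fun k => IZR (sh_l (t_shift t)) * t_coef t k
              + eigenvalue k * (t_coef t k - t_coef t (flip k)))%C
    (RtoC (IZR (sh_l (t_shift t))) * t_symbol t)%C.

Lemma represents_dirac (T S : op) (L : list term) : is_commutator Dirac T S ->
  represents T L -> represents S (map term_dirac L).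
Proof.
intros (HT & _ & H) HL k Hk; apply functional_extensionality; intros k'.
apply bounded_lin_op in HT; destruct HT as (_ & _ & HT).
assert (Hin : inH (Dirac (ket_of k))) by (rewrite Dirac_ket_of; apply inH_scal_ket).
rewrite (proj2 (H _ (inH_ket k) Hin)), Dirac_ket_of, HT, !HL
  by (try apply inH_ket; rewrite ?admissible_flip; assumption).
unfold Dirac; clear; unfold vscal.
induction L as [|t L IH]; simpl; unfold vadd, vscal; [ring|].
rewrite <- IH; fold (apply_terms L k); fold (apply_terms L (flip k)).
rewrite move_flip, move_toggle, ket_of_flip.
destruct (excluded_middle_informative (move (t_shift t) k = flip k')) as [E|N].
- assert (Ee : eigenvalue k' = eigenvalue k + IZR (sh_l (t_shift t))).
  { rewrite <- eigenvalue_move, E; now destruct k'. }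
  rewrite Ee, RtoC_plus; ring.
- rewrite ket_of_other by exact N; ring.
Qed.

(** * Symbols modulo negligible coefficients *)

Definition qh (q : R) (z : Z) : R := Rpower q (half z).

Lemma Rpower_decr (q a b : R) : 0 < q < 1 -> a <= b -> Rpower q b <= Rpower q a.
Proof.
intros Hq Hab; unfold Rpower.
assert (ln q < 0) by (rewrite <- ln_1; apply ln_increasing; lra).
destruct (Rle_lt_or_eq_dec _ _ Hab) as [H1| ->]; [|lra].
apply Rlt_le, exp_increasing; nra.
Qed.

Lemma Rpower_le_1 (q a : R) : 0 < q < 1 -> 0 <= a -> Rpower q a <= 1.
Proof. intros Hq Ha; rewrite <- (Rpower_O q) by lra; now apply Rpower_decr. Qed.

Lemma qh_pos (q : R) (z : Z) : 0 < qh q z.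
Proof. apply exp_pos. Qed.

Lemma qh_add (q : R) (a b : Z) : qh q (a + b) = qh q a * qh q b.
Proof. unfold qh; rewrite <- Rpower_plus; f_equal; unfold half; rewrite plus_IZR; field. Qed.

Lemma qh_decr (q : R) (a b : Z) : 0 < q < 1 -> (a <= b)%Z -> qh q b <= qh q a.
Proof. intros Hq H; apply Rpower_decr; [exact Hq|]; unfold half; apply IZR_le in H; lra. Qed.

Lemma qh_0 (q : R) : 0 < q -> qh q 0 = 1.
Proof. intros Hq; unfold qh, half; replace (0 / 2) with 0 by field; now apply Rpower_O. Qed.

(** For true labels (half of the stored ones), [alpha] is [2 (j + m1)] and [beta] is
    [2 (l - j + m2)]: the distances of [m1] and [m2] to the lower ends of their ranges, up to the
    offset [-1] for [beta]. *)
Definition alpha (k : label) : Z := (lab_m1 k + lab_j k)%Z.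
Definition beta (k : label) : Z := (lab_m2 k + lab_l k - lab_j k)%Z.

(** Diagonal entries bounded by [weight] contribute [O(N)] to the trace on the eigenspace of the
    eigenvalue [N], hence nothing singular in the half plane [Re s > 2]. *)
Definition weight (q : R) (k : label) : R := qh q (lab_j k) + qh q (alpha k) * qh q (beta k).

Lemma admissible_bounds (k : label) : admissible k = true ->
  (1 <= lab_j k <= lab_l k /\ 0 <= alpha k /\ -1 <= beta k)%Z.
Proof.
destruct k as [s l m1 m2 j]; intros H; apply admissible_coordinates in H.
destruct H as (n & p & a & b & H); unfold alpha, beta; cbn [lab_l lab_m1 lab_m2 lab_j]; lia.
Qed.

(** The shifts that do not move the upper ends of the ranges of [m1] and [m2]. *)
Definition main (v : displacement) : Prop := sh_m1 v = sh_j v /\ sh_m2 v = (sh_l v - sh_j v)%Z.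

Lemma beta_move (v : displacement) (k : label) :
  beta (move v k) = (beta k + 2 * (sh_m2 v + sh_l v - sh_j v))%Z.
Proof. unfold beta, move; cbn [lab_l lab_m2 lab_j]; lia. Qed.

Lemma alpha_move (v : displacement) (k : label) :
  alpha (move v k) = (alpha k + 2 * (sh_m1 v + sh_j v))%Z.
Proof. unfold alpha, move; cbn [lab_m1 lab_j]; lia. Qed.

(** Distances to the upper ends are preserved, so the target can only fail through small [j] or at a
    lower end. In the middle case [alpha] moves by [4 * sh_j v] because [sh_m1 v = sh_j v]. *)
Lemma main_inadmissible (v : displacement) (k : label) : main v ->
  admissible k = true -> admissible (move v k) = false ->
  (lab_j k + 2 * sh_j v < 1 \/ alpha k + 4 * sh_j v < 0 \/ beta (move v k) < -1)%Z.
Proof.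
intros [M1 M2] H H'; rewrite beta_move.
destruct (Z_lt_dec (lab_j k + 2 * sh_j v) 1) as [|N1]; [now left|].
destruct (Z_lt_dec (alpha k + 4 * sh_j v) 0) as [|N2]; [now right; left|].
destruct (Z_lt_dec (beta k + 2 * (sh_m2 v + sh_l v - sh_j v)) (-1)) as [|N3]; [now right; right|].
exfalso; destruct k as [s l m1 m2 j]; unfold alpha, beta in *.
apply admissible_coordinates in H; destruct H as (n & p & a & b & H).
cbn [lab_l lab_m1 lab_m2 lab_j] in *.
apply Bool.not_true_iff_false in H'; apply H'; unfold move.
cbn [chirality lab_l lab_m1 lab_m2 lab_j].
apply admissible_coordinates.
exists (n + sh_l v)%Z, (p + sh_j v)%Z, (a + 2 * sh_j v)%Z, (b + 2 * (sh_l v - sh_j v))%Z; lia.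
Qed.

Definition adm2 (v : displacement) (k : label) : Prop :=
  admissible k = true /\ admissible (move v k) = true.

(** A coefficient is good when, up to a multiple of [weight], it is a function
    [f + g (beta k)] with [g] exponentially small; [f] is the leading symbol. Only shifts by
    multiples of (dl, dm1, dm2, dj) = (1, 0, 1, 0) can have a nonzero leading symbol. *)
Definition good_with (q : R) (v : displacement) (c : label -> C) (f : C) (g : Z -> C) (K : R) : Prop :=
  0 <= K /\
  (forall b, (-1 <= b)%Z -> Cmod (g b) <= K * qh q b) /\
  (forall k, adm2 v k -> Cmod (c k - f - g (beta k))%C <= K * weight q k) /\
  (main v \/ (f = 0%C /\ forall b, g b = 0%C)) /\
  (f = 0%C \/ sh_j v = 0%Z).

Definition good (q : R) (t : term) : Prop :=
  exists g K, good_with q (t_shift t) (t_coef t) (t_symbol t) g K.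

Lemma weight_pos (q : R) (k : label) : 0 < weight q k.
Proof.
unfold weight; pose proof (qh_pos q (lab_j k)); pose proof (qh_pos q (alpha k)).
pose proof (qh_pos q (beta k)); nra.
Qed.

Lemma qh_beta_le (q : R) (b : Z) : 0 < q < 1 -> (-1 <= b)%Z -> qh q b <= qh q (-1).
Proof. intros; now apply qh_decr. Qed.

Lemma qh_le_1 (q : R) (z : Z) : 0 < q < 1 -> (0 <= z)%Z -> qh q z <= 1.
Proof. intros Hq Hz; rewrite <- (qh_0 q) by lra; now apply qh_decr. Qed.

Lemma weight_le (q : R) (k : label) : 0 < q < 1 -> admissible k = true ->
  weight q k <= 1 + qh q (-1).
Proof.
intros Hq Hk; apply admissible_bounds in Hk; destruct Hk as (H1 & H2 & H3).
assert (A := qh_le_1 q (lab_j k) Hq ltac:(lia)).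
assert (B := qh_le_1 q (alpha k) Hq H2); assert (D := qh_beta_le q (beta k) Hq H3).
unfold weight; pose proof (qh_pos q (alpha k)); pose proof (qh_pos q (beta k)); nra.
Qed.

Lemma weight_move (q : R) (v : displacement) : 0 < q < 1 ->
  exists K, 0 < K /\ forall k, weight q (move v k) <= K * weight q k.
Proof.
intros Hq.
set (x := qh q (2 * sh_j v)).
set (y := qh q (2 * (sh_m1 v + sh_j v)) * qh q (2 * (sh_m2 v + sh_l v - sh_j v))).
assert (Hx : 0 < x) by apply qh_pos.
assert (Hy : 0 < y) by (apply Rmult_lt_0_compat; apply qh_pos).
exists (x + y); split; [lra|]; intros k.
unfold weight; rewrite alpha_move, beta_move.
change (lab_j (move v k)) with (lab_j k + 2 * sh_j v)%Z.
rewrite !qh_add; fold x.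
replace (qh q (alpha k) * qh q (2 * (sh_m1 v + sh_j v)) *
         (qh q (beta k) * qh q (2 * (sh_m2 v + sh_l v - sh_j v))))
  with (qh q (alpha k) * qh q (beta k) * y) by (unfold y; ring).
assert (0 < qh q (alpha k) * qh q (beta k)) by (apply Rmult_lt_0_compat; apply qh_pos).
pose proof (qh_pos q (lab_j k)); nra.
Qed.

Lemma good_bounded (q : R) (v : displacement) (c : label -> C) (f : C) (g : Z -> C) (K : R) :
  0 < q < 1 -> good_with q v c f g K ->
  exists B, 0 <= B /\
    (forall b, (-1 <= b)%Z -> Cmod (f + g b)%C <= B) /\ (forall k, adm2 v k -> Cmod (c k) <= B).
Proof.
intros Hq (HK & Hg & Hc & _).
set (Q := qh q (-1)); assert (HQ : 0 < Q) by apply qh_pos.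
pose proof (Cmod_ge_0 f).
assert (Hfg : forall b, (-1 <= b)%Z -> Cmod (f + g b)%C <= Cmod f + K * Q).
{ intros b Hb; eapply Rle_trans; [apply Cmod_triangle|].
  specialize (Hg b Hb); pose proof (qh_beta_le q b Hq Hb) as Hb'; fold Q in Hb'.
  apply Rplus_le_compat_l; nra. }
exists (Cmod f + K * Q + K * (1 + Q)); repeat split; [nra| |].
- intros b Hb; specialize (Hfg b Hb); nra.
- intros k Hk; replace (c k) with ((f + g (beta k)) + (c k - f - g (beta k)))%C by ring.
  eapply Rle_trans; [apply Cmod_triangle|].
  specialize (Hc k Hk); destruct Hk as [Hk _].
  pose proof (weight_le q k Hq Hk) as Hw; fold Q in Hw.
  specialize (Hfg (beta k) (proj2 (proj2 (admissible_bounds k Hk)))); nra.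
Qed.

Lemma good_of_small (q : R) (v : displacement) (c : label -> C) (K : R) :
  0 <= K -> (forall k, adm2 v k -> Cmod (c k) <= K * weight q k) -> good q (Term v c 0%C).
Proof.
intros HK H; exists (fun _ => 0%C), K; split; [exact HK|repeat split].
- intros b _; rewrite Cmod_0; pose proof (qh_pos q b); nra.
- intros k Hk; cbn [t_coef t_symbol].
  replace (c k - 0 - 0)%C with (c k) by ring; now apply H.
- right; auto.
- now left.
Qed.

Lemma good_scal (q : R) (a : C) (t : term) : good q t -> good q (term_scal a t).
Proof.
intros (g & K & HK & Hg & Hc & Hm & Hj).
pose proof (Cmod_ge_0 a).
exists (fun b => a * g b)%C, (Cmod a * K); unfold term_scal; cbn [t_shift t_coef t_symbol].
repeat split.
- nra.
- intros b Hb; rewrite Cmod_mult, Rmult_assoc; apply Rmult_le_compat_l; auto.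
- intros k Hk.
  replace (a * t_coef t k - a * t_symbol t - a * g (beta k))%C
    with (a * (t_coef t k - t_symbol t - g (beta k)))%C by ring.
  rewrite Cmod_mult, Rmult_assoc; apply Rmult_le_compat_l; auto.
- destruct Hm as [Hm|[H1 H2]]; [now left|right; split; [rewrite H1; ring|]].
  intros b; rewrite H2; ring.
- destruct Hj as [->|Hj]; [left; ring|now right].
Qed.

Lemma good_adj (q : R) (t : term) : 0 < q < 1 -> good q t -> good q (term_adj t).
Proof.
intros Hq (g & K & HK & Hg & Hc & Hm & Hj).
set (v := t_shift t) in *; set (d := (2 * (sh_m2 v + sh_l v - sh_j v))%Z).
destruct (weight_move q (sh_opp v) Hq) as (Kw & HKw & Hw).
assert (Hd := qh_pos q (- d)).
(* The boundary function is transported along the change [d] of [beta]. Below [-1] nothing is known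
   about [g], and 0 is a safe value: admissible targets of the adjoint shift never lead there. *)
exists (fun b => if (-1 <=? b - d)%Z then Cconj (g (b - d)%Z) else 0%C), (K * qh q (- d) + K * Kw).
unfold term_adj; fold v; cbn [t_shift t_coef t_symbol].
assert (HKd : 0 <= K * qh q (- d)) by nra.
assert (HKK : 0 <= K * Kw) by nra.
repeat split.
- lra.
- intros b Hb; pose proof (qh_pos q b); destruct (Z.leb_spec (-1) (b - d)).
  + rewrite Cmod_conj; eapply Rle_trans; [now apply Hg|].
    unfold Z.sub; rewrite qh_add; nra.
  + rewrite Cmod_0; nra.
- intros k [H1 H2].
  assert (E : adm2 v (move (sh_opp v) k)) by (split; [exact H2|now rewrite move_opp_r]).
  assert (Eb : beta (move (sh_opp v) k) = (beta k - d)%Z)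
    by (rewrite beta_move; unfold d, sh_opp; cbn [sh_l sh_m1 sh_m2 sh_j]; lia).
  specialize (Hc _ E); rewrite Eb in Hc.
  rewrite (proj2 (Z.leb_le (-1) (beta k - d))) by (rewrite <- Eb; apply admissible_bounds, H2).
  rewrite <- !Cminus_conj, Cmod_conj.
  eapply Rle_trans; [exact Hc|].
  pose proof (weight_pos q k); specialize (Hw k).
  assert (0 <= K * qh q (- d) * weight q k) by (apply Rmult_le_pos; lra).
  assert (K * weight q (move (sh_opp v) k) <= K * (Kw * weight q k)) by (now apply Rmult_le_compat_l).
  lra.
- destruct Hm as [[M1 M2]|[H1 H2]].
  + left; split; cbn; lia.
  + right; split; [rewrite H1; apply Cconj_0|].
    intros b; rewrite H2, Cconj_0; now destruct (_ <=? _)%Z.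
- destruct Hj as [->|Hj]; [left; apply Cconj_0|right; cbn; lia].
Qed.

(** The leading parts multiply as [(f1 + g1) (f2 + g2)], with [g1] evaluated after the first shift;
    what remains is to place the defects where the intermediate ket is inadmissible. *)
Lemma good_mul (q : R) (t s : term) : 0 < q < 1 -> good q t -> good q s -> good q (term_mul t s).
Proof.
intros Hq (g1 & K1 & G1) (g2 & K2 & G2).
destruct (good_bounded _ _ _ _ _ _ Hq G1) as (B1 & HB1 & Hh1 & Hc1).
destruct (good_bounded _ _ _ _ _ _ Hq G2) as (B2 & HB2 & Hh2 & Hc2).
destruct G1 as (HK1 & Hg1 & He1 & Hm1 & Hj1), G2 as (HK2 & Hg2 & He2 & Hm2 & Hj2).
set (v := t_shift t) in *; set (w := t_shift s) in *.
set (f1 := t_symbol t) in *; set (f2 := t_symbol s) in *.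
set (c1 := t_coef t) in *; set (c2 := t_coef s) in *.
destruct (weight_move q w Hq) as (Kw & HKw & Hw).
unfold term_mul, good; cbn [t_shift t_coef t_symbol]; fold v w f1 f2 c1 c2.
assert (Hsplit : forall k, adm2 (sh_add v w) k -> admissible (move w k) = true ->
                 adm2 v (move w k) /\ adm2 w k).
{ intros k [H1 H2] H3; rewrite move_add in H2; split; split; assumption. }
(* If one factor is negligible so is the product, the other factor being bounded. Afterwards both
   shifts may be assumed to satisfy [main]. *)
assert (Hzero : (f1 = 0%C /\ (forall b, g1 b = 0%C)) \/ (f2 = 0%C /\ (forall b, g2 b = 0%C)) ->
  exists g K, good_with q (sh_add v w)
    (fun k => if admissible (move w k) then (c1 (move w k) * c2 k)%C else 0%C) (f1 * f2)%C g K).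
{ intros Hz; replace (f1 * f2)%C with (RtoC 0) by (destruct Hz as [[-> _]|[-> _]]; ring).
  assert (HKa : 0 <= K1 * Kw * B2) by (repeat apply Rmult_le_pos; lra).
  assert (HKb : 0 <= B1 * K2) by (apply Rmult_le_pos; lra).
  assert (HK : 0 <= K1 * Kw * B2 + B1 * K2) by lra.
  apply (good_of_small q (sh_add v w) _ (K1 * Kw * B2 + B1 * K2) HK).
  intros k Hk; pose proof (weight_pos q k).
  destruct (admissible (move w k)) eqn:E; [|rewrite Cmod_0; nra].
  destruct (Hsplit k Hk E) as [A1 A2]; rewrite Cmod_mult.
  specialize (Hc1 _ A1); specialize (Hc2 _ A2).
  destruct Hz as [[Z1 Z2]|[Z1 Z2]].
  - specialize (He1 _ A1); rewrite Z1, Z2 in He1.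
    replace (c1 (move w k) - 0 - 0)%C with (c1 (move w k)) in He1 by ring.
    specialize (Hw k).
    apply Rle_trans with (K1 * Kw * weight q k * B2).
    + apply Rmult_le_compat; try apply Cmod_ge_0; [|exact Hc2].
      eapply Rle_trans; [exact He1|]; rewrite Rmult_assoc; now apply Rmult_le_compat_l.
    + assert (0 <= B1 * K2 * weight q k) by (apply Rmult_le_pos; lra). lra.
  - specialize (He2 _ A2); rewrite Z1, Z2 in He2.
    replace (c2 k - 0 - 0)%C with (c2 k) in He2 by ring.
    apply Rle_trans with (B1 * (K2 * weight q k)).
    + apply Rmult_le_compat; try apply Cmod_ge_0; assumption.
    + assert (0 <= K1 * Kw * B2 * weight q k) by (apply Rmult_le_pos; lra). lra. }
destruct Hm1 as [Hm1|Hm1]; [|apply Hzero; now left].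
destruct Hm2 as [Hm2|Hm2]; [|apply Hzero; now right].
clear Hzero.
set (d := (2 * (sh_m2 w + sh_l w - sh_j w))%Z).
set (Q := qh q (-1)); assert (HQ : 0 < Q) by apply qh_pos.
assert (Hd := qh_pos q d); assert (Hd1 := qh_pos q (d + 1)).
pose proof (Cmod_ge_0 f1) as F1; pose proof (Cmod_ge_0 f2) as F2.
set (Kg := Cmod f1 * K2 + K1 * qh q d * Cmod f2 + K1 * Q * K2 + Cmod f1 * Cmod f2 * qh q (d + 1)).
set (Ke := K1 * Kw * B2 + B1 * K2 + B1 * B2 * qh q (2 * sh_j w - 1) + B1 * K2 * qh q (4 * sh_j w)).
assert (HKg : 0 <= Kg).
{ unfold Kg; repeat apply Rplus_le_le_0_compat; repeat apply Rmult_le_pos; lra. }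
assert (P1 := qh_pos q (2 * sh_j w - 1)); assert (P2 := qh_pos q (4 * sh_j w)).
assert (HKe0 : 0 <= K1 * Kw * B2 /\ 0 <= B1 * K2 /\ 0 <= B1 * B2 * qh q (2 * sh_j w - 1)
               /\ 0 <= B1 * K2 * qh q (4 * sh_j w)).
{ repeat split; repeat apply Rmult_le_pos; lra. }
assert (HKe : 0 <= Ke) by (unfold Ke; lra).
(* When [b + d < -1] the intermediate ket lies below the range of [m2] and the product is 0, so the
   boundary function must cancel [f1 * f2]. This concerns a bounded range of [b], which the last
   summand of [Kg] pays for. *)
exists (fun b => if (-1 <=? b + d)%Z
                 then ((f1 + g1 (b + d)%Z) * (f2 + g2 b) - f1 * f2)%C else (- (f1 * f2))%C),
  (Kg + Ke).
split; [lra|split; [|split; [|split]]].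
- intros b Hb; pose proof (qh_pos q b) as Hqb.
  enough (Cmod (if (-1 <=? b + d)%Z
     then ((f1 + g1 (b + d)%Z) * (f2 + g2 b) - f1 * f2)%C else (- (f1 * f2))%C) <= Kg * qh q b) by nra.
  destruct (Z.leb_spec (-1) (b + d)) as [Hbd|Hbd].
  + replace ((f1 + g1 (b + d)%Z) * (f2 + g2 b) - f1 * f2)%C
      with (f1 * g2 b + g1 (b + d)%Z * f2 + g1 (b + d)%Z * g2 b)%C by ring.
    eapply Rle_trans; [apply Cmod_triangle|].
    eapply Rle_trans; [apply Rplus_le_compat_r, Cmod_triangle|].
    rewrite !Cmod_mult.
    specialize (Hg2 b Hb); specialize (Hg1 _ Hbd).
    pose proof (qh_beta_le q _ Hq Hbd) as Hb'; fold Q in Hb'.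
    assert (T1 : Cmod f1 * Cmod (g2 b) <= Cmod f1 * K2 * qh q b)
      by (rewrite Rmult_assoc; now apply Rmult_le_compat_l).
    assert (T2 : Cmod (g1 (b + d)%Z) * Cmod f2 <= K1 * qh q d * Cmod f2 * qh q b).
    { replace (K1 * qh q d * Cmod f2 * qh q b) with (K1 * qh q (b + d) * Cmod f2)
        by (rewrite qh_add; ring).
      now apply Rmult_le_compat_r. }
    assert (T3 : Cmod (g1 (b + d)%Z) * Cmod (g2 b) <= K1 * Q * K2 * qh q b).
    { replace (K1 * Q * K2 * qh q b) with ((K1 * Q) * (K2 * qh q b)) by ring.
      apply Rmult_le_compat; try apply Cmod_ge_0; [|exact Hg2].
      eapply Rle_trans; [exact Hg1|]; now apply Rmult_le_compat_l. }
    unfold Kg.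
    assert (0 <= Cmod f1 * Cmod f2 * qh q (d + 1) * qh q b) by (repeat apply Rmult_le_pos; lra).
    lra.
  + rewrite Cmod_opp, Cmod_mult.
    assert (H1 : 1 <= qh q (d + 1) * qh q b).
    { rewrite <- qh_add, <- (qh_0 q) by lra; apply qh_decr; [exact Hq|lia]. }
    assert (H2 : 0 <= Cmod f1 * Cmod f2) by (now apply Rmult_le_pos).
    assert (0 <= (Cmod f1 * K2 + K1 * qh q d * Cmod f2 + K1 * Q * K2) * qh q b).
    { apply Rmult_le_pos; [|lra]; repeat apply Rplus_le_le_0_compat; repeat apply Rmult_le_pos; lra. }
    unfold Kg; nra.
- intros k Hk; pose proof (weight_pos q k) as Wp.
  enough (Cmod ((if admissible (move w k) then (c1 (move w k) * c2 k)%C else 0%C) - f1 * f2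
    - (if (-1 <=? beta k + d)%Z
       then (f1 + g1 (beta k + d)%Z) * (f2 + g2 (beta k)) - f1 * f2 else - (f1 * f2)))%C
    <= Ke * weight q k) by nra.
  assert (Eb : beta (move w k) = (beta k + d)%Z) by apply beta_move.
  assert (Hbk : (-1 <= beta k)%Z) by (apply admissible_bounds, Hk).
  destruct (admissible (move w k)) eqn:E.
  + destruct (Hsplit k Hk E) as [A1 A2].
    assert (Hbd : (-1 <= beta k + d)%Z) by (rewrite <- Eb; now apply admissible_bounds).
    rewrite (proj2 (Z.leb_le _ _) Hbd).
    replace (c1 (move w k) * c2 k - f1 * f2
             - ((f1 + g1 (beta k + d)%Z) * (f2 + g2 (beta k)) - f1 * f2))%C
      with ((c1 (move w k) - f1 - g1 (beta k + d)%Z) * c2 k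
            + (f1 + g1 (beta k + d)%Z) * (c2 k - f2 - g2 (beta k)))%C by ring.
    eapply Rle_trans; [apply Cmod_triangle|]; rewrite !Cmod_mult.
    specialize (He1 _ A1); rewrite Eb in He1; specialize (He2 _ A2).
    specialize (Hc2 _ A2); specialize (Hh1 _ Hbd).
    assert (T1 : Cmod (c1 (move w k) - f1 - g1 (beta k + d)%Z)%C * Cmod (c2 k)
                 <= K1 * Kw * weight q k * B2).
    { apply Rmult_le_compat; try apply Cmod_ge_0; [|exact Hc2].
      eapply Rle_trans; [exact He1|]; specialize (Hw k).
      rewrite Rmult_assoc; now apply Rmult_le_compat_l. }
    assert (T2 : Cmod (f1 + g1 (beta k + d)%Z)%C * Cmod (c2 k - f2 - g2 (beta k))%C
                 <= B1 * (K2 * weight q k)) by (apply Rmult_le_compat; try apply Cmod_ge_0; assumption).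
    unfold Ke; nra.
  + destruct (Z.leb_spec (-1) (beta k + d)) as [Hbd|Hbd].
    * replace (0 - f1 * f2 - ((f1 + g1 (beta k + d)%Z) * (f2 + g2 (beta k)) - f1 * f2))%C
        with (- ((f1 + g1 (beta k + d)%Z) * (f2 + g2 (beta k))))%C by ring.
      rewrite Cmod_opp, Cmod_mult.
      specialize (Hh1 _ Hbd).
      destruct (main_inadmissible w k Hm2 (proj1 Hk) E) as [N|[N|N]]; [| |lia].
      (* Too small a [j]: here [q^j] is bounded below, so the bounded defect is a multiple of the
         weight. *)
      -- specialize (Hh2 _ Hbk).
         assert (T : 1 <= qh q (2 * sh_j w - 1) * weight q k).
         { apply Rle_trans with (qh q (2 * sh_j w - 1) * qh q (lab_j k)).
           - rewrite <- qh_add, <- (qh_0 q) by lra; apply qh_decr; [exact Hq|lia].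
           - apply Rmult_le_compat_l; [lra|]; unfold weight.
             pose proof (qh_pos q (alpha k)); pose proof (qh_pos q (beta k)); nra. }
         assert (Cmod (f1 + g1 (beta k + d)%Z)%C * Cmod (f2 + g2 (beta k))%C <= B1 * B2)
           by (apply Rmult_le_compat; try apply Cmod_ge_0; assumption).
         assert (B1 * B2 <= B1 * B2 * (qh q (2 * sh_j w - 1) * weight q k)) by nra.
         unfold Ke; nra.
      (* Below the range of [m1]: a shift with [sh_j w = 0] would leave [alpha] unchanged, so
         [f2 = 0]. The defect then carries [g2 (beta k)], and as [q^(j + m1)] is bounded below it
         fits the second summand of the weight. *)
      -- assert (Hf2 : f2 = 0%C).
         { destruct Hj2 as [Hj2|Hj2]; [exact Hj2|].
           pose proof (admissible_bounds k (proj1 Hk)); lia. }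
         rewrite Hf2, Cplus_0_l.
         specialize (Hg2 _ Hbk).
         assert (T : qh q (beta k) <= qh q (4 * sh_j w) * weight q k).
         { apply Rle_trans with (qh q (4 * sh_j w) * (qh q (alpha k) * qh q (beta k))).
           - rewrite <- !qh_add; apply qh_decr; [exact Hq|lia].
           - apply Rmult_le_compat_l; [lra|]; unfold weight.
             pose proof (qh_pos q (lab_j k)); lra. }
         assert (Cmod (f1 + g1 (beta k + d)%Z)%C * Cmod (g2 (beta k)) <= B1 * (K2 * qh q (beta k)))
           by (apply Rmult_le_compat; try apply Cmod_ge_0; assumption).
         assert (B1 * (K2 * qh q (beta k)) <= B1 * K2 * (qh q (4 * sh_j w) * weight q k)) by nra.
         unfold Ke; nra.
    * replace (0 - f1 * f2 - - (f1 * f2))%C with (RtoC 0) by ring; rewrite Cmod_0; nra.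
- left; destruct Hm1, Hm2; split; cbn; lia.
- destruct Hj1 as [->|Hj1]; [left; ring|destruct Hj2 as [->|Hj2]; [left; ring|]].
  right; cbn; lia.
Qed.

(** Equality of the two chiral representations up to [O(q^(2l))]: this is what makes
    commutators with the Dirac operator bounded. *)
Definition chirally_symmetric (q : R) (t : term) : Prop :=
  sh_flip (t_shift t) = false /\
  exists K, 0 <= K /\ forall k, adm2 (t_shift t) k ->
    Cmod (t_coef t k - t_coef t (flip k))%C <= K * qh q (2 * lab_l k).

Lemma adm2_flip (v : displacement) (k : label) : adm2 v k -> adm2 v (flip k).
Proof. intros [H1 H2]; split; [|rewrite move_flip]; now rewrite admissible_flip. Qed.

Lemma good_coef_bounded (q : R) (t : term) : 0 < q < 1 -> good q t ->
  exists B, 0 <= B /\ forall k, adm2 (t_shift t) k -> Cmod (t_coef t k) <= B.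
Proof.
intros Hq (g & K & G); destruct (good_bounded _ _ _ _ _ _ Hq G) as (B & HB & _ & H).
now exists B.
Qed.

(** The usual splitting of a difference of products, with boundedness taken from [good]; a ket and
    its flip are admissible together, so the guard of [term_mul] is chirally symmetric. *)
Lemma chirally_symmetric_mul (q : R) (t s : term) : 0 < q < 1 -> good q t -> good q s ->
  chirally_symmetric q t -> chirally_symmetric q s -> chirally_symmetric q (term_mul t s).
Proof.
intros Hq G1 G2 (F1 & K1 & HK1 & H1) (F2 & K2 & HK2 & H2).
destruct (good_coef_bounded _ _ Hq G1) as (B1 & HB1 & Hb1).
destruct (good_coef_bounded _ _ Hq G2) as (B2 & HB2 & Hb2).
unfold term_mul; split; cbn [t_shift t_coef]; [cbn; now rewrite F1, F2|].
set (w := t_shift s) in *; set (e := qh q (2 * (2 * sh_l w))).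
assert (He : 0 < e) by apply qh_pos.
assert (HA : 0 <= K1 * e * B2) by (repeat apply Rmult_le_pos; lra).
assert (HB : 0 <= B1 * K2) by (apply Rmult_le_pos; lra).
exists (K1 * e * B2 + B1 * K2); split; [lra|].
intros k [A1 A2]; rewrite move_flip, admissible_flip.
assert (Hp := qh_pos q (2 * lab_l k)).
destruct (admissible (move w k)) eqn:E.
- rewrite move_add in A2.
  assert (C1 : adm2 (t_shift t) (move w k)) by now split.
  assert (C2 : adm2 w k) by now split.
  replace (t_coef t (move w k) * t_coef s k - t_coef t (flip (move w k)) * t_coef s (flip k))%C
    with ((t_coef t (move w k) - t_coef t (flip (move w k))) * t_coef s k
          + t_coef t (flip (move w k)) * (t_coef s k - t_coef s (flip k)))%C by ring.
  eapply Rle_trans; [apply Cmod_triangle|]; rewrite !Cmod_mult.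
  assert (T1 : Cmod (t_coef t (move w k) - t_coef t (flip (move w k)))%C * Cmod (t_coef s k)
               <= K1 * (qh q (2 * lab_l k) * e) * B2).
  { apply Rmult_le_compat; try apply Cmod_ge_0; [|now apply Hb2].
    unfold e; rewrite <- qh_add.
    replace (2 * lab_l k + 2 * (2 * sh_l w))%Z with (2 * lab_l (move w k))%Z
      by (unfold move; cbn [lab_l]; lia).
    now apply H1. }
  assert (T2 : Cmod (t_coef t (flip (move w k))) * Cmod (t_coef s k - t_coef s (flip k))%C
               <= B1 * (K2 * qh q (2 * lab_l k))).
  { apply Rmult_le_compat; try apply Cmod_ge_0; [now apply Hb1, adm2_flip|now apply H2]. }
  lra.
- replace (0 - 0)%C with (RtoC 0) by ring; rewrite Cmod_0; apply Rmult_le_pos; lra.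
Qed.

Lemma chirally_symmetric_adj (q : R) (t : term) :
  chirally_symmetric q t -> chirally_symmetric q (term_adj t).
Proof.
intros (F & K & HK & H); unfold term_adj; split; cbn [t_shift t_coef]; [exact F|].
set (v := t_shift t) in *; set (e := qh q (2 * (2 * - sh_l v))).
assert (He : 0 < e) by apply qh_pos.
exists (K * e); split; [apply Rmult_le_pos; lra|].
intros k [A1 A2]; rewrite move_flip, <- Cminus_conj, Cmod_conj.
assert (C1 : adm2 v (move (sh_opp v) k)) by (split; [exact A2|now rewrite move_opp_r]).
specialize (H _ C1).
replace (lab_l (move (sh_opp v) k)) with (lab_l k + 2 * - sh_l v)%Z in H by reflexivity.
rewrite Z.mul_add_distr_l, qh_add in H; fold e in H; lra.
Qed.

Lemma Rpower_linear_bound (q x : R) : 0 < q < 1 -> x * Rpower q x <= / - ln q.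
Proof.
intros Hq; assert (Hl : ln q < 0) by (rewrite <- ln_1; apply ln_increasing; lra).
apply Rmult_le_reg_l with (- ln q); [lra|]; rewrite Rinv_r by lra.
unfold Rpower; replace (x * ln q) with (- (x * - ln q)) by ring; rewrite exp_Ropp.
assert (He := exp_pos (x * - ln q)).
apply Rmult_le_reg_r with (exp (x * - ln q)); [exact He|].
rewrite Rmult_1_l, !Rmult_assoc, Rinv_l, Rmult_1_r by lra.
pose proof (exp_ineq1_le (x * - ln q)); lra.
Qed.

(** The chiral discrepancy is split as [q^(2l) = q^l * q^l]: one factor compensates the eigenvalue
    [l + 3/2], the other is at most [q^j] and hence below the weight. *)
Lemma good_dirac (q : R) (t : term) : 0 < q < 1 ->
  good q t -> chirally_symmetric q t -> good q (term_dirac t).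
Proof.
intros Hq (g & K & HK & Hg & Hc & Hm & Hj) (_ & K' & HK' & Hs).
set (v := t_shift t) in *; set (d := RtoC (IZR (sh_l v))).
set (B := / - ln q + 3 / 2).
assert (HB : 0 < B).
{ assert (ln q < 0) by (rewrite <- ln_1; apply ln_increasing; lra).
  assert (0 < / - ln q) by (apply Rinv_0_lt_compat; lra); unfold B; lra. }
assert (Hd := Cmod_ge_0 d).
assert (H1 : 0 <= Cmod d * K) by (apply Rmult_le_pos; lra).
assert (H2 : 0 <= B * K') by (apply Rmult_le_pos; lra).
unfold term_dirac, good; cbn [t_shift t_coef t_symbol]; fold v d.
exists (fun b => d * g b)%C, (Cmod d * K + B * K').
repeat split.
- lra.
- intros b Hb; rewrite Cmod_mult.
  apply Rle_trans with (Cmod d * (K * qh q b)); [apply Rmult_le_compat_l; auto|].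
  pose proof (qh_pos q b); nra.
- intros k [A1 A2]; rewrite move_toggle, admissible_flip in A2.
  assert (A : adm2 v k) by now split.
  replace (d * t_coef t k + eigenvalue k * (t_coef t k - t_coef t (flip k))
           - d * t_symbol t - d * g (beta k))%C
    with (d * (t_coef t k - t_symbol t - g (beta k))
          + eigenvalue k * (t_coef t k - t_coef t (flip k)))%C by ring.
  eapply Rle_trans; [apply Cmod_triangle|]; rewrite !Cmod_mult, Cmod_R.
  assert (Hb := admissible_bounds k A1); destruct Hb as (Hb & _).
  assert (Hl : 1 <= IZR (lab_l k)) by (apply IZR_le; lia).
  assert (Hev : 0 <= eigenvalue k) by (unfold eigenvalue, half; lra).
  rewrite Rabs_pos_eq by exact Hev.
  assert (T1 : Cmod d * Cmod (t_coef t k - t_symbol t - g (beta k))%C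
               <= Cmod d * (K * weight q k)) by (apply Rmult_le_compat_l; auto).
  assert (T2 : eigenvalue k * qh q (lab_l k) <= B).
  { unfold eigenvalue, qh, B; rewrite Rmult_plus_distr_r.
    pose proof (Rpower_linear_bound q (half (lab_l k)) Hq).
    assert (Rpower q (half (lab_l k)) <= 1) by (apply Rpower_le_1; [exact Hq|unfold half; lra]).
    lra. }
  assert (T3 : qh q (lab_l k) <= weight q k).
  { apply Rle_trans with (qh q (lab_j k)); [apply qh_decr; [exact Hq|lia]|].
    unfold weight; pose proof (qh_pos q (alpha k)); pose proof (qh_pos q (beta k)); nra. }
  assert (T4 : eigenvalue k * Cmod (t_coef t k - t_coef t (flip k))%C <= B * K' * weight q k).
  { apply Rle_trans with (eigenvalue k * (K' * qh q (2 * lab_l k))).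
    - apply Rmult_le_compat_l; auto.
    - replace (2 * lab_l k)%Z with (lab_l k + lab_l k)%Z by lia; rewrite qh_add.
      replace (eigenvalue k * (K' * (qh q (lab_l k) * qh q (lab_l k))))
        with ((K' * (eigenvalue k * qh q (lab_l k))) * qh q (lab_l k)) by ring.
      assert (Hp := qh_pos q (lab_l k)).
      apply Rmult_le_compat; try lra.
      + repeat apply Rmult_le_pos; lra.
      + rewrite Rmult_comm; now apply Rmult_le_compat_r. }
  lra.
- destruct Hm as [Hm|[H3 H4]]; [left; exact Hm|right; split; [rewrite H3; ring|]].
  intros b; rewrite H4; ring.
- destruct Hj as [->|Hj]; [left; ring|right; exact Hj].
Qed.

(** * Symbols of algebra elements as trigonometric polynomials *)

Definition cis (x : R) : C := (cos x, sin x).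

Lemma cis_plus (x y : R) : cis (x + y) = (cis x * cis y)%C.
Proof. unfold cis; rewrite cos_plus, sin_plus; unfold Cmult; simpl; f_equal; ring. Qed.

Lemma cis_conj (x : R) : cis (- x) = Cconj (cis x).
Proof. unfold cis; rewrite cos_neg, sin_antisym; reflexivity. Qed.

Lemma cis_0 : cis 0 = 1%C.
Proof. unfold cis; now rewrite cos_0, sin_0. Qed.

(** The basic shift of [x2] stands for the unitary [u], and [sh_l] counts how often it occurs. *)
Definition symbol_sum (L : list term) (theta : R) : C :=
  fold_right (fun t z => t_symbol t * cis (IZR (sh_l (t_shift t)) * theta) + z)%C 0%C L.

Lemma symbol_sum_app (L L' : list term) (theta : R) :
  symbol_sum (L ++ L') theta = (symbol_sum L theta + symbol_sum L' theta)%C.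
Proof. induction L as [|t L IH]; simpl; [ring|rewrite IH; ring]. Qed.

Lemma symbol_sum_mul (L L' : list term) (theta : R) :
  symbol_sum (terms_mul L L') theta = (symbol_sum L theta * symbol_sum L' theta)%C.
Proof.
induction L' as [|s L' IH]; simpl; [ring|].
rewrite symbol_sum_app, IH; clear IH.
induction L as [|t L IH]; simpl; [ring|].
assert (E : symbol_sum (map (fun t => term_mul t s) L) theta
            = (symbol_sum L theta * (t_symbol s * cis (IZR (sh_l (t_shift s)) * theta)))%C).
{ clear IH; induction L as [|t' L IH]; simpl; [ring|].
  rewrite IH, plus_IZR, Rmult_plus_distr_r, cis_plus; ring. }
rewrite E, plus_IZR, Rmult_plus_distr_r, cis_plus; ring.
Qed.

Lemma symbol_sum_adj (L : list term) (theta : R) :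
  symbol_sum (map term_adj L) theta = Cconj (symbol_sum L theta).
Proof.
induction L as [|t L IH]; simpl; [symmetry; apply Cconj_0|].
rewrite IH, Cplus_conj, Cmult_conj, opp_IZR, Ropp_mult_distr_l_reverse, cis_conj; reflexivity.
Qed.

Definition algebra_terms (q : R) (pi : star_poly -> op) (a : star_poly) (L : list term) : Prop :=
  represents (pi a) L /\ (forall t, In t L -> good q t /\ chirally_symmetric q t) /\
  (forall theta, classical_points a theta = symbol_sum L theta).

Definition zero_displacement : displacement := Displacement false 0 0 0 0.

Lemma move_zero (k : label) : move zero_displacement k = k.
Proof.
destruct k as [s l m1 m2 j]; unfold move, zero_displacement.
cbn [sh_flip sh_l sh_m1 sh_m2 sh_j chirality lab_l lab_m1 lab_m2 lab_j].
f_equal; try lia; now destruct s.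
Qed.

Lemma algebra_terms_scalar (q : R) (pi : star_poly -> op) (c : C) :
  spinor_representation q pi -> exists L, algebra_terms q pi (Scalar c) L.
Proof.
intros Hpi; exists (Term zero_displacement (fun _ => c) c :: nil); split; [|split].
- intros k Hk; rewrite (rep_scalar q pi Hpi) by apply inH_ket; simpl; rewrite move_zero.
  apply functional_extensionality; intros k'; unfold vadd; ring.
- intros t [<-|[]]; split.
  + exists (fun _ => 0%C), 0; split; [lra|]; cbn [t_shift t_coef t_symbol]; repeat split.
    * intros; rewrite Cmod_0; lra.
    * intros k _; replace (c - c - 0)%C with (RtoC 0) by ring; rewrite Cmod_0; lra.
    * left; split; reflexivity.
    * now right.
  + split; [reflexivity|exists 0; split; [lra|]]; cbn [t_shift t_coef]; intros k _.
    replace (c - c)%C with (RtoC 0) by ring; rewrite Cmod_0; lra.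
- intros theta; simpl; rewrite Rmult_0_l, cis_0; ring.
Qed.

(** The induction follows the expression rather than its class modulo the relations: every
    constructor has its counterpart on lists of terms, so estimates are required only for the
    generators. *)
Lemma algebra_terms_exist (q : R) (pi : star_poly -> op) : 0 < q < 1 ->
  spinor_representation q pi ->
  (forall x, exists L, algebra_terms q pi (Gen x) L) ->
  forall a, exists L, algebra_terms q pi a L.
Proof.
intros Hq Hpi Hgen a; induction a as [x|c|a [L IH] b [L' IH']|a [L IH] b [L' IH']|a [L IH]].
- apply Hgen.
- now apply algebra_terms_scalar.
- destruct IH as (H1 & H2 & H3), IH' as (H1' & H2' & H3').
  exists (L ++ L'); split; [|split].
  + apply represents_ext with (fun f => vadd (pi a f) (pi b f)).
    * intros f Hf; symmetry; now apply (rep_add q pi Hpi).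
    * now apply represents_add.
  + intros t Ht; apply in_app_or in Ht; destruct Ht; auto.
  + intros theta; simpl; now rewrite symbol_sum_app, H3, H3'.
- destruct IH as (H1 & H2 & H3), IH' as (H1' & H2' & H3').
  exists (terms_mul L L'); split; [|split].
  + apply represents_ext with (op_comp (pi a) (pi b)).
    * intros f Hf; symmetry; now apply (rep_mul q pi Hpi).
    * apply represents_comp; try assumption; apply bounded_lin_op, (rep_bounded q pi Hpi).
  + intros t Ht; apply in_flat_map in Ht; destruct Ht as (s & Hs & Ht).
    apply in_map_iff in Ht; destruct Ht as (t' & <- & Ht').
    destruct (H2 _ Ht'), (H2' _ Hs).
    split; [now apply good_mul|now apply chirally_symmetric_mul].
  + intros theta; simpl; now rewrite symbol_sum_mul, H3, H3'.
- destruct IH as (H1 & H2 & H3).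
  exists (map term_adj L); split; [|split].
  + apply represents_adj with (pi a); [apply bounded_lin_op, (rep_bounded q pi Hpi)| |exact H1].
    apply (rep_star q pi Hpi).
  + intros t Ht; apply in_map_iff in Ht; destruct Ht as (t' & <- & Ht').
    destruct (H2 _ Ht'); split; [now apply good_adj|now apply chirally_symmetric_adj].
  + intros theta; simpl; now rewrite symbol_sum_adj, H3.
Qed.

(** * Sums over eigenspaces, and expansion of the elements of Psi^0 *)

Lemma level_sum_le (F G : label -> R) (n : nat) :
  (forall k, admissible k = true -> F k <= G k) -> level_sum F n <= level_sum G n.
Proof.
intros H; unfold level_sum; rewrite !sum_n_Reals; apply sum_Rle; intros p Hp.
rewrite !sum_n_Reals; apply sum_Rle; intros a Ha.
rewrite !sum_n_Reals; apply sum_Rle; intros b Hb.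
apply Rplus_le_compat; apply H; now apply label_at_admissible.
Qed.

Lemma level_sum_plus {G : AbelianMonoid} (E F : label -> G) (n : nat) :
  level_sum (fun k => plus (E k) (F k)) n = plus (level_sum E n) (level_sum F n).
Proof.
unfold level_sum; rewrite <- sum_n_plus; apply sum_n_ext; intros p.
rewrite <- sum_n_plus; apply sum_n_ext; intros a.
rewrite <- sum_n_plus; apply sum_n_ext; intros b.
rewrite <- !plus_assoc; f_equal; rewrite !plus_assoc; f_equal; apply plus_comm.
Qed.

Lemma level_sum_scal (c : R) (F : label -> R) (n : nat) :
  level_sum (fun k => c * F k) n = c * level_sum F n.
Proof.
unfold level_sum; rewrite <- (sum_n_mult_l (K := R_Ring) c); apply sum_n_ext; intros p.
rewrite <- (sum_n_mult_l (K := R_Ring) c); apply sum_n_ext; intros a.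
rewrite <- (sum_n_mult_l (K := R_Ring) c); apply sum_n_ext; intros b.
unfold mult, plus; simpl; ring.
Qed.

Lemma level_sum_ge_0 (F : label -> R) (n : nat) :
  (forall k, admissible k = true -> 0 <= F k) -> 0 <= level_sum F n.
Proof.
intros H; apply Rle_trans with (level_sum (fun _ => 0) n); [|now apply level_sum_le].
apply Req_le; symmetry; now apply (level_sum_zero (G := R_AbelianMonoid)).
Qed.

Lemma inH_vadd (f g : vec) : inH f -> inH g -> inH (vadd f g).
Proof.
intros [F1 F2] [G1 G2]; split.
- intros k Hk; unfold vadd; rewrite F1, G1 by exact Hk; ring.
- apply ex_series_le_R with (level_sum (fun k => 2 * (Cmod (f k) ^ 2 + Cmod (g k) ^ 2))).
  + intros n; split; [apply level_sum_ge_0; intros; apply pow2_ge_0|].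
    apply level_sum_le; intros k _; unfold vadd.
    pose proof (Cmod_triangle (f k) (g k)); pose proof (Cmod_ge_0 (f k + g k)%C).
    pose proof (pow2_ge_0 (Cmod (f k) - Cmod (g k))); nra.
  + apply ex_series_ext with (fun n => 2 * (level_sum (fun k => Cmod (f k) ^ 2) n
                                            + level_sum (fun k => Cmod (g k) ^ 2) n)).
    * intros n; rewrite level_sum_scal; f_equal; symmetry.
      exact (level_sum_plus (G := R_AbelianMonoid) (fun k => Cmod (f k) ^ 2)
               (fun k => Cmod (g k) ^ 2) n).
    * apply (ex_series_scal (V := R_NormedModule)), (ex_series_plus (V := R_NormedModule));
        assumption.
Qed.

Lemma inH_vscal (c : C) (f : vec) : inH f -> inH (vscal c f).
Proof.
intros [F1 F2]; split.
- intros k Hk; unfold vscal; rewrite F1 by exact Hk; ring.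
- eapply ex_series_ext with (fun n => Cmod c ^ 2 * level_sum (fun k => Cmod (f k) ^ 2) n).
  + intros n; rewrite <- level_sum_scal; unfold level_sum; apply sum_n_ext; intros p.
    apply sum_n_ext; intros a; apply sum_n_ext; intros b; unfold vscal.
    rewrite !Cmod_mult, !Rpow_mult_distr; reflexivity.
  + apply (ex_series_scal (V := R_NormedModule)); assumption.
Qed.

Definition good_terms (q : R) (T : op) (L : list term) : Prop :=
  represents T L /\ forall t, In t L -> good q t.

Lemma good_terms_delta_iter (q : R) (T : op) (n : nat) :
  (exists L, good_terms q T L) -> forall S, delta_iter n T S -> exists L, good_terms q S L.
Proof.
intros (L0 & H0 & G0); induction n as [|n IH]; intros S H.
- destruct H as (_ & _ & E); exists L0; split; [|exact G0].
  now apply represents_ext with T.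
- destruct H as (T' & HT' & HS); destruct (IH T' HT') as (L & HL & GL).
  exists (map term_delta L); split; [now apply represents_delta with T'|].
  intros t Ht; apply in_map_iff in Ht; destruct Ht as (t' & <- & Ht'); apply good_scal; auto.
Qed.

Lemma delta_iter_bounded (T S : op) (n : nat) : delta_iter n T S -> bounded_op S.
Proof. destruct n; simpl; [tauto|]; intros (T' & _ & _ & H & _); exact H. Qed.

(** Linearity on [inH] is proved simultaneously, since a left factor must distribute over the finite
    combinations produced by the right one. Commutators with [Dirac] are taken of algebra elements
    only, so chiral symmetry is asked for there alone. *)
Lemma Psi0_good_terms (q : R) (pi : star_poly -> op) : 0 < q < 1 ->
  (forall a, exists L, algebra_terms q pi a L) ->
  forall T, Psi0 pi T -> lin_op T /\ exists L, good_terms q T L.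
Proof.
intros Hq Halg T H; induction H as [n T S HT HS|T S _ IH _ IH'|c T _ IH|T S _ IH _ IH'].
- split; [now apply bounded_lin_op, (delta_iter_bounded T S n)|].
  refine (good_terms_delta_iter q T n _ S HS).
  destruct HT as (a & HT); destruct (Halg a) as (L & H1 & H2 & _).
  destruct HT as [E|HT].
  + exists L; split; [|intros t Ht; now apply H2].
    apply represents_ext with (pi a); [|exact H1]; intros f Hf; symmetry; now apply E.
  + exists (map term_dirac L); split; [now apply represents_dirac with (pi a)|].
    intros t Ht; apply in_map_iff in Ht; destruct Ht as (t' & <- & Ht').
    destruct (H2 _ Ht'); now apply good_dirac.
- destruct IH as ((A1 & A2 & A3) & L & H & G), IH' as ((B1 & B2 & B3) & L' & H' & G').
  split.
  + assert (Hadd : forall f g, inH f -> inH g -> inH (vadd f g)) by (intros; now apply inH_vadd).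
    split; [|split].
    * intros f Hf; auto.
    * intros f g Hf Hg; rewrite A2, B2 by assumption.
      apply functional_extensionality; intros k; unfold vadd; ring.
    * intros c f Hf; rewrite A3, B3 by assumption.
      apply functional_extensionality; intros k; unfold vadd, vscal; ring.
  + exists (L ++ L'); split; [now apply represents_add|].
    intros t Ht; apply in_app_or in Ht; destruct Ht; auto.
- destruct IH as ((A1 & A2 & A3) & L & H & G); split.
  + split; [|split].
    * intros f Hf; apply inH_vscal; auto.
    * intros f g Hf Hg; rewrite A2 by assumption.
      apply functional_extensionality; intros k; unfold vadd, vscal; ring.
    * intros d f Hf; rewrite A3 by assumption.
      apply functional_extensionality; intros k; unfold vscal; ring.
  + exists (map (term_scal c) L); split; [now apply represents_scal|].
    intros t Ht; apply in_map_iff in Ht; destruct Ht as (t' & <- & Ht'); apply good_scal; auto.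
- destruct IH as (HT & L & H & G), IH' as (HS & L' & H' & G').
  assert (HT' := HT); assert (HS' := HS).
  destruct HT' as (A1 & A2 & A3), HS' as (B1 & B2 & B3); split.
  + unfold op_comp; split; [|split].
    * intros f Hf; auto.
    * intros f g Hf Hg; rewrite B2, A2 by auto; reflexivity.
    * intros c f Hf; rewrite B3, A3 by auto; reflexivity.
  + exists (terms_mul L L'); split; [now apply represents_comp|].
    intros t Ht; apply in_flat_map in Ht; destruct Ht as (s & Hs & Ht).
    apply in_map_iff in Ht; destruct Ht as (t' & <- & Ht'); apply good_mul; auto.
Qed.

(** * Estimates of the coefficients of the representation *)

(** One constant above 2, [/ q] and the prefactor of a q-number, so that a sum, a unit loss in an
    exponent, and a q-number or its inverse each cost one power. The exponent [-6] allows arguments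
    of q-numbers down to [-3]. *)
Definition qconst (q : R) : R := 2 + / q + / (/ q - q) * (1 + Rpower q (-6)).

Lemma inv_minus_pos (q : R) : 0 < q < 1 -> 0 < / q - q.
Proof.
intros Hq; assert (1 < / q) by (rewrite <- Rinv_1; apply Rinv_lt_contravar; lra); lra.
Qed.

Lemma qconst_ge (q : R) : 0 < q < 1 -> 2 <= qconst q /\ / q <= qconst q /\
  / (/ q - q) * (1 + Rpower q (-6)) <= qconst q.
Proof.
intros Hq; unfold qconst.
assert (0 < / q) by (apply Rinv_0_lt_compat; lra).
assert (0 < / (/ q - q)) by (apply Rinv_0_lt_compat, inv_minus_pos, Hq).
pose proof (Rpower_pos q (-6)).
assert (0 < / (/ q - q) * (1 + Rpower q (-6))) by (apply Rmult_lt_0_compat; lra).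
lra.
Qed.

Lemma qnum_eq (q z : R) : 0 < q < 1 ->
  qnum q z = / (/ q - q) * (Rpower q (- z) * (1 - Rpower q (2 * z))).
Proof.
intros Hq; pose proof (inv_minus_pos q Hq) as H; unfold qnum.
assert (E : Rpower q z = Rpower q (- z) * Rpower q (2 * z)).
{ rewrite <- Rpower_plus; f_equal; ring. }
rewrite E; replace (q - / q) with (- (/ q - q)) by ring; field; split; [lra|].
apply Rgt_not_eq; nra.
Qed.

(** [ebd q n e x]: the size of [x] is at most [q^e], up to the [n]th power of a constant. *)
Definition ebd (q : R) (n : nat) (e x : R) : Prop := Rabs x <= qconst q ^ n * Rpower q e.

Lemma qconst_pow_pos (q : R) (n : nat) : 0 < q < 1 -> 1 <= qconst q ^ n.
Proof. intros Hq; apply pow_R1_Rle; destruct (qconst_ge q Hq); lra. Qed.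

Lemma Rpower_opp_nat_le (q : R) (m : nat) : 0 < q < 1 -> Rpower q (- INR m) <= qconst q ^ m.
Proof.
intros Hq; rewrite Rpower_Ropp, Rpower_pow by lra.
rewrite <- pow_inv; apply pow_incr; split.
- apply Rlt_le, Rinv_0_lt_compat; lra.
- apply (qconst_ge q Hq).
Qed.


(** A loss of [m] in the exponent is bought with [m] powers of [qconst], because [/ q <= qconst q].
    Additive constants in the exponents can thus be forgotten. *)
Lemma ebd_weaken (q : R) (n m n' : nat) (e e' x : R) : 0 < q < 1 ->
  ebd q n e x -> (n + m <= n')%nat -> e' - INR m <= e -> ebd q n' e' x.
Proof.
intros Hq H Hn He; unfold ebd in *; eapply Rle_trans; [exact H|].
pose proof (qconst_pow_pos q n Hq) as Hk.
apply Rle_trans with (qconst q ^ n * (qconst q ^ m * Rpower q e')).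
- apply Rmult_le_compat_l; [lra|].
  apply Rle_trans with (Rpower q (- INR m) * Rpower q e').
  + rewrite <- Rpower_plus; apply Rpower_decr; [exact Hq|lra].
  + apply Rmult_le_compat_r; [apply Rlt_le, Rpower_pos|now apply Rpower_opp_nat_le].
- rewrite <- Rmult_assoc, <- pow_add; apply Rmult_le_compat_r; [apply Rlt_le, Rpower_pos|].
  apply Rle_pow; [destruct (qconst_ge q Hq); lra|exact Hn].
Qed.

Lemma ebd_mult (q : R) (n m : nat) (e f x y : R) : 0 < q < 1 ->
  ebd q n e x -> ebd q m f y -> ebd q (n + m) (e + f) (x * y).
Proof.
intros Hq Hx Hy; unfold ebd in *; rewrite Rabs_mult, pow_add, Rpower_plus.
replace (qconst q ^ n * qconst q ^ m * (Rpower q e * Rpower q f))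
  with ((qconst q ^ n * Rpower q e) * (qconst q ^ m * Rpower q f)) by ring.
apply Rmult_le_compat; try apply Rabs_pos; assumption.
Qed.

Lemma ebd_plus (q : R) (n : nat) (e x y : R) : 0 < q < 1 ->
  ebd q n e x -> ebd q n e y -> ebd q (S n) e (x + y).
Proof.
intros Hq Hx Hy; unfold ebd in *; simpl.
eapply Rle_trans; [apply Rabs_triang|].
assert (0 < qconst q ^ n * Rpower q e).
{ apply Rmult_lt_0_compat; [pose proof (qconst_pow_pos q n Hq); lra|apply Rpower_pos]. }
destruct (qconst_ge q Hq) as [H2 _]; nra.
Qed.

Lemma ebd_opp (q : R) (n : nat) (e x : R) : ebd q n e x -> ebd q n e (- x).
Proof. unfold ebd; now rewrite Rabs_Ropp. Qed.

Lemma ebd_Rpower (q e : R) : ebd q 0 e (Rpower q e).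
Proof. unfold ebd; simpl; rewrite Rabs_pos_eq by (apply Rlt_le, Rpower_pos); lra. Qed.

Lemma ebd_qnum (q z : R) : 0 < q < 1 -> -3 <= z -> ebd q 1 (- z) (qnum q z).
Proof.
intros Hq Hz; unfold ebd; rewrite pow_1, qnum_eq, !Rabs_mult by exact Hq.
pose proof (inv_minus_pos q Hq) as Hp; apply Rinv_0_lt_compat in Hp.
pose proof (Rpower_pos q (- z)) as Hz'.
rewrite (Rabs_pos_eq (/ _)), (Rabs_pos_eq (Rpower q (- z))) by lra.
destruct (qconst_ge q Hq) as (_ & _ & H).
assert (H1 : Rabs (1 - Rpower q (2 * z)) <= 1 + Rpower q (-6)).
{ eapply Rle_trans; [apply Rabs_triang|]; rewrite Rabs_Ropp, Rabs_R1.
  rewrite Rabs_pos_eq by (apply Rlt_le, Rpower_pos).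
  apply Rplus_le_compat_l, Rpower_decr; [exact Hq|lra]. }
apply Rle_trans with (/ (/ q - q) * (1 + Rpower q (-6)) * Rpower q (- z)).
- replace (/ (/ q - q) * (1 + Rpower q (-6)) * Rpower q (- z))
    with (/ (/ q - q) * (Rpower q (- z) * (1 + Rpower q (-6)))) by ring.
  apply Rmult_le_compat_l; [lra|]; apply Rmult_le_compat_l; lra.
- apply Rmult_le_compat_r; lra.
Qed.

Lemma qnum_ge (q z : R) : 0 < q < 1 -> 1 <= z -> Rpower q (1 - z) <= qnum q z.
Proof.
intros Hq Hz; rewrite qnum_eq by exact Hq.
pose proof (inv_minus_pos q Hq) as Hp.
assert (H1 : Rpower q (2 * z) <= q ^ 2).
{ rewrite <- Rpower_pow by lra; apply Rpower_decr; [exact Hq|simpl; lra]. }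
unfold Rminus at 1; rewrite Rpower_plus, Rpower_1 by lra.
pose proof (Rpower_pos q (- z)).
apply Rmult_le_reg_l with (/ q - q); [exact Hp|].
rewrite <- (Rmult_assoc (/ q - q) (/ (/ q - q))), Rinv_r, Rmult_1_l by lra.
replace ((/ q - q) * (q * Rpower q (- z))) with (Rpower q (- z) * (1 - q ^ 2)) by (field; lra).
apply Rmult_le_compat_l; lra.
Qed.

Lemma ebd_inv_qnum (q z : R) : 0 < q < 1 -> 1 <= z -> ebd q 1 z (/ qnum q z).
Proof.
intros Hq Hz; pose proof (qnum_ge q z Hq Hz) as H; unfold ebd; rewrite pow_1.
pose proof (Rpower_pos q (1 - z)) as H0.
rewrite Rabs_pos_eq by (apply Rlt_le, Rinv_0_lt_compat; lra).
apply Rle_trans with (/ Rpower q (1 - z)); [now apply Rinv_le_contravar|].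
rewrite <- Rpower_Ropp; replace (- (1 - z)) with (z + - (1)) by ring.
rewrite Rpower_plus, Rpower_Ropp, Rpower_1, Rmult_comm by lra.
apply Rmult_le_compat_r; [apply Rlt_le, Rpower_pos|apply (qconst_ge q Hq)].
Qed.

Lemma ebd_sqrt (q x y : R) : 0 < q < 1 -> -3 <= x -> -3 <= y ->
  ebd q 1 (- ((x + y) / 2)) (sqrt (qnum q x * qnum q y)).
Proof.
intros Hq Hx Hy; unfold ebd; rewrite Rabs_pos_eq by apply sqrt_pos.
pose proof (ebd_mult _ _ _ _ _ _ _ Hq (ebd_qnum q x Hq Hx) (ebd_qnum q y Hq Hy)) as H.
unfold ebd in H; simpl pow in *; rewrite Rmult_1_r in *.
assert (Hk : 0 < qconst q) by (destruct (qconst_ge q Hq); lra).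
pose proof (Rpower_pos q (- ((x + y) / 2))).
rewrite <- (sqrt_square (qconst q * Rpower q (- ((x + y) / 2)))) by nra.
apply sqrt_le_1_alt.
eapply Rle_trans; [apply Rle_abs|]; eapply Rle_trans; [exact H|].
replace (- x + - y) with (- ((x + y) / 2) + - ((x + y) / 2)) by field.
rewrite Rpower_plus; apply Req_le; ring.
Qed.

Lemma ebd_root (q x y z : R) : 0 < q < 1 -> -3 <= x -> -3 <= y -> 1 <= z ->
  ebd q 2 (- ((x + y) / 2) + z) (sqrt (qnum q x * qnum q y) / qnum q z).
Proof. intros; apply (ebd_mult q 1 1); [assumption|now apply ebd_sqrt|now apply ebd_inv_qnum]. Qed.

Lemma eps_cases (l j m2 : Z) : eps l j m2 = / 2 \/ eps l j m2 = - / 2.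
Proof. unfold eps; destruct (Z.even _); [left|right]; lra. Qed.

Definition half_admissible (l m1 m2 j : R) : Prop :=
  1 / 2 <= j <= l /\ - j <= m1 <= j /\ - (l + 1 / 2 - j) <= m2 <= l + 1 / 2 - j.

Lemma admissible_half (k : label) : admissible k = true ->
  half_admissible (half (lab_l k)) (half (lab_m1 k)) (half (lab_m2 k)) (half (lab_j k)).
Proof.
destruct k as [s l m1 m2 j]; intros H; apply admissible_coordinates in H.
destruct H as (n & p & a & b & H); cbn [lab_l lab_m1 lab_m2 lab_j].
unfold half_admissible, half.
assert (H1 : 1 <= IZR j <= IZR l) by (split; apply IZR_le; lia).
assert (H2 : - IZR j <= IZR m1 <= IZR j).
{ split; [rewrite <- opp_IZR|]; apply IZR_le; lia. }
assert (H3 : - (IZR l + 1 - IZR j) <= IZR m2 <= IZR l + 1 - IZR j).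
{ rewrite <- plus_IZR, <- minus_IZR; split; [rewrite <- opp_IZR|]; apply IZR_le; lia. }
lra.
Qed.

Ltac ebd_tac Hq :=
  repeat first
    [ apply ebd_opp | apply (ebd_root _ _ _ _ Hq) | apply ebd_Rpower
    | apply (ebd_qnum _ _ Hq) | apply (ebd_inv_qnum _ _ Hq)
    | apply (ebd_sqrt _ _ _ Hq) | eapply (ebd_mult _ _ _ _ _ _ _ Hq) ].

(** The exponent may be off by 10, and 30 powers of [qconst] cover both this loss and the factors of
    any single coefficient. *)
Ltac ebd_start Hq := eapply (ebd_weaken _ _ 10 30 _ _ _ Hq); [ebd_tac Hq| |].

Lemma ebd_A_p (q : R) (j m1 : Z) : 0 < q < 1 ->
  1 / 2 <= half j -> - half j <= half m1 <= half j -> ebd q 30 (half j + half m1) (A_p q j m1).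
Proof.
intros Hq Hj Hm; unfold A_p; cbv zeta; ebd_start Hq; simpl; try lia; lra.
Qed.

(** Real inequalities instead of admissibility, because the formulas also evaluate coefficients at
    partially shifted labels such as [(l + 1, j - 1, m2)]. *)
Definition okA (j m1 : Z) : Prop := 1 / 2 <= half j /\ - half j <= half m1 <= half j.

Definition okL (l j m2 : Z) : Prop := 1 / 2 <= half j <= half l /\
  - (half l + 1 / 2 - half j) <= half m2 <= half l + 1 / 2 - half j.

Lemma ebd_A_0 (q : R) (j m1 : Z) : 0 < q < 1 -> okA j m1 -> ebd q 30 (2 * half j) (A_0 q j m1).
Proof.
intros Hq [Hj Hm]; unfold A_0; cbv zeta; unfold Rdiv, Rminus at 1; rewrite Rinv_mult.
eapply (ebd_weaken _ _ 10 30 _ _ _ Hq).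
- eapply (ebd_mult _ _ _ _ _ _ _ Hq); [apply ebd_Rpower|].
  eapply (ebd_mult _ _ _ _ _ _ _ Hq); [|ebd_tac Hq; lra].
  eapply (ebd_plus _ 5 (- (2 * half j)) _ _ Hq).
  + eapply (ebd_weaken _ _ 3 5 _ _ _ Hq); [ebd_tac Hq| |]; simpl; try lia; lra.
  + eapply (ebd_weaken _ _ 3 5 _ _ _ Hq); [ebd_tac Hq| |]; simpl; try lia; lra.
- simpl; lia.
- simpl; lra.
Qed.

Lemma ebd_B_p (q : R) (j m1 : Z) : 0 < q < 1 -> okA j m1 -> ebd q 30 0 (B_p q j m1).
Proof.
intros Hq [Hj Hm]; unfold B_p; cbv zeta; ebd_start Hq; simpl; try lia; lra.
Qed.

Lemma ebd_B_0 (q : R) (j m1 : Z) : 0 < q < 1 -> okA j m1 ->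
  ebd q 30 (2 * half j) (B_0 q j m1).
Proof.
intros Hq [Hj Hm]; unfold B_0; cbv zeta; unfold Rdiv; rewrite Rinv_mult.
assert (H : ebd q 1 0 (1 + q ^ 2)).
{ unfold ebd; rewrite Rpower_O, pow_1, Rmult_1_r by lra.
  rewrite Rabs_pos_eq by nra; destruct (qconst_ge q Hq); nra. }
eapply (ebd_weaken _ _ 10 30 _ _ _ Hq).
- eapply (ebd_mult _ _ _ _ _ _ _ Hq); [eapply (ebd_mult _ _ _ _ _ _ _ Hq); [exact H|apply ebd_Rpower]|].
  ebd_tac Hq; lra.
- simpl; lia.
- simpl; lra.
Qed.

Lemma ebd_B_m (q : R) (j m1 : Z) : 0 < q < 1 -> okA j m1 ->
  ebd q 30 (2 * (half j + half m1)) (B_m q j m1).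
Proof.
intros Hq [Hj Hm]; unfold B_m; cbv zeta; ebd_start Hq; simpl; try lia; lra.
Qed.

Lemma ebd_C_p (q : R) (l j m2 : Z) : 0 < q < 1 -> okL l j m2 ->
  ebd q 30 (half l - half j + half m2) (C_p q l j m2).
Proof.
intros Hq [Hj Hm]; unfold C_p; cbv zeta.
destruct (eps_cases l j m2) as [-> | ->]; ebd_start Hq; simpl; try lia; lra.
Qed.

Lemma ebd_C_0 (q : R) (l j m2 : Z) : 0 < q < 1 -> okL l j m2 ->
  ebd q 30 (2 * half l) (C_0 q l j m2).
Proof.
intros Hq [Hj Hm]; unfold C_0; cbv zeta; unfold Rdiv; rewrite Rinv_mult.
destruct (eps_cases l j m2) as [-> | ->]; ebd_start Hq; simpl; try lia; lra.
Qed.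

Lemma ebd_C_m (q : R) (l j m2 : Z) : 0 < q < 1 -> okL l j m2 ->
  ebd q 30 (half l + half j + half m2) (C_m q l j m2).
Proof.
intros Hq [Hj Hm]; unfold C_m; cbv zeta.
destruct (eps_cases l j m2) as [-> | ->]; ebd_start Hq; simpl; try lia; lra.
Qed.

Lemma ebd_H_p (q : R) (l j m2 : Z) : 0 < q < 1 -> okL l j m2 -> ebd q 30 0 (H_p q l j m2).
Proof.
intros Hq [Hj Hm]; unfold H_p; cbv zeta.
destruct (eps_cases l j m2) as [-> | ->]; ebd_start Hq; simpl; try lia; lra.
Qed.

Lemma ebd_H_0 (q : R) (l j m2 : Z) : 0 < q < 1 -> okL l j m2 ->
  ebd q 30 (2 * half l - 2 * half j) (H_0 q l j m2).
Proof.
intros Hq [Hj Hm]; unfold H_0; cbv zeta; unfold Rdiv, Rminus at 1; rewrite Rinv_mult.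
eapply (ebd_weaken _ _ 10 30 _ _ _ Hq).
- eapply (ebd_mult _ _ _ _ _ _ _ Hq); [|ebd_tac Hq; lra].
  eapply (ebd_plus _ 15 (- (2 * half l) - 2 * half j) _ _ Hq);
  destruct (eps_cases l j m2) as [-> | ->];
    (eapply (ebd_weaken _ _ 10 15 _ _ _ Hq); [ebd_tac Hq| |]; simpl; try lia; lra).
- simpl; lia.
- simpl; lra.
Qed.

Lemma ebd_D_0 (q : R) (l j m2 : Z) : 0 < q < 1 -> okL l j m2 ->
  ebd q 30 (2 * half l) (D_0 q l j m2).
Proof.
intros Hq [Hj Hm]; unfold D_0; cbv zeta; unfold Rdiv; rewrite Rinv_mult.
destruct (eps_cases l j m2) as [-> | ->]; ebd_start Hq; simpl; try lia; lra.
Qed.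

Lemma ebd_D_m (q : R) (l j m2 : Z) : 0 < q < 1 -> okL l j m2 ->
  ebd q 30 (2 * half j) (D_m q l j m2).
Proof.
intros Hq [Hj Hm]; unfold D_m; cbv zeta.
destruct (eps_cases l j m2) as [-> | ->]; ebd_start Hq; simpl; try lia; lra.
Qed.

(** A square root of a product of [q]-numbers divided by a [q]-number, stripped of its power of
    [q]. *)
Definition root_ratio (q x y z : R) : R :=
  sqrt (1 - Rpower q (2 * x)) * sqrt (1 - Rpower q (2 * y)) / (1 - Rpower q (2 * z)).

Lemma root_eq (q x y z : R) : 0 < q < 1 -> 0 <= x -> 0 <= y -> 1 <= z ->
  sqrt (qnum q x * qnum q y) / qnum q z = Rpower q (z - (x + y) / 2) * root_ratio q x y z.
Proof.
intros Hq Hx Hy Hz; unfold root_ratio; rewrite !qnum_eq by exact Hq.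
assert (Hc : 0 < / (/ q - q)) by apply Rinv_0_lt_compat, inv_minus_pos, Hq.
set (c := / (/ q - q)) in *.
assert (Hu : 0 <= 1 - Rpower q (2 * x)) by (assert (Rpower q (2 * x) <= 1) by (apply Rpower_le_1; lra); lra).
assert (Hv : 0 <= 1 - Rpower q (2 * y)) by (assert (Rpower q (2 * y) <= 1) by (apply Rpower_le_1; lra); lra).
assert (Hw : 0 < 1 - Rpower q (2 * z)).
{ assert (Rpower q (2 * z) <= Rpower q 1) by (apply Rpower_decr; lra).
  rewrite Rpower_1 in H by lra; lra. }
pose proof (Rpower_pos q (- z)) as Hz0; pose proof (Rpower_pos q (- ((x + y) / 2))) as Hxy.
set (u := 1 - Rpower q (2 * x)) in *; set (v := 1 - Rpower q (2 * y)) in *.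
set (w := 1 - Rpower q (2 * z)) in *.
assert (E : c * (Rpower q (- x) * u) * (c * (Rpower q (- y) * v))
            = (c * Rpower q (- ((x + y) / 2))) ^ 2 * (u * v)).
{ replace (c * (Rpower q (- x) * u) * (c * (Rpower q (- y) * v)))
    with (c * c * (Rpower q (- x) * Rpower q (- y)) * (u * v)) by ring.
  rewrite <- Rpower_plus; replace (- x + - y) with (- ((x + y) / 2) + - ((x + y) / 2)) by field.
  rewrite Rpower_plus; ring. }
rewrite E, sqrt_mult by (try apply pow2_ge_0; now apply Rmult_le_pos).
rewrite sqrt_pow2 by (apply Rmult_le_pos; lra).
rewrite sqrt_mult by assumption.
replace (z - (x + y) / 2) with (- ((x + y) / 2) + z) by ring; rewrite Rpower_plus.
assert (Ez : Rpower q z = / Rpower q (- z)) by (rewrite Rpower_Ropp, Rinv_inv; reflexivity).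
rewrite Ez; field; repeat split; lra.
Qed.

Lemma one_minus_Rpower (q x : R) : 0 < q < 1 -> 0 <= x ->
  let s := sqrt (1 - Rpower q (2 * x)) in 1 - Rpower q (2 * x) <= s /\ s <= 1.
Proof.
intros Hq Hx; cbv zeta.
assert (H : 0 < Rpower q (2 * x) <= 1) by (split; [apply Rpower_pos|apply Rpower_le_1; lra]).
set (u := 1 - Rpower q (2 * x)); assert (Hu : 0 <= u <= 1) by (unfold u; lra).
pose proof (sqrt_pos u); pose proof (sqrt_sqrt u (proj1 Hu)); split; nra.
Qed.

(** The factor in [y] is kept exact: in [D_p] it depends on [beta] alone and differs from 1 near the
    lower end of [m2], whereas [x] and [z] grow with [j] and [l]. *)
Lemma root_asymptotics (q x y z : R) : 0 < q < 1 -> 0 <= x -> 0 <= y -> 1 <= z ->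
  Rabs (root_ratio q x y z - sqrt (1 - Rpower q (2 * y)))
  <= / (1 - q) * (Rpower q (2 * x) + Rpower q (2 * z)).
Proof.
intros Hq Hx Hy Hz; unfold root_ratio.
destruct (one_minus_Rpower q x Hq Hx) as [U1 U2]; destruct (one_minus_Rpower q y Hq Hy) as [V1 V2].
assert (Hz1 : Rpower q (2 * z) <= q).
{ rewrite <- (Rpower_1 q) at 2 by lra; apply Rpower_decr; lra. }
pose proof (Rpower_pos q (2 * z)) as Hz0; pose proof (Rpower_pos q (2 * x)) as Hx0.
set (s := sqrt (1 - Rpower q (2 * x))) in *; set (t := sqrt (1 - Rpower q (2 * y))) in *.
set (w := 1 - Rpower q (2 * z)) in *.
assert (Ht : 0 <= t) by apply sqrt_pos.
assert (Hw : 1 - q <= w) by (unfold w; lra).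
replace (s * t / w - t) with (t * (s - w) * / w) by (field; lra).
rewrite !Rabs_mult, (Rabs_pos_eq t), (Rabs_pos_eq (/ w))
  by (try exact Ht; apply Rlt_le, Rinv_0_lt_compat; lra).
assert (H1 : Rabs (s - w) <= Rpower q (2 * x) + Rpower q (2 * z))
  by (apply Rabs_le; unfold w; lra).
assert (H2 : 0 < / w <= / (1 - q)).
{ split; [apply Rinv_0_lt_compat; lra|apply Rinv_le_contravar; lra]. }
pose proof (Rabs_pos (s - w)).
apply Rle_trans with (1 * (Rpower q (2 * x) + Rpower q (2 * z)) * / (1 - q)); [|lra].
apply Rmult_le_compat; try lra.
- apply Rmult_le_pos; lra.
- apply Rmult_le_compat; lra.
Qed.

Lemma root_asymptotics_1 (q x y z : R) : 0 < q < 1 -> 0 <= x -> 0 <= y -> 1 <= z ->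
  Rabs (root_ratio q x y z - 1)
  <= / (1 - q) * (Rpower q (2 * x) + Rpower q (2 * z)) + Rpower q (2 * y).
Proof.
intros Hq Hx Hy Hz; pose proof (root_asymptotics q x y z Hq Hx Hy Hz) as H.
destruct (one_minus_Rpower q y Hq Hy) as [V1 V2].
set (t := sqrt (1 - Rpower q (2 * y))) in *.
replace (root_ratio q x y z - 1) with ((root_ratio q x y z - t) + (t - 1)) by ring.
eapply Rle_trans; [apply Rabs_triang|]; apply Rplus_le_compat; [exact H|].
apply Rabs_le; lra.
Qed.

Lemma root_ratio_ge (q x y z : R) : 0 < q < 1 -> 1 / 2 <= x -> 1 / 2 <= y -> 1 <= z ->
  (1 - q) ^ 2 <= root_ratio q x y z.
Proof.
intros Hq Hx Hy Hz.
destruct (one_minus_Rpower q x Hq ltac:(lra)) as [X1 _].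
destruct (one_minus_Rpower q y Hq ltac:(lra)) as [Y1 _].
assert (Hle : forall t, 1 / 2 <= t -> Rpower q (2 * t) <= q).
{ intros t Ht; rewrite <- (Rpower_1 q) at 2 by lra; apply Rpower_decr; lra. }
pose proof (Hle x Hx); pose proof (Hle y Hy); pose proof (Hle z ltac:(lra)).
pose proof (Rpower_pos q (2 * z)).
assert (Hst : (1 - q) ^ 2 <= sqrt (1 - Rpower q (2 * x)) * sqrt (1 - Rpower q (2 * y))).
{ simpl; rewrite Rmult_1_r; apply Rmult_le_compat; lra. }
assert (Hw : 1 <= / (1 - Rpower q (2 * z))).
{ rewrite <- Rinv_1; apply Rinv_le_contravar; lra. }
assert (0 <= (1 - q) ^ 2) by apply pow2_ge_0.
unfold root_ratio, Rdiv; nra.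
Qed.

Definition eps_beta (b : Z) : R := / 2 * (if Z.even ((b + 1) / 2) then -1 else 1).

(** The integers [l + 1/2 - j - m2] and [l + 1/2 - j + m2] have odd sum, hence opposite parities. So
    the sign is a function of [beta] alone, and coefficients containing it can have limits that
    depend on [beta] only. *)
Lemma eps_eps_beta (k : label) : admissible k = true ->
  eps (lab_l k) (lab_j k) (lab_m2 k) = eps_beta (beta k).
Proof.
destruct k as [s l m1 m2 j]; intros H; apply admissible_coordinates in H.
destruct H as (n & p & a & b & H); unfold eps, eps_beta, beta; cbn [lab_l lab_j lab_m2].
replace (l + 1 - j - m2)%Z with ((2 * (n - p) + 1 - b) * 2)%Z by lia.
replace (m2 + l - j + 1)%Z with (b * 2)%Z by lia.
rewrite !Z.div_mul by lia.
replace (2 * (n - p) + 1 - b)%Z with ((1 - b) + 2 * (n - p))%Z by lia.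
rewrite Z.even_add_mul_2, Z.even_sub; simpl (Z.even 1).
now destruct (Z.even b).
Qed.

Lemma eps_beta_cases (b : Z) : eps_beta b = / 2 \/ eps_beta b = - / 2.
Proof. unfold eps_beta; destruct (Z.even _); [right|left]; lra. Qed.

Lemma half_beta (k : label) : half (beta k) = half (lab_m2 k) + half (lab_l k) - half (lab_j k).
Proof. unfold half, beta; rewrite minus_IZR, plus_IZR; field. Qed.

Lemma half_alpha (k : label) : half (alpha k) = half (lab_m1 k) + half (lab_j k).
Proof. unfold half, alpha; rewrite plus_IZR; field. Qed.

Lemma weight_half (q : R) (k : label) : 0 < q < 1 ->
  weight q k = Rpower q (half (lab_j k)) + Rpower q (half (alpha k) + half (beta k)).
Proof. intros; unfold weight, qh; now rewrite Rpower_plus. Qed.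

(** The value of [D_p] at fixed [beta] once [j] and [l] are large. It tends to 1 with growing
    [beta], which gives [x2] the symbol 1. *)
Definition D_limit (q : R) (b : Z) : R :=
  sqrt (1 - Rpower q (2 * (half b + 2 - eps_beta b))).

Lemma D_p_asymptotics (q : R) : 0 < q < 1 ->
  exists K, 0 <= K /\ forall k, admissible k = true ->
    Rabs (D_p q (lab_l k) (lab_j k) (lab_m2 k) - D_limit q (beta k)) <= K * weight q k.
Proof.
intros Hq; assert (Hi : 0 < / (1 - q)) by (apply Rinv_0_lt_compat; lra).
exists (/ (1 - q) * 2); split; [lra|]; intros k Hk.
destruct (admissible_half k Hk) as (H1 & H2 & H3).
unfold D_p, D_limit; cbv zeta; rewrite (eps_eps_beta k Hk), half_beta.
set (l := half (lab_l k)) in *; set (j := half (lab_j k)) in *; set (m2 := half (lab_m2 k)) in *.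
assert (He : - / 2 <= eps_beta (beta k) <= / 2) by (destruct (eps_beta_cases (beta k)); lra).
set (e := eps_beta (beta k)) in *.
rewrite root_eq by lra; rewrite <- Rmult_assoc, <- Rpower_plus.
replace (- l + m2 - 3 / 2 + (2 * l + 4 - (l + j + m2 + 3 + e + (l - j + m2 + 2 - e)) / 2)) with 0
  by field.
rewrite Rpower_O, Rmult_1_l by lra.
replace (l - j + m2 + 2 - e) with (m2 + l - j + 2 - e) by ring.
eapply Rle_trans; [apply root_asymptotics; lra|].
rewrite Rmult_assoc; apply Rmult_le_compat_l; [lra|].
assert (T1 : Rpower q (2 * (l + j + m2 + 3 + e)) <= Rpower q j) by (apply Rpower_decr; lra).
assert (T2 : Rpower q (2 * (2 * l + 4)) <= Rpower q j) by (apply Rpower_decr; lra).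
rewrite weight_half by exact Hq; fold j.
pose proof (Rpower_pos q (half (alpha k) + half (beta k))); lra.
Qed.

(** The value of [C_p] at fixed [beta] for large [j] and [l]. It decays with [beta], so [x1] has a
    boundary function but no symbol. *)
Definition BC_limit (q : R) (b : Z) : R := - Rpower q (half b - eps_beta b).

Lemma B_p_eq (q : R) (k : label) : 0 < q < 1 -> admissible k = true ->
  B_p q (lab_j k) (lab_m1 k)
  = root_ratio q (half (alpha k) + 1) (half (alpha k) + 2) (2 * half (lab_j k) + 2).
Proof.
intros Hq Hk; destruct (admissible_half k Hk) as (H1 & H2 & _).
unfold B_p; cbv zeta; rewrite half_alpha.
set (j := half (lab_j k)) in *; set (m1 := half (lab_m1 k)) in *.
rewrite root_eq by lra; rewrite <- Rmult_assoc, <- Rpower_plus.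
replace (- j + m1 - 1 / 2 + (2 * j + 2 - (j + m1 + 1 + (j + m1 + 2)) / 2)) with 0 by field.
rewrite Rpower_O, Rmult_1_l by lra; f_equal; ring.
Qed.

(** As [x] and [y] are at least [j], this says that [C_p] is [BC_limit] up to [O(q^(2j))]. *)
Lemma C_p_eq (q : R) (k : label) : 0 < q < 1 -> admissible k = true ->
  exists x y, half (lab_j k) <= x /\ half (lab_j k) <= y /\
    C_p q (lab_l k) (lab_j k) (lab_m2 k)
    = BC_limit q (beta k) * root_ratio q x y (2 * half (lab_l k) + 4).
Proof.
intros Hq Hk; destruct (admissible_half k Hk) as (H1 & _ & H3).
unfold C_p, BC_limit; cbv zeta; rewrite (eps_eps_beta k Hk), half_beta.
set (l := half (lab_l k)) in *; set (j := half (lab_j k)) in *; set (m2 := half (lab_m2 k)) in *.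
assert (He : - / 2 <= eps_beta (beta k) <= / 2) by (destruct (eps_beta_cases (beta k)); lra).
set (e := eps_beta (beta k)) in *.
exists (l + j + m2 + 3 + e), (l + j - m2 + 3 - e); split; [lra|split; [lra|]].
rewrite root_eq by lra; rewrite Ropp_mult_distr_l_reverse, <- Rmult_assoc, <- Rpower_plus.
rewrite Ropp_mult_distr_l_reverse; do 3 f_equal; field.
Qed.

Lemma BC_limit_bound (q : R) (b : Z) : 0 < q < 1 ->
  Rabs (BC_limit q b) <= Rpower q (-1) * Rpower q (half b).
Proof.
intros Hq; unfold BC_limit; rewrite Rabs_Ropp, Rabs_pos_eq by (apply Rlt_le, Rpower_pos).
rewrite <- Rpower_plus; apply Rpower_decr; [exact Hq|].
destruct (eps_beta_cases b); lra.
Qed.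

(** The error of [B_p] contains [q^(j + m1)], which by itself is not negligible; the factor
    [BC_limit], of size [q^(l - j + m2)], completes it to the second summand of the weight. *)
Lemma BC_asymptotics (q : R) : 0 < q < 1 ->
  exists K, 0 <= K /\ forall k, admissible k = true ->
    Rabs (B_p q (lab_j k) (lab_m1 k) * C_p q (lab_l k) (lab_j k) (lab_m2 k) - BC_limit q (beta k))
    <= K * weight q k.
Proof.
intros Hq; set (c := / (1 - q)); assert (Hc : 0 < c) by (apply Rinv_0_lt_compat; lra).
pose proof (qconst_pow_pos q 30 Hq) as HQ; set (Q := qconst q ^ 30) in *.
pose proof (Rpower_pos q (-1)) as Hr; set (r := Rpower q (-1)) in *.
set (M := Q * (2 * c + 1) + 2 * c + 1).
assert (HM : 2 * c + 1 <= M).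
{ assert (0 <= Q * (2 * c + 1)) by (apply Rmult_le_pos; lra); unfold M; lra. }
exists (M * (r * (r + 1))); split; [repeat apply Rmult_le_pos; lra|].
intros k Hk; destruct (admissible_half k Hk) as (H1 & H2 & H3).
assert (HB : Rabs (B_p q (lab_j k) (lab_m1 k)) <= Q).
{ assert (HB : ebd q 30 0 (B_p q (lab_j k) (lab_m1 k))) by (apply ebd_B_p; [exact Hq|split; lra]).
  unfold ebd in HB; now rewrite Rpower_O, Rmult_1_r in HB by lra. }
destruct (C_p_eq q k Hq Hk) as (x & y & Hx & Hy & ->).
pose proof (BC_limit_bound q (beta k) Hq) as HL; fold r in HL.
assert (Ha := half_alpha k); assert (Hb := half_beta k).
rewrite weight_half by exact Hq.
set (a := half (alpha k)) in *; set (b := half (beta k)) in *.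
assert (HB1 : Rabs (B_p q (lab_j k) (lab_m1 k) - 1) <= (2 * c + 1) * (Rpower q (half (lab_j k)) + Rpower q a)).
{ rewrite B_p_eq by assumption; fold a.
  eapply Rle_trans; [apply root_asymptotics_1; lra|]; fold c.
  assert (Rpower q (2 * (a + 1)) <= Rpower q a) by (apply Rpower_decr; lra).
  assert (Rpower q (2 * (a + 2)) <= Rpower q a) by (apply Rpower_decr; lra).
  assert (Rpower q (2 * (2 * half (lab_j k) + 2)) <= Rpower q (half (lab_j k)))
    by (apply Rpower_decr; lra).
  pose proof (Rpower_pos q a); pose proof (Rpower_pos q (half (lab_j k))); nra. }
set (B := B_p q (lab_j k) (lab_m1 k)) in *; set (L := BC_limit q (beta k)) in *.
set (l := half (lab_l k)) in *; set (j := half (lab_j k)) in *.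
assert (HR : Rabs (root_ratio q x y (2 * l + 4) - 1) <= (2 * c + 1) * Rpower q j).
{ eapply Rle_trans; [apply root_asymptotics_1; lra|]; fold c.
  assert (Rpower q (2 * x) <= Rpower q j) by (apply Rpower_decr; lra).
  assert (Rpower q (2 * y) <= Rpower q j) by (apply Rpower_decr; lra).
  assert (Rpower q (2 * (2 * l + 4)) <= Rpower q j) by (apply Rpower_decr; lra).
  nra. }
set (R0 := root_ratio q x y (2 * l + 4)) in *.
replace (B * (L * R0) - L) with (L * (B * (R0 - 1) + (B - 1))) by ring.
rewrite Rabs_mult.
pose proof (Rpower_pos q j) as Pj; pose proof (Rpower_pos q a) as Pa.
assert (Hsum : Rabs (B * (R0 - 1) + (B - 1)) <= M * (Rpower q j + Rpower q a)).
{ eapply Rle_trans; [apply Rabs_triang|]; rewrite Rabs_mult.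
  assert (Rabs B * Rabs (R0 - 1) <= Q * ((2 * c + 1) * Rpower q j))
    by (apply Rmult_le_compat; try apply Rabs_pos; assumption).
  assert (0 <= Q * (2 * c + 1) * Rpower q a)
    by (apply Rmult_le_pos; [apply Rmult_le_pos|]; lra).
  unfold M; lra. }
apply Rle_trans with (r * Rpower q b * (M * (Rpower q j + Rpower q a))).
- apply Rmult_le_compat; try apply Rabs_pos; assumption.
- assert (Hbr : Rpower q b <= r) by (apply Rpower_decr; [exact Hq|lra]).
  rewrite Rpower_plus; pose proof (Rpower_pos q b) as Pb.
  replace (r * Rpower q b * (M * (Rpower q j + Rpower q a)))
    with (M * r * (Rpower q b * Rpower q j + Rpower q a * Rpower q b)) by ring.
  replace (M * (r * (r + 1)) * (Rpower q j + Rpower q a * Rpower q b))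
    with (M * r * ((r + 1) * (Rpower q j + Rpower q a * Rpower q b))) by ring.
  apply Rmult_le_compat_l; [apply Rmult_le_pos; lra|].
  assert (Rpower q b * Rpower q j <= r * Rpower q j) by (apply Rmult_le_compat_r; lra).
  assert (0 <= r * (Rpower q a * Rpower q b)) by (repeat apply Rmult_le_pos; lra).
  lra.
Qed.

(** * The terms of the three generators *)

Definition real_term (v : displacement) (c : label -> R) (f : C) : term :=
  Term v (fun k => RtoC (c k)) f.

Definition sgn (k : label) : R := if chirality k then 1 else -1.

Lemma ebd_sgn (q : R) (n : nat) (e x : R) (k : label) : ebd q n e x -> ebd q n e (sgn k * x).
Proof.
unfold sgn; destruct (chirality k); intros H; [now rewrite Rmult_1_l|].
replace (-1 * x) with (- x) by ring; now apply ebd_opp.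
Qed.

Lemma ebd_opp_sgn (q : R) (n : nat) (e x : R) (k : label) : ebd q n e x -> ebd q n e (- sgn k * x).
Proof. intros H; rewrite Ropp_mult_distr_l_reverse; now apply ebd_opp, ebd_sgn. Qed.

(** A product of two coefficients uses 60 powers of [qconst]; the slack of 5 in the exponent, meant
    for the offsets of shifted labels, costs 5 more. *)
Lemma weight_of_ebd (q : R) (n : nat) (e x : R) (k : label) : 0 < q < 1 -> ebd q n e x ->
  (n <= 75)%nat -> half (lab_j k) - 5 <= e \/ half (alpha k) + half (beta k) - 5 <= e ->
  Rabs x <= qconst q ^ 80 * weight q k.
Proof.
intros Hq H Hn He; rewrite weight_half by exact Hq.
pose proof (Rpower_pos q (half (lab_j k))) as P1.
pose proof (Rpower_pos q (half (alpha k) + half (beta k))) as P2.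
pose proof (qconst_pow_pos q 80 Hq) as P3.
destruct He as [He|He];
  [assert (H' := ebd_weaken q n 5 80 e (half (lab_j k)) x Hq H ltac:(lia) ltac:(simpl; lra))
  |assert (H' := ebd_weaken q n 5 80 e (half (alpha k) + half (beta k)) x Hq H
                   ltac:(lia) ltac:(simpl; lra))]; unfold ebd in H'; nra.
Qed.

Lemma real_term_small (q : R) (v : displacement) (c : label -> R) : 0 < q < 1 ->
  (forall k, adm2 v k -> Rabs (c k) <= qconst q ^ 80 * weight q k) -> good q (real_term v c 0).
Proof.
intros Hq H; apply (good_of_small q v _ (qconst q ^ 80)).
- pose proof (qconst_pow_pos q 80 Hq); lra.
- intros k Hk; rewrite Cmod_R; now apply H.
Qed.

Lemma real_term_symmetric (q : R) (v : displacement) (c : label -> R) (f : C) :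
  sh_flip v = false -> (forall k, c (flip k) = c k) -> chirally_symmetric q (real_term v c f).
Proof.
intros Hv Hc; split; [exact Hv|exists 0; split; [lra|]]; intros k _; simpl; rewrite Hc.
replace (c k - c k)%C with (RtoC 0) by ring; rewrite Cmod_0; lra.
Qed.

(** Terms carrying the sign of the chirality are symmetric only if they are [O(q^(2l))] themselves.
    [C_0] and [D_0] are of this size, and [H_0] is after multiplication by [A_0] or [B_0]. *)
Lemma real_term_symmetric_small (q : R) (v : displacement) (c : label -> R) (f : C) : 0 < q < 1 ->
  sh_flip v = false -> (forall k, adm2 v k -> ebd q 80 (2 * half (lab_l k)) (c k)) ->
  chirally_symmetric q (real_term v c f).
Proof.
intros Hq Hv Hc; split; [exact Hv|exists (2 * qconst q ^ 80); split].
- pose proof (qconst_pow_pos q 80 Hq); lra.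
- intros k Hk; simpl t_coef; rewrite <- RtoC_minus, Cmod_R.
  assert (H1 := Hc k Hk); assert (H2 := Hc _ (adm2_flip _ _ Hk)).
  unfold ebd in H1, H2; change (lab_l (flip k)) with (lab_l k) in H2.
  replace (qh q (2 * lab_l k)) with (Rpower q (2 * half (lab_l k)))
    by (unfold qh, half; rewrite mult_IZR; f_equal; field).
  unfold Rminus; eapply Rle_trans; [apply Rabs_triang|]; rewrite Rabs_Ropp; lra.
Qed.

Definition x0_terms (q : R) : list term :=
  let j := lab_j in let l := lab_l in let m1 := lab_m1 in let m2 := lab_m2 in
  [ real_term (Displacement false 1 0 0 1) (fun k =>
      A_p q (j k) (m1 k) * C_p q (l k) (j k) (m2 k)) 0;
    real_term (Displacement false 0 0 0 1) (fun k =>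
      - sgn k * (A_p q (j k) (m1 k) * C_0 q (l k) (j k) (m2 k))) 0;
    real_term (Displacement false (-1) 0 0 1) (fun k =>
      A_p q (j k) (m1 k) * C_m q (l k) (j k) (m2 k)) 0;
    real_term (Displacement false 1 0 0 0) (fun k =>
      A_0 q (j k) (m1 k) * H_p q (l k) (j k) (m2 k)) 0;
    real_term (Displacement false 0 0 0 0) (fun k =>
      sgn k * (A_0 q (j k) (m1 k) * H_0 q (l k) (j k) (m2 k))) 0;
    real_term (Displacement false (-1) 0 0 0) (fun k =>
      A_0 q (j k) (m1 k) * H_p q (l k - 2) (j k) (m2 k)) 0;
    real_term (Displacement false 1 0 0 (-1)) (fun k =>
      A_p q (j k - 2) (m1 k) * C_m q (l k + 2) (j k - 2) (m2 k)) 0;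
    real_term (Displacement false 0 0 0 (-1)) (fun k =>
      - sgn k * (A_p q (j k - 2) (m1 k) * C_0 q (l k) (j k - 2) (m2 k))) 0;
    real_term (Displacement false (-1) 0 0 (-1)) (fun k =>
      A_p q (j k - 2) (m1 k) * C_p q (l k - 2) (j k - 2) (m2 k)) 0 ].

Definition x1_terms (q : R) : list term :=
  let j := lab_j in let l := lab_l in let m1 := lab_m1 in let m2 := lab_m2 in
  [ real_term (Displacement false 1 1 0 1) (fun k =>
      B_p q (j k) (m1 k) * C_p q (l k) (j k) (m2 k)) 0;
    real_term (Displacement false 0 1 0 1) (fun k =>
      - sgn k * (B_p q (j k) (m1 k) * C_0 q (l k) (j k) (m2 k))) 0;
    real_term (Displacement false (-1) 1 0 1) (fun k =>
      B_p q (j k) (m1 k) * C_m q (l k) (j k) (m2 k)) 0;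
    real_term (Displacement false 1 1 0 0) (fun k =>
      B_0 q (j k) (m1 k) * H_p q (l k) (j k) (m2 k)) 0;
    real_term (Displacement false 0 1 0 0) (fun k =>
      sgn k * (B_0 q (j k) (m1 k) * H_0 q (l k) (j k) (m2 k))) 0;
    real_term (Displacement false (-1) 1 0 0) (fun k =>
      B_0 q (j k) (m1 k) * H_p q (l k - 2) (j k) (m2 k)) 0;
    real_term (Displacement false 1 1 0 (-1)) (fun k =>
      B_m q (j k) (m1 k) * C_m q (l k + 2) (j k - 2) (m2 k)) 0;
    real_term (Displacement false 0 1 0 (-1)) (fun k =>
      - sgn k * (B_m q (j k) (m1 k) * C_0 q (l k) (j k - 2) (m2 k))) 0;
    real_term (Displacement false (-1) 1 0 (-1)) (fun k =>
      B_m q (j k) (m1 k) * C_p q (l k - 2) (j k - 2) (m2 k)) 0 ].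

Definition x2_terms (q : R) : list term :=
  let j := lab_j in let l := lab_l in let m2 := lab_m2 in
  [ real_term (Displacement false 1 0 1 0) (fun k => D_p q (l k) (j k) (m2 k)) 1;
    real_term (Displacement false 0 0 1 0) (fun k => sgn k * D_0 q (l k) (j k) (m2 k)) 0;
    real_term (Displacement false (-1) 0 1 0) (fun k => D_m q (l k) (j k) (m2 k)) 0 ].

Lemma move_label (s : bool) (l m1 m2 j a b c d : Z) :
  move (Displacement false a b c d) (Label s l m1 m2 j)
  = Label s (l + 2 * a) (m1 + 2 * b) (m2 + 2 * c) (j + 2 * d).
Proof. now destruct s. Qed.

Ltac label_shifts l m1 m2 j :=
  rewrite !move_label;
  change (2 * 1)%Z with 2%Z; change (2 * -1)%Z with (-2)%Z; change (2 * 0)%Z with 0%Z;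
  rewrite ?(Z.add_0_r l), ?(Z.add_0_r m1), ?(Z.add_0_r m2), ?(Z.add_0_r j).

Ltac represents_generator formula :=
  let k := fresh "k" in
  intros [s l m1 m2 j] Hk; change (ket_of (Label s l m1 m2 j)) with (ket s l m1 m2 j);
  rewrite (formula s l m1 m2 j Hk); apply functional_extensionality; intros k;
  unfold x0_terms, x0_ket, x1_terms, x1_ket, x2_terms, x2_ket, apply_terms, real_term, sgn;
  cbv zeta; cbn [fold_right t_coef t_shift lab_l lab_m1 lab_m2 lab_j chirality];
  unfold vadd, vscal, ket; label_shifts l m1 m2 j;
  change (l - 2)%Z with (l + -2)%Z; change (j - 2)%Z with (j + -2)%Z; ring.

Lemma represents_x0 (q : R) (pi : star_poly -> op) :
  spinor_representation q pi -> represents (pi (Gen X0)) (x0_terms q).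
Proof. intros Hpi; represents_generator (rep_x0 q pi Hpi). Qed.

Lemma represents_x1 (q : R) (pi : star_poly -> op) :
  spinor_representation q pi -> represents (pi (Gen X1)) (x1_terms q).
Proof. intros Hpi; represents_generator (rep_x1 q pi Hpi). Qed.

Lemma represents_x2 (q : R) (pi : star_poly -> op) :
  spinor_representation q pi -> represents (pi (Gen X2)) (x2_terms q).
Proof. intros Hpi; represents_generator (rep_x2 q pi Hpi). Qed.

Lemma half_shift (z a : Z) : half (z + 2 * a) = half z + IZR a.
Proof. unfold half; rewrite plus_IZR, mult_IZR; field. Qed.

Lemma half_plus2 (z : Z) : half (z + 2) = half z + 1.
Proof. exact (half_shift z 1). Qed.

Lemma half_minus2 (z : Z) : half (z - 2) = half z - 1.
Proof. exact (half_shift z (-1)). Qed.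

Lemma adm2_half (v : displacement) (k : label) : adm2 v k ->
  half_admissible (half (lab_l k)) (half (lab_m1 k)) (half (lab_m2 k)) (half (lab_j k)) /\
  half_admissible (half (lab_l k) + IZR (sh_l v)) (half (lab_m1 k) + IZR (sh_m1 v))
    (half (lab_m2 k) + IZR (sh_m2 v)) (half (lab_j k) + IZR (sh_j v)).
Proof.
intros [H1 H2]; split; [now apply admissible_half|].
apply admissible_half in H2; unfold move in H2; cbn [lab_l lab_m1 lab_m2 lab_j] in H2.
rewrite !half_shift in H2; exact H2.
Qed.

Ltac coef_bound Hq :=
  repeat first
    [ apply (ebd_A_p _ _ _ Hq) | apply (ebd_A_0 _ _ _ Hq)
    | apply (ebd_B_p _ _ _ Hq) | apply (ebd_B_0 _ _ _ Hq) | apply (ebd_B_m _ _ _ Hq)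
    | apply (ebd_C_p _ _ _ _ Hq) | apply (ebd_C_0 _ _ _ _ Hq) | apply (ebd_C_m _ _ _ _ Hq)
    | apply (ebd_H_p _ _ _ _ Hq) | apply (ebd_H_0 _ _ _ _ Hq)
    | apply (ebd_D_0 _ _ _ _ Hq) | apply (ebd_D_m _ _ _ _ Hq)
    | apply ebd_opp_sgn | apply ebd_sgn | eapply (ebd_mult _ _ _ _ _ _ _ Hq) ].

Ltac adm_facts k Hk :=
  let H := fresh in
  assert (H := adm2_half _ k Hk); cbn [sh_l sh_m1 sh_m2 sh_j] in H;
  destruct H as [(? & ? & ?) (? & ? & ?)].

Ltac half_lra :=
  unfold okA, okL; rewrite ?half_alpha, ?half_beta, ?half_plus2, ?half_minus2;
  repeat split; lra.

Ltac small_coefficient Hq :=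
  let k := fresh "k" in let Hk := fresh "Hk" in
  apply (real_term_small _ _ _ Hq); intros k Hk; adm_facts k Hk;
  eapply (weight_of_ebd _ _ _ _ _ Hq);
  [ coef_bound Hq; half_lra
  | simpl; lia
  | first [ left; half_lra | right; half_lra ] ].

Ltac small_symmetric Hq :=
  first
  [ apply real_term_symmetric; [reflexivity|intros; reflexivity]
  | let k := fresh "k" in let Hk := fresh "Hk" in
    apply (real_term_symmetric_small _ _ _ _ Hq); [reflexivity|]; intros k Hk; adm_facts k Hk;
    eapply (ebd_weaken _ _ 5 80 _ _ _ Hq);
    [ coef_bound Hq; half_lra | simpl; lia | rewrite ?half_plus2, ?half_minus2; simpl; lra ] ].

Lemma x0_terms_good (q : R) (t : term) : 0 < q < 1 -> In t (x0_terms q) ->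
  good q t /\ chirally_symmetric q t.
Proof.
intros Hq Ht; unfold x0_terms in Ht; cbv zeta in Ht; simpl In in Ht.
decompose [or] Ht; clear Ht; subst t || contradiction.
all: split; [small_coefficient Hq|small_symmetric Hq].
Qed.

Lemma qh_half (q : R) (b : Z) : qh q b = Rpower q (half b).
Proof. reflexivity. Qed.

Lemma half_beta_ge (b : Z) : (-1 <= b)%Z -> - (1 / 2) <= half b.
Proof. intros H; apply IZR_le in H; unfold half; lra. Qed.

Lemma BC_term_good (q : R) : 0 < q < 1 ->
  good q (real_term (Displacement false 1 1 0 1) (fun k =>
      B_p q (lab_j k) (lab_m1 k) * C_p q (lab_l k) (lab_j k) (lab_m2 k)) 0).
Proof.
intros Hq; destruct (BC_asymptotics q Hq) as (K & HK & H).
pose proof (Rpower_pos q (-1)) as Hr.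
exists (fun b => RtoC (BC_limit q b)), (K + Rpower q (-1)).
cbn [real_term t_shift t_coef t_symbol]; split; [lra|split; [|split; [|split]]].
- intros b Hb; rewrite Cmod_R, qh_half.
  eapply Rle_trans; [now apply BC_limit_bound|].
  apply Rmult_le_compat_r; [apply Rlt_le, Rpower_pos|lra].
- intros k [Hk _].
  replace (RtoC (B_p q (lab_j k) (lab_m1 k) * C_p q (lab_l k) (lab_j k) (lab_m2 k)) - 0
           - RtoC (BC_limit q (beta k)))%C
    with (RtoC (B_p q (lab_j k) (lab_m1 k) * C_p q (lab_l k) (lab_j k) (lab_m2 k)
                - BC_limit q (beta k))) by (rewrite RtoC_minus; ring).
  rewrite Cmod_R; specialize (H k Hk); pose proof (weight_pos q k); nra.
- left; split; reflexivity.
- now left.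
Qed.

Lemma D_term_good (q : R) : 0 < q < 1 ->
  good q (real_term (Displacement false 1 0 1 0)
            (fun k => D_p q (lab_l k) (lab_j k) (lab_m2 k)) 1).
Proof.
intros Hq; destruct (D_p_asymptotics q Hq) as (K & HK & H).
exists (fun b => RtoC (D_limit q b - 1)), (K + 1).
cbn [real_term t_shift t_coef t_symbol]; split; [lra|split; [|split; [|split]]].
- intros b Hb; rewrite Cmod_R, qh_half; unfold D_limit.
  pose proof (half_beta_ge b Hb) as Hb'.
  assert (He : - / 2 <= eps_beta b <= / 2) by (destruct (eps_beta_cases b); lra).
  destruct (one_minus_Rpower q (half b + 2 - eps_beta b) Hq ltac:(lra)) as [H1 H2].
  apply Rle_trans with (Rpower q (2 * (half b + 2 - eps_beta b))); [apply Rabs_le; lra|].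
  apply Rle_trans with (Rpower q (half b)); [apply Rpower_decr; lra|].
  pose proof (Rpower_pos q (half b)); nra.
- intros k [Hk _].
  replace (RtoC (D_p q (lab_l k) (lab_j k) (lab_m2 k)) - 1 - RtoC (D_limit q (beta k) - 1))%C
    with (RtoC (D_p q (lab_l k) (lab_j k) (lab_m2 k) - D_limit q (beta k)))
    by (rewrite !RtoC_minus; ring).
  rewrite Cmod_R; specialize (H k Hk); pose proof (weight_pos q k); nra.
- left; split; reflexivity.
- now right.
Qed.

Lemma x1_terms_good (q : R) (t : term) : 0 < q < 1 -> In t (x1_terms q) ->
  good q t /\ chirally_symmetric q t.
Proof.
intros Hq Ht; unfold x1_terms in Ht; cbv zeta in Ht; simpl In in Ht.
decompose [or] Ht; clear Ht; subst t || contradiction.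
all: split; [|small_symmetric Hq].
(* Only the leading term is not bounded by the weight, since at small [beta] it does not decay; the
   other eight yield to counting exponents. *)
1: now apply BC_term_good.
all: small_coefficient Hq.
Qed.

Lemma x2_terms_good (q : R) (t : term) : 0 < q < 1 -> In t (x2_terms q) ->
  good q t /\ chirally_symmetric q t.
Proof.
intros Hq Ht; unfold x2_terms in Ht; cbv zeta in Ht; simpl In in Ht.
decompose [or] Ht; clear Ht; subst t || contradiction.
all: split; [|small_symmetric Hq].
1: now apply D_term_good.
all: small_coefficient Hq.
Qed.

Lemma algebra_terms_gen (q : R) (pi : star_poly -> op) (x : generator) : 0 < q < 1 ->
  spinor_representation q pi -> exists L, algebra_terms q pi (Gen x) L.
Proof.
intros Hq Hpi; destruct x;
  [exists (x0_terms q)|exists (x1_terms q)|exists (x2_terms q)]; split.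
- now apply represents_x0.
- split; [intros t; now apply x0_terms_good|].
  intros theta; unfold x0_terms, real_term; simpl; ring.
- now apply represents_x1.
- split; [intros t; now apply x1_terms_good|].
  intros theta; unfold x1_terms, real_term; simpl; ring.
- now apply represents_x2.
- split; [intros t; now apply x2_terms_good|].
  intros theta; unfold x2_terms, real_term; simpl; rewrite Rmult_1_l.
  change (cos theta, sin theta) with (cis theta); ring.
Qed.

Ltac C_ring := match goal with |- @eq _ ?a ?b => change (@eq C a b); ring end.

(** * Growth of the trace on the eigenspaces *)

Lemma sum_n_le (u v : nat -> R) (n : nat) :
  (forall i, (i <= n)%nat -> u i <= v i) -> sum_n u n <= sum_n v n.
Proof. intros H; rewrite !sum_n_Reals; now apply sum_Rle. Qed.

Lemma Cmod_sum_n_le (u : nat -> C) (v : nat -> R) (n : nat) :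
  (forall i, (i <= n)%nat -> Cmod (u i) <= v i) -> Cmod (sum_n u n) <= sum_n v n.
Proof.
induction n as [|n IH]; intros H; [rewrite !sum_O; apply H; lia|].
rewrite !sum_Sn; eapply Rle_trans; [apply Cmod_triangle|].
apply Rplus_le_compat; [apply IH; intros; apply H; lia|apply H; lia].
Qed.

Lemma sum_n_R_scal (c : R) (u : nat -> R) (n : nat) : sum_n (fun i => c * u i) n = c * sum_n u n.
Proof. exact (sum_n_mult_l (K := R_Ring) c u n). Qed.

Lemma sum_n_R_plus (u v : nat -> R) (n : nat) :
  sum_n (fun i => u i + v i) n = sum_n u n + sum_n v n.
Proof. exact (sum_n_plus (G := R_AbelianMonoid) u v n). Qed.

Lemma geometric_sum_le (q : R) (n : nat) : 0 < q < 1 -> sum_n (fun i => q ^ i) n <= / (1 - q).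
Proof.
intros Hq; apply Rmult_le_reg_l with (1 - q); [lra|]; rewrite Rinv_r by lra.
assert (E : (1 - q) * sum_n (fun i => q ^ i) n = 1 - q ^ S n).
{ induction n as [|n IH]; [rewrite sum_O; simpl; ring|].
  rewrite sum_Sn; unfold plus; simpl; rewrite Rmult_plus_distr_l, IH; simpl; ring. }
rewrite E; assert (0 < q ^ S n) by (apply pow_lt; lra); lra.
Qed.

Lemma geometric_reverse_sum_le (q : R) (n : nat) : 0 < q < 1 ->
  sum_n (fun i => q ^ (n - i)) n <= / (1 - q).
Proof.
intros Hq; assert (H1 : / (1 - q) = q * / (1 - q) + 1) by (field; lra).
assert (H0 : 0 < / (1 - q)) by (apply Rinv_0_lt_compat; lra).
induction n as [|n IH]; [rewrite sum_O; simpl; nra|].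
rewrite sum_Sn, Nat.sub_diag.
rewrite (sum_n_ext_loc _ (fun i => q * q ^ (n - i)))
  by (intros i Hi; now replace (S n - i)%nat with (S (n - i)) by lia).
rewrite sum_n_R_scal; change (q * sum_n (fun i => q ^ (n - i)) n + 1 <= / (1 - q)); nra.
Qed.

Lemma arithmetic_geometric_sum_le (q : R) (n : nat) : 0 < q < 1 ->
  sum_n (fun i => INR (S i) * q ^ i) n <= / (1 - q) ^ 2.
Proof.
intros Hq; assert (Hp : 0 < (1 - q) ^ 2) by (apply pow_lt; lra).
apply Rmult_le_reg_l with ((1 - q) ^ 2); [exact Hp|]; rewrite Rinv_r by lra.
assert (E : (1 - q) ^ 2 * sum_n (fun i => INR (S i) * q ^ i) n
            = 1 - (INR n + 2) * q ^ S n + (INR n + 1) * q ^ S (S n)).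
{ induction n as [|n IH]; [rewrite sum_O; simpl; ring|].
  rewrite sum_Sn.
  change ((1 - q) ^ 2 * (sum_n (fun i => INR (S i) * q ^ i) n + INR (S (S n)) * q ^ S n)
          = 1 - (INR (S n) + 2) * q ^ S (S n) + (INR (S n) + 1) * q ^ S (S (S n))).
  rewrite Rmult_plus_distr_l, IH, !S_INR; simpl; ring. }
rewrite E; assert (0 < q ^ S n) by (apply pow_lt; lra).
replace (q ^ S (S n)) with (q * q ^ S n) by reflexivity.
pose proof (pos_INR n).
assert (0 <= ((INR n + 2) - (INR n + 1) * q) * q ^ S n) by (apply Rmult_le_pos; nra).
lra.
Qed.

Lemma qh_double (q : R) (n : nat) : 0 < q -> qh q (2 * Z.of_nat n) = q ^ n.
Proof.
intros Hq; unfold qh, half; rewrite mult_IZR, <- INR_IZR_INZ.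
replace (2 * INR n / 2) with (INR n) by field; now apply Rpower_pow.
Qed.

Lemma alpha_label_at (s : bool) (n p a b : nat) : alpha (label_at s n p a b) = (2 * Z.of_nat a)%Z.
Proof. unfold alpha, label_at; cbn [lab_m1 lab_j]; lia. Qed.

Lemma beta_label_at (s : bool) (n p a b : nat) :
  beta (label_at s n p a b) = (2 * Z.of_nat b + -1)%Z.
Proof. unfold beta, label_at; cbn [lab_m2 lab_l lab_j]; lia. Qed.

Lemma weight_label_at (q : R) (s : bool) (n p a b : nat) : 0 < q ->
  weight q (label_at s n p a b) = qh q 1 * q ^ p + qh q (-1) * (q ^ a * q ^ b).
Proof.
intros Hq; unfold weight; rewrite alpha_label_at, beta_label_at.
change (lab_j (label_at s n p a b)) with (2 * Z.of_nat p + 1)%Z.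
rewrite !qh_add, !qh_double by exact Hq; ring.
Qed.

(** For [q^j] there are [O(j)] values of [m1] and [O(N)] of [m2], and the sum of [j q^j] converges.
    For the other summand the sums over [m1] and [m2] are geometric, leaving a bounded amount for
    each of the [N - 1] values of [j]. *)
Lemma level_sum_weight_le (q : R) : 0 < q < 1 ->
  exists K, 0 <= K /\ forall n, level_sum (weight q) n <= K * (INR n + 2).
Proof.
intros Hq; set (c1 := qh q 1); set (c2 := qh q (-1)).
assert (Hc1 : 0 < c1) by apply qh_pos; assert (Hc2 : 0 < c2) by apply qh_pos.
assert (Hi : 0 < / (1 - q)) by (apply Rinv_0_lt_compat; lra).
assert (Hi2 : 0 < / (1 - q) ^ 2) by (apply Rinv_0_lt_compat, pow_lt; lra).
exists (8 * c1 * / (1 - q) ^ 2 + 2 * c2 * / (1 - q) ^ 2); split; [nra|]; intros n.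
assert (Hn := pos_INR n).
set (A := fun p => 8 * c1 * (INR n + 1) * (INR (S p) * q ^ p)).
apply Rle_trans with (sum_n (fun p => A p + 2 * c2 * / (1 - q) ^ 2) n).
- apply sum_n_le; intros p Hp.
  apply Rle_trans with (sum_n (fun a => INR (2 * (n - p) + 2) * (2 * c1 * q ^ p)
                                + 2 * c2 * / (1 - q) * q ^ a) (2 * p + 1)).
  + apply sum_n_le; intros a Ha.
    apply Rle_trans with (sum_n (fun b => 2 * c1 * q ^ p + 2 * c2 * q ^ a * q ^ b) (2 * (n - p) + 1)).
    * apply sum_n_le; intros b Hb; rewrite !weight_label_at by lra; unfold plus; simpl.
      fold c1 c2; apply Req_le; ring.
    * rewrite (sum_n_R_plus (fun _ => 2 * c1 * q ^ p)), sum_n_const, sum_n_R_scal.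
      replace (S (2 * (n - p) + 1)) with (2 * (n - p) + 2)%nat by lia.
      assert (0 < q ^ a) by (apply pow_lt; lra).
      pose proof (geometric_sum_le q (2 * (n - p) + 1) Hq).
      assert (2 * c2 * q ^ a * sum_n (fun b => q ^ b) (2 * (n - p) + 1) <= 2 * c2 * q ^ a * / (1 - q))
        by (apply Rmult_le_compat_l; nra).
      apply Rplus_le_compat; [lra|].
      eapply Rle_trans; [eassumption|apply Req_le; ring].
  + rewrite (sum_n_R_plus (fun _ => INR (2 * (n - p) + 2) * (2 * c1 * q ^ p))),
      sum_n_const, sum_n_R_scal.
    apply Rplus_le_compat.
    * unfold A; assert (0 < q ^ p) by (apply pow_lt; lra).
      replace (S (2 * p + 1)) with (2 * S p)%nat by lia; rewrite mult_INR.
      assert (H1 : INR (2 * (n - p) + 2) <= 2 * (INR n + 1)).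
      { apply Rle_trans with (INR (2 * (n + 1))); [apply le_INR; lia|].
        rewrite mult_INR, plus_INR; simpl; lra. }
      pose proof (pos_INR (S p)); simpl (INR 2).
      replace (8 * c1 * (INR n + 1) * (INR (S p) * q ^ p))
        with ((1 + 1) * INR (S p) * (2 * (INR n + 1) * (2 * c1 * q ^ p))) by ring.
      apply Rmult_le_compat_l; [nra|]; apply Rmult_le_compat_r; nra.
    * pose proof (geometric_sum_le q (2 * p + 1) Hq).
      replace (/ (1 - q) ^ 2) with (/ (1 - q) * / (1 - q)) by (field; lra).
      assert (2 * c2 * / (1 - q) * sum_n (fun i => q ^ i) (2 * p + 1)
              <= 2 * c2 * / (1 - q) * / (1 - q)) by (apply Rmult_le_compat_l; nra).
      eapply Rle_trans; [eassumption|apply Req_le; ring].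
- rewrite (sum_n_R_plus A), sum_n_const.
  unfold A; rewrite sum_n_R_scal.
  pose proof (arithmetic_geometric_sum_le q n Hq) as H.
  assert (H' : 8 * c1 * (INR n + 1) * sum_n (fun p => INR (S p) * q ^ p) n
               <= 8 * c1 * (INR n + 1) * / (1 - q) ^ 2) by (apply Rmult_le_compat_l; nra).
  rewrite S_INR; apply Rle_trans with
    (8 * c1 * (INR n + 1) * / (1 - q) ^ 2 + (INR n + 1) * (2 * c2 * / (1 - q) ^ 2)).
  + now apply Rplus_le_compat_r.
  + assert (0 < c1 * / (1 - q) ^ 2) by nra; assert (0 < c2 * / (1 - q) ^ 2) by nra; nra.
Qed.

Lemma Cmod_level_sum_le (F : label -> C) (G : label -> R) (n : nat) :
  (forall k, admissible k = true -> Cmod (F k) <= G k) ->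
  Cmod (level_sum F n) <= level_sum G n.
Proof.
intros H; apply Cmod_sum_n_le; intros p Hp; apply Cmod_sum_n_le; intros a Ha.
apply Cmod_sum_n_le; intros b Hb; eapply Rle_trans; [apply Cmod_triangle|].
apply Rplus_le_compat; apply H; now apply label_at_admissible.
Qed.

Lemma sum_n_C_const (z : C) (n : nat) : sum_n (fun _ => z) n = (INR (S n) * z)%C.
Proof.
induction n as [|n IH]; [rewrite sum_O; simpl; ring|].
rewrite sum_Sn, IH, (S_INR (S n)), RtoC_plus; unfold plus; simpl; ring.
Qed.

Lemma sum_n_C_scal (z : C) (u : nat -> C) (n : nat) :
  sum_n (fun i => z * u i)%C n = (z * sum_n u n)%C.
Proof. exact (sum_n_mult_l (K := C_Ring) z u n). Qed.

Lemma sum_n_C_scal_r (z : C) (u : nat -> R) (n : nat) :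
  sum_n (fun i => u i * z)%C n = (sum_n u n * z)%C.
Proof.
induction n as [|n IH]; [now rewrite !sum_O|].
rewrite !sum_Sn, IH; unfold plus; simpl; rewrite RtoC_plus; ring.
Qed.

(** This is the dimension of the eigenspace of [N = n + 2], both chiralities included. As it has no
    [N^2] term, a constant symbol contributes nothing to the pole at 3. *)
Lemma multiplicity_sum (n : nat) :
  sum_n (fun p => INR (2 * p + 2) * INR (2 * (n - p) + 2) * 2) n
  = 4 / 3 * ((INR n + 2) ^ 3 - (INR n + 2)).
Proof.
(* The summand depends on [n], so the induction is on the upper limit [m] with [n] fixed. *)
assert (H : forall m, (m <= n)%nat ->
  sum_n (fun p => INR (2 * p + 2) * INR (2 * (n - p) + 2) * 2) m
  = 8 * ((INR n + 2) * (INR m + 1) * (INR m + 2) / 2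
         - (INR m + 1) * (INR m + 2) * (2 * INR m + 3) / 6)).
{ induction m as [|m IH]; intros Hm.
  - rewrite sum_O, Nat.sub_0_r, !plus_INR, !mult_INR; simpl; field.
  - rewrite sum_Sn, IH by lia; unfold plus; cbn [AbelianMonoid.plus].
    rewrite !plus_INR, !mult_INR, minus_INR by lia.
    rewrite (S_INR m); change (INR 2) with 2; simpl; field. }
rewrite H by lia; match goal with |- @eq _ ?a ?b => change (@eq R a b) end; field.
Qed.

Lemma level_sum_const (z : C) (n : nat) :
  level_sum (fun _ => z) n = (RtoC (4 / 3 * ((INR n + 2) ^ 3 - (INR n + 2))) * z)%C.
Proof.
rewrite <- multiplicity_sum, <- sum_n_C_scal_r; apply sum_n_ext; intros p.
rewrite !sum_n_C_const; unfold plus; cbn [AbelianMonoid.plus].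
replace (S (2 * p + 1)) with (2 * p + 2)%nat by lia.
replace (S (2 * (n - p) + 1)) with (2 * (n - p) + 2)%nat by lia.
rewrite !RtoC_mult; simpl; ring.
Qed.

Lemma CSeries_tail_le (u : nat -> C) (A q : R) (m : nat) : 0 < q < 1 ->
  (forall n, Cmod (u n) <= A * q ^ n) ->
  Cmod (sum_n u m - CSeries u)%C <= 2 * A * / (1 - q) * q ^ S m.
Proof.
intros Hq Hu.
assert (Hg : is_series (fun n => q ^ n) (/ (1 - q)))
  by (apply is_series_geom; rewrite Rabs_pos_eq; lra).
assert (Hex : ex_series (fun n => A * q ^ n))
  by (apply (ex_series_scal (V := R_NormedModule)); eexists; exact Hg).
assert (Hc : abs_conv u) by (now apply abs_conv_le with (fun n => A * q ^ n)).
assert (E : (sum_n u m - CSeries u = - CSeries (fun n => u (S m + n)%nat))%C).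
{ pose proof (Series_incr_n (fun n => Re (u n)) (S m) ltac:(lia) (abs_conv_Re _ Hc)) as H1.
  pose proof (Series_incr_n (fun n => Im (u n)) (S m) ltac:(lia) (abs_conv_Im _ Hc)) as H2.
  rewrite <- sum_n_Reals in H1, H2; simpl pred in H1, H2.
  apply injective_projections; unfold CSeries;
    [change (Re (sum_n u m) + - Series (fun n => Re (u n)) = - Series (fun n => Re (u (S m + n)%nat)))
    |change (Im (sum_n u m) + - Series (fun n => Im (u n)) = - Series (fun n => Im (u (S m + n)%nat)))];
    rewrite ?Re_sum_n, ?Im_sum_n; lra. }
rewrite E, Cmod_opp.
assert (Hs : is_series (fun n => A * q ^ S m * q ^ n) (A * q ^ S m * / (1 - q)))
  by (apply (is_series_scal (V := R_NormedModule) (A * q ^ S m)); exact Hg).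
eapply Rle_trans; [apply Cmod_CSeries_le with (v := fun n => A * q ^ S m * q ^ n)|].
- intros n; eapply Rle_trans; [apply Hu|]; rewrite pow_add; lra.
- eexists; exact Hs.
- rewrite (is_series_unique _ _ Hs); lra.
Qed.

(** For fixed [j] and [m1] the sum over [m2] converges to [CSeries u] exponentially in [n - p], and
    there are [(n + 1) (n + 2)] pairs [(j, m1)]. The truncation errors form a geometric sum weighted
    by at most [2 (n + 1)], hence are [O(N)]. *)
Lemma level_sum_boundary (q : R) (g : Z -> C) (K : R) : 0 < q < 1 -> 0 <= K ->
  (forall b, (-1 <= b)%Z -> Cmod (g b) <= K * qh q b) ->
  exists B K', forall n,
    Cmod (level_sum (fun k => g (beta k)) n - RtoC ((INR n + 1) * (INR n + 2)) * B)%C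
    <= K' * (INR n + 2).
Proof.
intros Hq HK Hg.
set (u := fun b => (g (2 * Z.of_nat b + -1)%Z + g (2 * Z.of_nat b + -1)%Z)%C).
set (A := 2 * K * qh q (-1)).
assert (HA : 0 <= A) by (unfold A; pose proof (qh_pos q (-1)); nra).
assert (Hu : forall b, Cmod (u b) <= A * q ^ b).
{ intros b; eapply Rle_trans; [apply Cmod_triangle|].
  assert (H := Hg (2 * Z.of_nat b + -1)%Z ltac:(lia)).
  rewrite qh_add, qh_double in H by lra; unfold A; nra. }
assert (Hi : 0 < / (1 - q)) by (apply Rinv_0_lt_compat; lra).
set (D := 2 * A * / (1 - q)).
assert (HD : 0 <= D) by (unfold D; nra).
exists (CSeries u), (2 * D * / (1 - q)); intros n.
assert (Hn := pos_INR n).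
assert (E1 : level_sum (fun k => g (beta k)) n
             = sum_n (fun p => INR (2 * p + 2) * sum_n u (2 * (n - p) + 1))%C n).
{ apply sum_n_ext; intros p.
  replace (2 * p + 2)%nat with (S (2 * p + 1)) by lia.
  rewrite <- (sum_n_C_const (sum_n u (2 * (n - p) + 1)) (2 * p + 1)).
  apply sum_n_ext; intros a; apply sum_n_ext; intros b; now rewrite !beta_label_at. }
assert (E2 : (RtoC ((INR n + 1) * (INR n + 2)) * CSeries u
             = sum_n (fun p => INR (2 * p + 2) * CSeries u) n)%C).
{ rewrite sum_n_C_scal_r; f_equal; f_equal.
  clear; induction n as [|n IH]; [rewrite sum_O; simpl; ring|].
  rewrite sum_Sn, <- IH; unfold plus; cbn [AbelianMonoid.plus].
  rewrite plus_INR, mult_INR, S_INR; simpl; ring. }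
rewrite E1, E2.
assert (E3 : (sum_n (fun p => INR (2 * p + 2) * sum_n u (2 * (n - p) + 1)) n
             - sum_n (fun p => INR (2 * p + 2) * CSeries u) n
             = sum_n (fun p => INR (2 * p + 2) * (sum_n u (2 * (n - p) + 1) - CSeries u)) n)%C).
{ assert (H : forall v w : nat -> C, (sum_n v n - sum_n w n = sum_n (fun p => v p - w p) n)%C).
  { intros v w; clear; induction n as [|n IH]; [now rewrite !sum_O|].
    rewrite !sum_Sn, <- IH; unfold plus; simpl; ring. }
  rewrite H; apply sum_n_ext; intros p; C_ring. }
rewrite E3.
apply Rle_trans with (sum_n (fun p => 2 * (INR n + 1) * D * q ^ (n - p)) n).
- apply Cmod_sum_n_le; intros p Hp; rewrite Cmod_mult, Cmod_R, Rabs_pos_eq by apply pos_INR.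
  rewrite Rmult_assoc; apply Rmult_le_compat; try apply pos_INR; try apply Cmod_ge_0.
  + apply Rle_trans with (INR (2 * (n + 1))); [apply le_INR; lia|].
    rewrite mult_INR, plus_INR; simpl; lra.
  + eapply Rle_trans; [exact (CSeries_tail_le u A q _ Hq Hu)|].
    fold D; apply Rmult_le_compat_l; [exact HD|].
    replace (S (2 * (n - p) + 1)) with ((n - p) + ((n - p) + 2))%nat by lia.
    rewrite pow_add; assert (0 < q ^ (n - p)) by (apply pow_lt; lra).
    assert (q ^ (n - p + 2) <= 1) by (rewrite <- (pow1 (n - p + 2)); apply pow_incr; lra).
    nra.
- rewrite sum_n_R_scal; pose proof (geometric_reverse_sum_le q n Hq).
  apply Rle_trans with (2 * (INR n + 1) * D * / (1 - q)).
  + apply Rmult_le_compat_l; [|assumption].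
    apply Rmult_le_pos; [lra|exact HD].
  + assert (0 <= D * / (1 - q)) by (apply Rmult_le_pos; lra).
    replace (2 * (INR n + 1) * D * / (1 - q)) with (2 * (D * / (1 - q)) * (INR n + 1)) by ring.
    replace (2 * D * / (1 - q) * (INR n + 2)) with (2 * (D * / (1 - q)) * (INR n + 2)) by ring.
    apply Rmult_le_compat_l; lra.
Qed.

Lemma level_sum_asymptotics (q : R) (F : label -> C) (f : C) (g : Z -> C) (K : R) :
  0 < q < 1 -> 0 <= K ->
  (forall b, (-1 <= b)%Z -> Cmod (g b) <= K * qh q b) ->
  (forall k, admissible k = true -> Cmod (F k - f - g (beta k))%C <= K * weight q k) ->
  exists B K', forall n,
    Cmod (level_sum F n - RtoC (4 / 3) * f * RtoC ((INR n + 2) ^ 3) - B * RtoC ((INR n + 2) ^ 2))%C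
    <= K' * (INR n + 2).
Proof.
intros Hq HK Hg HF.
destruct (level_sum_boundary q g K Hq HK Hg) as (B & K1 & H1).
destruct (level_sum_weight_le q Hq) as (K2 & HK2 & H2).
exists B, (K * K2 + K1 + Cmod (RtoC (4 / 3) * f)%C + Cmod B); intros n.
set (N := INR n + 2); assert (HN : 0 <= N) by (unfold N; pose proof (pos_INR n); lra).
assert (E : level_sum F n = (level_sum (fun _ => f) n + level_sum (fun k => g (beta k)) n
                             + level_sum (fun k => F k - f - g (beta k)) n)%C).
{ rewrite <- (level_sum_plus (G := C_AbelianMonoid) (fun _ => f) (fun k => g (beta k))).
  rewrite <- (level_sum_plus (G := C_AbelianMonoid)).
  apply sum_n_ext; intros p; apply sum_n_ext; intros a; apply sum_n_ext; intros b.
  unfold plus; simpl; f_equal; ring. }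
rewrite E, level_sum_const; fold N.
replace (RtoC (4 / 3 * (N ^ 3 - N)) * f + level_sum (fun k => g (beta k)) n
         + level_sum (fun k => F k - f - g (beta k)) n
         - RtoC (4 / 3) * f * RtoC (N ^ 3) - B * RtoC (N ^ 2))%C
  with (level_sum (fun k => F k - f - g (beta k)) n
        + (level_sum (fun k => g (beta k)) n - RtoC ((INR n + 1) * N) * B)
        + - (RtoC (4 / 3) * f * N) + - (B * N))%C.
- specialize (H1 n); fold N in H1.
  assert (H3 : Cmod (level_sum (fun k => F k - f - g (beta k))%C n) <= K * K2 * N).
  { eapply Rle_trans; [apply Cmod_level_sum_le with (G := fun k => K * weight q k); exact HF|].
    rewrite level_sum_scal, Rmult_assoc; apply Rmult_le_compat_l; [exact HK|apply H2]. }
  eapply Rle_trans; [apply Cmod_triangle|].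
  eapply Rle_trans; [apply Rplus_le_compat_r, Cmod_triangle|].
  eapply Rle_trans; [apply Rplus_le_compat_r, Rplus_le_compat_r, Cmod_triangle|].
  rewrite !Cmod_opp, (Cmod_mult _ (RtoC N)), (Cmod_mult B), !(Cmod_R N), (Rabs_pos_eq N) by exact HN.
  lra.
- replace (INR n + 1) with (N - 1) by (unfold N; ring).
  replace (N ^ 2) with (N * N) by ring.
  rewrite !RtoC_mult, !RtoC_minus; ring.
Qed.

Definition diagonal_symbol (L : list term) : C :=
  fold_right (fun t z => ((if excluded_middle_informative (t_shift t = zero_displacement)
                           then t_symbol t else 0) + z)%C) 0%C L.

Lemma move_fixed (v : displacement) (k : label) : move v k = k -> v = zero_displacement.
Proof.
destruct k as [s l m1 m2 j], v as [e a b c d]; unfold move, zero_displacement.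
cbn [sh_flip sh_l sh_m1 sh_m2 sh_j chirality lab_l lab_m1 lab_m2 lab_j].
intros H; apply label_eq_inv in H; f_equal; try lia.
destruct H as [H _]; now destruct e, s.
Qed.

Lemma diagonal_expansion (q : R) (L : list term) : (forall t, In t L -> good q t) ->
  exists g K, 0 <= K /\ (forall b, (-1 <= b)%Z -> Cmod (g b) <= K * qh q b) /\
    forall k, admissible k = true ->
      Cmod (apply_terms L k k - diagonal_symbol L - g (beta k))%C <= K * weight q k.
Proof.
induction L as [|t L IH]; intros HL.
- exists (fun _ => 0%C), 0; split; [lra|split].
  + intros b _; rewrite Cmod_0; lra.
  + intros k _; simpl; replace (0 - 0 - 0)%C with (RtoC 0) by ring; rewrite Cmod_0; lra.
- destruct IH as (g & K & HK & Hg & HF); [intros t' Ht'; apply HL; now right|].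
  simpl; unfold vadd, vscal.
  destruct (excluded_middle_informative (t_shift t = zero_displacement)) as [E|N].
  + destruct (HL t (or_introl eq_refl)) as (g1 & K1 & HK1 & Hg1 & HF1 & _).
    exists (fun b => g1 b + g b)%C, (K1 + K); split; [lra|split].
    * intros b Hb; eapply Rle_trans; [apply Cmod_triangle|].
      specialize (Hg b Hb); specialize (Hg1 b Hb); lra.
    * intros k Hk; rewrite E, move_zero, ket_of_same by exact Hk; fold (apply_terms L k).
      replace (t_coef t k * 1 + apply_terms L k k - (t_symbol t + diagonal_symbol L)
               - (g1 (beta k) + g (beta k)))%C
        with ((t_coef t k - t_symbol t - g1 (beta k))
              + (apply_terms L k k - diagonal_symbol L - g (beta k)))%C by ring.
      eapply Rle_trans; [apply Cmod_triangle|].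
      specialize (HF k Hk).
      assert (A : adm2 (t_shift t) k) by (split; rewrite ?E, ?move_zero; exact Hk).
      specialize (HF1 k A); lra.
  + exists g, K; split; [exact HK|split; [exact Hg|]]; intros k Hk.
    rewrite ket_of_other; [|intros H; apply N; now apply move_fixed in H].
    fold (apply_terms L k).
    replace (t_coef t k * 0 + apply_terms L k k - (0 + diagonal_symbol L) - g (beta k))%C
      with (apply_terms L k k - diagonal_symbol L - g (beta k))%C by ring.
    now apply HF.
Qed.

(** The coefficients [a3], [a2] are those of [N^3] and [N^2] in the trace of [T] on the
    eigenspace of the absolute value of the Dirac operator for the eigenvalue [N = n + 2]. *)
Definition trace_growth (T : op) (a3 a2 : C) : Prop :=
  exists K, forall n,
    Cmod (level_sum (fun k => T (ket_of k) k) n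
          - a3 * RtoC ((INR n + 2) ^ 3) - a2 * RtoC ((INR n + 2) ^ 2))%C <= K * (INR n + 2).

Lemma level_sum_ext {G : AbelianMonoid} (E F : label -> G) (n : nat) :
  (forall k, admissible k = true -> E k = F k) -> level_sum E n = level_sum F n.
Proof.
intros H; apply sum_n_ext_loc; intros p Hp; apply sum_n_ext_loc; intros a Ha.
apply sum_n_ext_loc; intros b Hb; rewrite !H; try reflexivity; now apply label_at_admissible.
Qed.

Lemma good_terms_trace_growth (q : R) (T : op) (L : list term) : 0 < q < 1 ->
  good_terms q T L -> exists a2, trace_growth T (RtoC (4 / 3) * diagonal_symbol L)%C a2.
Proof.
intros Hq [HT HL]; destruct (diagonal_expansion q L HL) as (g & K & HK & Hg & HF).
destruct (level_sum_asymptotics q (fun k => T (ket_of k) k) (diagonal_symbol L) g K Hq HK Hg)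
  as (B & K' & H).
- intros k Hk; rewrite HT by exact Hk; now apply HF.
- exists B, K'; exact H.
Qed.

(** * The zeta functions *)

Lemma Re_level_sum (F : label -> C) (n : nat) : Re (level_sum F n) = level_sum (fun k => Re (F k)) n.
Proof.
unfold level_sum; rewrite Re_sum_n; apply sum_n_ext; intros p; rewrite Re_sum_n.
apply sum_n_ext; intros a; rewrite Re_sum_n; apply sum_n_ext; reflexivity.
Qed.

Lemma Im_level_sum (F : label -> C) (n : nat) : Im (level_sum F n) = level_sum (fun k => Im (F k)) n.
Proof.
unfold level_sum; rewrite Im_sum_n; apply sum_n_ext; intros p; rewrite Im_sum_n.
apply sum_n_ext; intros a; rewrite Im_sum_n; apply sum_n_ext; reflexivity.
Qed.

Lemma total_CSeries (F : label -> C) : total F = CSeries (level_sum F).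
Proof.
unfold total, CSeries; f_equal; apply Series_ext; intros n;
  [now rewrite Re_level_sum|now rewrite Im_level_sum].
Qed.

Lemma eigenvalue_label_at (s : bool) (n p a b : nat) : eigenvalue (label_at s n p a b) = INR n + 2.
Proof.
unfold eigenvalue, half, label_at; cbn [lab_l].
rewrite plus_IZR, mult_IZR, <- INR_IZR_INZ; field.
Qed.

Lemma level_sum_eigenvalue (w : R -> C) (d : label -> C) (n : nat) :
  level_sum (fun k => w (eigenvalue k) * d k)%C n = (w (INR n + 2)%R * level_sum d n)%C.
Proof.
unfold level_sum; rewrite <- (sum_n_C_scal (w (INR n + 2))); apply sum_n_ext; intros p.
rewrite <- (sum_n_C_scal (w (INR n + 2))); apply sum_n_ext; intros a.
rewrite <- (sum_n_C_scal (w (INR n + 2))); apply sum_n_ext; intros b.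
rewrite !eigenvalue_label_at; unfold plus; simpl; ring.
Qed.

Definition remainder (T : op) (a3 a2 : C) (n : nat) : C :=
  (level_sum (fun k => T (ket_of k) k) n
   - a3 * RtoC ((INR n + 2) ^ 3) - a2 * RtoC ((INR n + 2) ^ 2))%C.

Definition zeta_smooth (T : op) (a3 a2 : C) (s : C) : C :=
  (a3 * zeta_regular (s - 3) + a2 * zeta_regular (s - 2)
   + CSeries (fun n => remainder T a3 a2 n * cpower (INR n + 2) (- s)))%C.

(** The powers [N^3] and [N^2] shift the argument of the zeta function, moving its pole at 1 to 4
    and to 3. *)
Definition zeta_fun (T : op) (a3 a2 : C) (s : C) : C :=
  (a3 / (s - 4) + a2 / (s - 3) + zeta_smooth T a3 a2 s)%C.

Lemma zeta_smooth_cdiff (T : op) (a3 a2 s : C) :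
  trace_growth T a3 a2 -> 2 < Re s -> cdiff (zeta_smooth T a3 a2) s.
Proof.
intros [K HK] Hs; unfold zeta_smooth; apply cdiff_plus; [apply cdiff_plus|].
- apply cdiff_mult; [apply cdiff_const|].
  apply (cdiff_shift zeta_regular), zeta_regular_cdiff.
  rewrite re_plus, re_opp, re_RtoC; lra.
- apply cdiff_mult; [apply cdiff_const|].
  apply (cdiff_shift zeta_regular), zeta_regular_cdiff.
  rewrite re_plus, re_opp, re_RtoC; lra.
- now apply (dirichlet_cdiff (remainder T a3 a2) K).
Qed.

Definition diagonal_bounded (T : op) : Prop :=
  exists B, forall k, admissible k = true -> Cmod (T (ket_of k) k) <= B.

Lemma absD_power_ket (z : C) (k : label) :
  absD_power z (ket_of k) = vscal (cpower (eigenvalue k) z) (ket_of k).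
Proof. exact (inH_diagonal_ket (fun k' => cpower (eigenvalue k') z) k). Qed.

Lemma diagonal_absD_power (T : op) (z : C) (k : label) : lin_op T ->
  op_comp T (absD_power z) (ket_of k) k = (cpower (eigenvalue k) z * T (ket_of k) k)%C.
Proof.
intros (_ & _ & H); unfold op_comp; rewrite absD_power_ket, H by apply inH_ket; reflexivity.
Qed.

Lemma cpower_opp_minus_nat (x : R) (s : C) (m : nat) : 0 < x ->
  cpower x (- (s - RtoC (INR m))) = (cpower x (- s) * RtoC (x ^ m))%C.
Proof.
intros Hx; replace (- (s - RtoC (INR m)))%C with (- s + RtoC (INR m))%C by ring.
now rewrite cpower_plus, cpower_nat.
Qed.

(** Absolute summability cannot come from [trace_growth], which allows cancellation inside an
    eigenspace; it follows from bounded diagonal entries and multiplicities of order [N^3]. The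
    value comes from splitting each eigenspace trace into its two leading powers and the
    remainder. *)
Lemma trace_zeta (T : op) (a3 a2 s : C) : lin_op T -> diagonal_bounded T ->
  trace_growth T a3 a2 -> 4 < Re s -> is_trace (op_comp T (absD_power (- s))) (zeta_fun T a3 a2 s).
Proof.
intros HT [B HB] [K HK] Hs.
set (d := fun k => T (ket_of k) k) in *.
assert (Hpos : forall n, 0 < INR n + 2) by (intros n; pose proof (pos_INR n); lra).
assert (E : (fun k => op_comp T (absD_power (- s)) (ket_of k) k)
            = fun k => (cpower (eigenvalue k) (- s) * d k)%C)
  by (apply functional_extensionality; intros k; now apply diagonal_absD_power).
unfold is_trace; rewrite E; split.
- unfold absolutely_summable.
  assert (HB0 : 0 <= B).
  { eapply Rle_trans; [apply Cmod_ge_0|apply (HB (label_at true 0 0 0 0))]; reflexivity. }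
  apply ex_series_le_R with
    (fun n => B * (4 / 3) * Rpower (INR n + INR 2) (- (Re s - 3))).
  + intros n; split; [apply level_sum_ge_0; intros; apply Cmod_ge_0|].
    set (N := INR n + 2); assert (HN := Hpos n); fold N in HN.
    assert (E1 : level_sum (fun k => Cmod (cpower (eigenvalue k) (- s) * d k)%C) n
                 <= level_sum (fun _ => Rpower N (- Re s) * B) n).
    { unfold level_sum; apply sum_n_le; intros p Hp; apply sum_n_le; intros a Ha.
      apply sum_n_le; intros b Hb.
      assert (H1 : forall c, Cmod (cpower (eigenvalue (label_at c n p a b)) (- s)
                                   * d (label_at c n p a b))%C <= Rpower N (- Re s) * B).
      { intros c; rewrite Cmod_mult, Cmod_cpower, eigenvalue_label_at, re_opp; fold N.
        apply Rmult_le_compat_l; [apply Rlt_le, Rpower_pos|].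
        apply HB; now apply label_at_admissible. }
      exact (Rplus_le_compat _ _ _ _ (H1 true) (H1 false)). }
    eapply Rle_trans; [exact E1|].
    assert (E2 : forall x : R, level_sum (fun _ => x) n = 4 / 3 * (N ^ 3 - N) * x).
    { intros x; pose proof (Re_level_sum (fun _ => RtoC x) n) as H.
      rewrite level_sum_const in H; fold N in H.
      rewrite re_scal_l, re_RtoC in H; symmetry; exact H. }
    rewrite E2; change (INR 2) with 2; fold N.
    replace (- (Re s - 3)) with (INR 3 + - Re s) by (simpl; ring).
    rewrite Rpower_plus, Rpower_pow by exact HN.
    pose proof (Rpower_pos N (- Re s)).
    replace (4 / 3 * (N ^ 3 - N) * (Rpower N (- Re s) * B))
      with (B * (4 / 3) * Rpower N (- Re s) * (N ^ 3 - N)) by ring.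
    replace (B * (4 / 3) * (N ^ 3 * Rpower N (- Re s)))
      with (B * (4 / 3) * Rpower N (- Re s) * N ^ 3) by ring.
    apply Rmult_le_compat_l; [|lra]; repeat apply Rmult_le_pos; lra.
  + apply (ex_series_scal (V := R_NormedModule)), ex_series_Rpower_shift; lra.
- rewrite total_CSeries.
  assert (Re3 : 1 < Re (s - 3)) by (unfold Cminus; rewrite re_plus, re_opp, re_RtoC; lra).
  assert (Re2 : 1 < Re (s - 2)) by (unfold Cminus; rewrite re_plus, re_opp, re_RtoC; lra).
  assert (A3 := zeta_terms_abs_conv _ 1 Re3); assert (A2 := zeta_terms_abs_conv _ 1 Re2).
  change (INR 2) with 2 in A3, A2.
  assert (A1 : abs_conv (fun n => remainder T a3 a2 n * cpower (INR n + 2) (- s))%C).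
  { apply abs_conv_le with (fun n => K * Rpower (INR n + INR 2) (- (Re s - 1))).
    - intros n; rewrite Cmod_mult, Cmod_cpower, re_opp; change (INR 2) with 2.
      replace (- (Re s - 1)) with (1 + - Re s) by ring.
      rewrite Rpower_plus, Rpower_1 by apply Hpos.
      rewrite <- Rmult_assoc; apply Rmult_le_compat_r; [apply Rlt_le, Rpower_pos|apply HK].
    - apply (ex_series_scal (V := R_NormedModule)), ex_series_Rpower_shift; lra. }
  rewrite (CSeries_ext _ (fun n => (a3 * cpower (INR n + 2)%R (- (s - 3))
    + a2 * cpower (INR n + 2)%R (- (s - 2))) + remainder T a3 a2 n * cpower (INR n + 2)%R (- s))%C).
  + assert (B3 := abs_conv_scal a3 _ A3); assert (B2 := abs_conv_scal a2 _ A2).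
    rewrite (CSeries_plus _ _ (abs_conv_plus _ _ B3 B2) A1), (CSeries_plus _ _ B3 B2).
    rewrite (CSeries_scal a3 _ A3), (CSeries_scal a2 _ A2), !zeta_continuation by assumption.
    unfold zeta_fun, zeta_smooth, Cdiv.
    replace (s - 3 - 1)%C with (s - 4)%C by ring; replace (s - 2 - 1)%C with (s - 3)%C by ring; ring.
  + intros n; rewrite (level_sum_eigenvalue (fun x => cpower x (- s)) d n).
    assert (P3 := cpower_opp_minus_nat (INR n + 2) s 3 (Hpos n)).
    assert (P2 := cpower_opp_minus_nat (INR n + 2) s 2 (Hpos n)).
    replace (INR 3) with 3 in P3 by (simpl; ring); replace (INR 2) with 2 in P2 by (simpl; ring).
    rewrite P2, P3.
    unfold remainder; fold d; ring.
Qed.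

(** * Polar parts and residues *)

Definition holomorphic_near (F : C -> C) (p : C) : Prop :=
  exists e, 0 < e /\ forall t, Cmod (t - p)%C < e -> cdiff F t.

Lemma holomorphic_near_at (F : C -> C) (p : C) : holomorphic_near F p -> holomorphic_at F p.
Proof.
intros (e & He & H); apply locally_C_cmod with e; [exact He|].
intros t Ht; now apply cdiff_ex_derive, H.
Qed.

Lemma holomorphic_near_cdiff (F : C -> C) (p : C) : holomorphic_near F p -> cdiff F p.
Proof.
intros (e & He & H); apply H; replace (p - p)%C with (RtoC 0) by ring; now rewrite Cmod_0.
Qed.

Lemma holomorphic_near_plus (F G : C -> C) (p : C) : holomorphic_near F p ->
  holomorphic_near G p -> holomorphic_near (fun s => F s + G s)%C p.
Proof.
intros (e & He & H) (e' & He' & H'); exists (Rmin e e'); split; [now apply Rmin_pos|].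
intros t Ht; apply cdiff_plus;
  [apply H, Rlt_le_trans with (1 := Ht), Rmin_l|apply H', Rlt_le_trans with (1 := Ht), Rmin_r].
Qed.

Lemma holomorphic_near_mult (F G : C -> C) (p : C) : holomorphic_near F p ->
  holomorphic_near G p -> holomorphic_near (fun s => F s * G s)%C p.
Proof.
intros (e & He & H) (e' & He' & H'); exists (Rmin e e'); split; [now apply Rmin_pos|].
intros t Ht; apply cdiff_mult;
  [apply H, Rlt_le_trans with (1 := Ht), Rmin_l|apply H', Rlt_le_trans with (1 := Ht), Rmin_r].
Qed.

Lemma holomorphic_near_shift (F : C -> C) (p c : C) :
  holomorphic_near F (p + c)%C -> holomorphic_near (fun s => F (s + c)%C) p.
Proof.
intros (e & He & H); exists e; split; [exact He|]; intros t Ht; apply cdiff_shift, H.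
now replace (t + c - (p + c))%C with (t - p)%C by ring.
Qed.

Lemma holomorphic_near_const (c p : C) : holomorphic_near (fun _ => c) p.
Proof. exists 1; split; [lra|]; intros; apply cdiff_const. Qed.

Lemma holomorphic_near_id (p : C) : holomorphic_near (fun s => s) p.
Proof. exists 1; split; [lra|]; intros; apply cdiff_id. Qed.

Lemma holomorphic_near_polar (c z p : C) : p <> z -> holomorphic_near (fun s => c / (s - z))%C p.
Proof.
intros Hp; assert (H0 : 0 < Cmod (p - z)%C) by (now apply Cmod_gt_0, Cminus_eq_contra).
exists (Cmod (p - z)%C); split; [exact H0|]; intros t Ht.
apply cdiff_mult; [apply cdiff_const|].
apply (cdiff_shift Cinv), cdiff_inv; change (t + - z)%C with (t - z)%C; intros E.
assert (E' : t = z) by (apply Ceq_minus; exact E).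
rewrite E' in Ht; rewrite <- Cmod_opp in Ht.
replace (- (z - p))%C with (p - z)%C in Ht by ring; lra.
Qed.

Lemma zeta_smooth_holomorphic (T : op) (a3 a2 p : C) :
  trace_growth T a3 a2 -> 2 < Re p -> holomorphic_near (zeta_smooth T a3 a2) p.
Proof.
intros H Hp; exists (Re p - 2); split; [lra|]; intros t Ht.
apply zeta_smooth_cdiff; [exact H|].
pose proof (Re_le_abs_add p (t - p)%C) as Hr.
replace (p + (t - p))%C with t in Hr by ring; lra.
Qed.

(** The coefficient may be 0, so that one decomposition covers regular points as well as poles and
    also displays the residue. *)
Definition simple_polar (F : C -> C) (p c : C) : Prop :=
  exists G, holomorphic_near G p /\ forall s, F s = (G s + c / (s - p))%C.

Lemma simple_polar_zero (F : C -> C) (p : C) : simple_polar F p 0 -> holomorphic_near F p.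
Proof.
intros (G & (e & He & H) & E); exists e; split; [exact He|]; intros t Ht.
apply (cdiff_ext_loc G F t 1); [lra| |now apply H].
intros h _; rewrite E; unfold Cdiv; ring.
Qed.

Lemma simple_polar_pole (F : C -> C) (p c : C) : simple_polar F p c -> c <> 0%C ->
  pole_of_order F p 1.
Proof.
intros (G & H & E) Hc; split; [lia|].
exists (fun s => c + (s + - p) * G s)%C; split; [|split].
- apply holomorphic_near_at, holomorphic_near_plus; [apply holomorphic_near_const|].
  apply holomorphic_near_mult; [|exact H].
  apply holomorphic_near_plus; [apply holomorphic_near_id|apply holomorphic_near_const].
- replace (c + (p + - p) * G p)%C with c by ring; exact Hc.
- exists (mkposreal 1 Rlt_0_1); intros t _ Ht; rewrite E, Cpow_1_r.
  assert ((t - p)%C <> 0%C) by (now apply Cminus_eq_contra).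
  field; assumption.
Qed.

(** For [c = 0] the function is differentiable at [p], and [cdiff_not_pole] then excludes poles of
    every order; this is what bounds the dimension spectrum from above. *)
Lemma simple_polar_cases (F : C -> C) (p c : C) : simple_polar F p c ->
  (holomorphic_at F p \/ is_pole F p) /\
  (is_pole F p -> c <> 0%C /\ pole_of_order F p 1).
Proof.
intros H; destruct (Ceq_dec c 0) as [->|N].
- apply simple_polar_zero in H; split.
  + left; now apply holomorphic_near_at.
  + intros HP; exfalso; revert HP; now apply cdiff_not_pole, holomorphic_near_cdiff.
- assert (HP := simple_polar_pole F p c H N); split; [right; now exists 1%nat|now split].
Qed.

Lemma zeta_fun_polar (T : op) (a3 a2 p : C) : trace_growth T a3 a2 -> 2 < Re p ->
  exists c, simple_polar (zeta_fun T a3 a2) p c /\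
    (p = RtoC 4 -> c = a3) /\ (p = RtoC 3 -> c = a2) /\ (c <> 0%C -> p = RtoC 3 \/ p = RtoC 4).
Proof.
intros HT Hp; assert (Hs := zeta_smooth_holomorphic T a3 a2 p HT Hp).
assert (H34 : RtoC 3 <> RtoC 4) by (intros E; apply RtoC_inj in E; lra).
destruct (Ceq_dec p 4) as [E4|N4]; [|destruct (Ceq_dec p 3) as [E3|N3]].
- exists a3; repeat split; try tauto; [|intros E; congruence].
  exists (fun s => a2 / (s - 3) + zeta_smooth T a3 a2 s)%C; split.
  + apply holomorphic_near_plus; [apply holomorphic_near_polar; congruence|exact Hs].
  + intros s; unfold zeta_fun; rewrite E4; ring.
- exists a2; repeat split; try tauto.
  exists (fun s => a3 / (s - 4) + zeta_smooth T a3 a2 s)%C; split.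
  + apply holomorphic_near_plus; [now apply holomorphic_near_polar|exact Hs].
  + intros s; unfold zeta_fun; rewrite E3; ring.
- exists 0%C; repeat split; try tauto.
  exists (zeta_fun T a3 a2); split.
  + unfold zeta_fun; apply holomorphic_near_plus; [|exact Hs].
    apply holomorphic_near_plus; now apply holomorphic_near_polar.
  + intros s; unfold Cdiv; ring.
Qed.

(** * Uniqueness of the growth coefficients, and elements realizing both poles *)

Lemma linear_growth_bound (c K : R) (m : nat) : 0 <= c -> (0 < m)%nat ->
  (forall n, c * (INR n + 2) ^ S m <= K * (INR n + 2)) -> c = 0.
Proof.
intros Hc Hm H; destruct (Rle_lt_or_eq_dec 0 c Hc) as [Hp|]; [exfalso|auto].
destruct (INR_unbounded (K / c)) as [n Hn]; specialize (H n).
assert (HN : 1 <= INR n + 2) by (pose proof (pos_INR n); lra).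
assert (H1 : INR n + 2 <= (INR n + 2) ^ m).
{ rewrite <- (pow_1 (INR n + 2)) at 1; now apply Rle_pow. }
simpl pow in H.
assert (H2 : c * (INR n + 2) <= K).
{ apply Rmult_le_reg_r with (INR n + 2); [lra|].
  apply Rle_trans with (c * ((INR n + 2) * (INR n + 2) ^ m)); [|exact H].
  rewrite Rmult_assoc; apply Rmult_le_compat_l; [lra|]; apply Rmult_le_compat_l; lra. }
apply Rmult_gt_compat_r with (r := c) in Hn; [|exact Hp].
replace (K / c * c) with K in Hn by (field; lra); lra.
Qed.

Lemma growth_zero (x y : C) (K : R) :
  (forall n, Cmod (x * RtoC ((INR n + 2) ^ 3) + y * RtoC ((INR n + 2) ^ 2))%C <= K * (INR n + 2)) ->
  x = 0%C /\ y = 0%C.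
Proof.
intros H.
assert (Hc : forall n, Cmod (RtoC ((INR n + 2) ^ 3)) = (INR n + 2) ^ 3 /\
                       Cmod (RtoC ((INR n + 2) ^ 2)) = (INR n + 2) ^ 2).
{ intros n; pose proof (pos_INR n); rewrite !Cmod_R, !Rabs_pos_eq by (apply pow_le; lra); auto. }
assert (Hx : x = 0%C).
{ apply Cmod_eq_0, (linear_growth_bound _ (2 * (K + Cmod y)) 1); [apply Cmod_ge_0|lia|].
  intros n; specialize (H n); destruct (Hc n) as [E3 E2].
  set (N := INR n + 2) in *; assert (HN : 2 <= N) by (unfold N; pose proof (pos_INR n); lra).
  pose proof (Cmod_minus_ge (x * RtoC (N ^ 3)) (- (y * RtoC (N ^ 2)))) as H1.
  replace (x * RtoC (N ^ 3) - - (y * RtoC (N ^ 2)))%C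
    with (x * RtoC (N ^ 3) + y * RtoC (N ^ 2))%C in H1 by ring.
  rewrite Cmod_opp, !Cmod_mult, E3, E2 in H1.
  pose proof (Cmod_ge_0 x) as Hx0; pose proof (Cmod_ge_0 y) as Hy0.
  assert (H2 : Cmod x * N ^ 3 <= K * N + Cmod y * N ^ 2) by lra.
  assert (H3 : 0 <= K).
  { apply Rmult_le_reg_r with N; [lra|]; rewrite Rmult_0_l.
    eapply Rle_trans; [apply Cmod_ge_0|exact H]. }
  assert (H4 : Cmod x * N ^ 2 <= K + Cmod y * N).
  { apply Rmult_le_reg_r with N; [lra|].
    replace (Cmod x * N ^ 2 * N) with (Cmod x * N ^ 3) by ring.
    replace ((K + Cmod y * N) * N) with (K * N + Cmod y * N ^ 2) by ring; exact H2. }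
  assert (0 <= K * N) by (apply Rmult_le_pos; lra).
  assert (0 <= Cmod y * N) by (apply Rmult_le_pos; lra).
  assert (K <= K * N) by nra.
  lra. }
split; [exact Hx|].
apply Cmod_eq_0, (linear_growth_bound _ K 1); [apply Cmod_ge_0|lia|].
intros n; specialize (H n); destruct (Hc n) as [E3 E2].
rewrite Hx in H; replace (0 * RtoC ((INR n + 2) ^ 3) + y * RtoC ((INR n + 2) ^ 2))%C
  with (y * RtoC ((INR n + 2) ^ 2))%C in H by ring.
now rewrite Cmod_mult, E2 in H.
Qed.

(** The theorem selects the coefficients by a choice operator; uniqueness identifies them with the
    ones computed for particular elements. *)
Lemma trace_growth_unique (T : op) (a3 a2 b3 b2 : C) :
  trace_growth T a3 a2 -> trace_growth T b3 b2 -> a3 = b3 /\ a2 = b2.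
Proof.
intros [K HK] [K' HK'].
destruct (growth_zero (a3 - b3) (a2 - b2) (K' + K)) as [E3 E2].
- intros n; specialize (HK n); specialize (HK' n).
  set (L := level_sum (fun k => T (ket_of k) k) n) in *.
  set (N3 := RtoC ((INR n + 2) ^ 3)) in *; set (N2 := RtoC ((INR n + 2) ^ 2)) in *.
  replace ((a3 - b3) * N3 + (a2 - b2) * N2)%C
    with ((L - b3 * N3 - b2 * N2) - (L - a3 * N3 - a2 * N2))%C by ring.
  eapply Rle_trans; [apply Cmod_minus_le|lra].
- split; apply Ceq_minus; assumption.
Qed.

Lemma Psi0_algebra (q : R) (pi : star_poly -> op) (a : star_poly) :
  spinor_representation q pi -> Psi0 pi (pi a).
Proof.
intros Hpi; apply Psi0_gen with O (pi a); [exists a; left; intros f _; reflexivity|].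
split; [|split]; [apply (rep_bounded q pi Hpi)..|intros f _; reflexivity].
Qed.

Lemma trace_growth_scalar_one (q : R) (pi : star_poly -> op) : spinor_representation q pi ->
  trace_growth (pi (Scalar 1)) (RtoC (4 / 3)) 0.
Proof.
intros Hpi; exists (4 / 3); intros n.
assert (E : level_sum (fun k => pi (Scalar 1) (ket_of k) k) n = level_sum (fun _ => RtoC 1) n).
{ apply level_sum_ext; intros k Hk; rewrite (rep_scalar q pi Hpi 1%C (ket_of k) (inH_ket k)).
  unfold vscal; rewrite ket_of_same by exact Hk; C_ring. }
rewrite E, level_sum_const; set (N := INR n + 2).
replace (RtoC (4 / 3 * (N ^ 3 - N)) * 1 - RtoC (4 / 3) * RtoC (N ^ 3) - 0 * RtoC (N ^ 2))%C
  with (RtoC (- (4 / 3 * N))) by (rewrite RtoC_opp, !RtoC_mult, RtoC_minus; ring).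
rewrite Cmod_R, Rabs_Ropp, Rabs_pos_eq; [lra|].
unfold N; pose proof (pos_INR n); lra.
Qed.

(** [beta k = -1] says that [m2] takes its lowest value [- (l + 1/2 - j)]. *)
Lemma BC_lower_bound (q : R) (k : label) : 0 < q < 1 -> admissible k = true -> beta k = (-1)%Z ->
  (1 - q) ^ 4 <= Rabs (B_p q (lab_j k) (lab_m1 k) * C_p q (lab_l k) (lab_j k) (lab_m2 k)).
Proof.
intros Hq Hk Hb; destruct (admissible_half k Hk) as (H1 & H2 & H3).
assert (Ha := half_alpha k).
destruct (C_p_eq q k Hq Hk) as (x & y & Hx & Hy & ->); rewrite B_p_eq by assumption.
replace (BC_limit q (beta k)) with (- (1)).
- assert (0 <= (1 - q) ^ 2) by apply pow2_ge_0.
  replace ((1 - q) ^ 4) with ((1 - q) ^ 2 * (1 - q) ^ 2) by ring.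
  rewrite Rabs_mult; apply Rmult_le_compat; try assumption.
  + eapply Rle_trans; [|apply Rle_abs]; apply root_ratio_ge; lra.
  + rewrite Ropp_mult_distr_l_reverse, Rmult_1_l, Rabs_Ropp.
    eapply Rle_trans; [|apply Rle_abs]; apply root_ratio_ge; lra.
- unfold BC_limit; rewrite Hb; replace (half (-1) - eps_beta (-1)) with 0.
  + now rewrite Rpower_O by lra.
  + unfold half, eps_beta; simpl; field.
Qed.

Lemma norm_sq_ge (f : vec) (k : label) : inH f -> admissible k = true ->
  Cmod (f k) ^ 2 <= norm_sq f.
Proof.
intros [_ Hf] Hk; unfold norm_sq.
set (F := fun k' => if excluded_middle_informative (k' = k) then Cmod (f k') ^ 2 else 0).
assert (HF : F k = Cmod (f k) ^ 2) by (unfold F; now destruct (excluded_middle_informative (k = k))).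
rewrite <- HF, <- (is_series_unique (level_sum F) (F k)).
- apply Series_le; [|exact Hf]; intros n; split.
  + apply level_sum_ge_0; intros k' _; unfold F.
    destruct (excluded_middle_informative _); [apply pow2_ge_0|lra].
  + apply level_sum_le; intros k' _; unfold F.
    destruct (excluded_middle_informative _); [lra|apply pow2_ge_0].
- apply is_series_level_single; [exact Hk|]; intros k' _ N; unfold F.
  now destruct (excluded_middle_informative (k' = k)).
Qed.

(** An element of vanishing symbol whose diagonal entries stay bounded below at the lowest value of
    [m2]: its trace on the eigenspaces grows quadratically, which produces the pole at 3. *)
Definition x1_norm : star_poly := Mul (Star (Gen X1)) (Gen X1).

Lemma inner_self (f : vec) : inner f f = RtoC (norm_sq f).
Proof.
unfold inner, total, norm_sq; apply injective_projections; cbn [fst snd RtoC].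
- apply Series_ext; intros n; apply (level_sum_ext (G := R_AbelianMonoid)); intros k _.
  rewrite Cmod2_alt; unfold Cconj, Re, Im; simpl; ring.
- rewrite (Series_ext _ (fun _ => 0)).
  + apply is_series_unique, filterlim_ext with (fun _ : nat => 0).
    * intros n; rewrite sum_n_const; ring.
    * apply filterlim_const.
  + intros n; apply (level_sum_zero (G := R_AbelianMonoid)); intros k _ _.
    rewrite im_mult, re_conj, im_conj; change (Re (f k) * Im (f k) + - Im (f k) * Re (f k) = 0); ring.
Qed.

(** Being squared norms, the diagonal entries are nonnegative, so no cancellation can hide those at
    the lowest [m2]. *)
Lemma x1_norm_diagonal (q : R) (pi : star_poly -> op) (k : label) :
  spinor_representation q pi -> admissible k = true ->
  pi x1_norm (ket_of k) k = RtoC (norm_sq (pi (Gen X1) (ket_of k))).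
Proof.
intros Hpi Hk; unfold x1_norm; rewrite (rep_mul q pi Hpi _ _ (ket_of k) (inH_ket k)); unfold op_comp.
set (f := pi (Gen X1) (ket_of k)).
assert (Hf : inH f) by (apply (rep_bounded q pi Hpi), inH_ket).
assert (H := rep_star q pi Hpi (Gen X1) f (ket_of k) Hf (inH_ket k)).
fold f in H; rewrite inner_self in H; unfold inner in H.
rewrite (total_single _ k Hk), ket_of_same in H by
  (try exact Hk; intros k' N; rewrite (ket_of_other k) by congruence; ring).
rewrite <- (Cconj_conj (pi (Star (Gen X1)) f k)).
rewrite <- (Cmult_1_r (Cconj (pi (Star (Gen X1)) f k))), H.
unfold Cconj, RtoC; simpl; f_equal; ring.
Qed.

(** It suffices to look at the coordinate along the leading shift of [x1], whose modulus is at least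
    [(1 - q)^4]; the exponent doubles on squaring. *)
Lemma x1_norm_lower_bound (q : R) (pi : star_poly -> op) (k : label) : 0 < q < 1 ->
  spinor_representation q pi -> admissible k = true -> beta k = (-1)%Z ->
  (1 - q) ^ 8 <= norm_sq (pi (Gen X1) (ket_of k)).
Proof.
intros Hq Hpi Hk Hb.
set (v := Displacement false 1 1 0 1).
assert (Hv : admissible (move v k) = true).
{ destruct k as [s l m1 m2 j]; unfold v; rewrite move_label.
  apply admissible_coordinates in Hk; destruct Hk as (n & p & a & b & H).
  apply admissible_coordinates; exists (n + 1)%Z, (p + 1)%Z, (a + 2)%Z, b; lia. }
assert (Hf : inH (pi (Gen X1) (ket_of k))) by (apply (rep_bounded q pi Hpi), inH_ket).
eapply Rle_trans; [|apply (norm_sq_ge _ (move v k) Hf Hv)].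
rewrite (represents_x1 q pi Hpi k Hk).
assert (E : apply_terms (x1_terms q) k (move v k)
            = RtoC (B_p q (lab_j k) (lab_m1 k) * C_p q (lab_l k) (lab_j k) (lab_m2 k))).
{ unfold x1_terms, apply_terms, real_term; cbv zeta; cbn [fold_right t_coef t_shift].
  unfold vadd, vscal; fold v; rewrite (ket_of_same (move v k) Hv).
  rewrite !ket_of_other; [ring|..]; intros E; unfold v, move in E;
    cbn [sh_flip sh_l sh_m1 sh_m2 sh_j] in E; apply label_eq_inv in E; lia. }
rewrite E, Cmod_R.
pose proof (BC_lower_bound q k Hq Hk Hb) as H.
replace ((1 - q) ^ 8) with (((1 - q) ^ 4) ^ 2) by ring.
apply pow_incr; split; [|exact H]; apply pow_le; lra.
Qed.

(** Every pair [(j, m1)] has a lowest [m2] in each chirality, so the eigenspace trace is at least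
    [c] times twice the number of pairs. This quadratic growth rules out that both coefficients
    vanish. *)
Lemma x1_norm_trace_growth (q : R) (pi : star_poly -> op) (a3 a2 : C) : 0 < q < 1 ->
  spinor_representation q pi -> trace_growth (pi x1_norm) a3 a2 -> a3 <> 0%C \/ a2 <> 0%C.
Proof.
intros Hq Hpi [K HK]; destruct (Ceq_dec a3 0) as [->|]; [right|now left]; intros ->.
set (c := (1 - q) ^ 8); assert (Hc : 0 < c) by (apply pow_lt; lra).
enough (c = 0) by lra.
apply (linear_growth_bound c K 1); [lra|lia|]; intros n.
eapply Rle_trans; [|apply HK].
set (L := level_sum (fun k => pi x1_norm (ket_of k) k) n : C).
replace (L - 0 * RtoC ((INR n + 2) ^ 3) - 0 * RtoC ((INR n + 2) ^ 2))%C with L by ring.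
apply Rle_trans with (Re L); [|pose proof (re_le_Cmod L); pose proof (Rle_abs (Re L)); lra].
unfold L; rewrite Re_level_sum.
apply Rle_trans with (level_sum (fun k => if (beta k =? -1)%Z then c else 0) n).
- assert (E : level_sum (G := R_AbelianMonoid) (fun k => if (beta k =? -1)%Z then c else 0) n
              = sum_n (G := R_AbelianMonoid) (fun p => 4 * c * INR (S p)) n).
  { apply sum_n_ext; intros p.
    rewrite (sum_n_ext (G := R_AbelianMonoid) _ (fun _ => 2 * c)).
    - rewrite sum_n_const; replace (S (2 * p + 1)) with (2 * S p)%nat by lia.
      rewrite mult_INR; change (INR 2) with 2.
      match goal with |- @eq _ ?x ?y => change (@eq R x y) end; ring.
    - intros a; rewrite (sum_n_single _ _ O); [rewrite !beta_label_at; change (c + c = 2 * c); ring|lia|].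
      intros b _ Hb; rewrite !beta_label_at.
      destruct (Z.eqb_spec (2 * Z.of_nat b + -1) (-1)); [lia|].
      change (0 + 0 = 0); ring. }
  rewrite E, sum_n_R_scal.
  assert (E' : sum_n (fun p => INR (S p)) n = (INR n + 1) * (INR n + 2) / 2).
  { clear; induction n as [|n IH]; [rewrite sum_O; simpl; field|].
    rewrite sum_Sn, IH, !S_INR; unfold plus; cbn [AbelianMonoid.plus]; simpl; field. }
  (* The lower bound is [2 * c * (n + 1) * (n + 2)], which exceeds [c * (n + 2)^2]. *)
  rewrite E'; pose proof (pos_INR n); simpl pow; nra.
- apply level_sum_le; intros k Hk; rewrite (x1_norm_diagonal q) by assumption; rewrite re_RtoC.
  destruct (Z.eqb_spec (beta k) (-1)) as [Hb|_]; [now apply x1_norm_lower_bound|].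
  eapply Rle_trans; [apply (pow2_ge_0 (Cmod (pi (Gen X1) (ket_of k) k)))|].
  apply norm_sq_ge; [|exact Hk]; apply (rep_bounded q pi Hpi), inH_ket.
Qed.

(** * The integral over the circle *)

Lemma cis_period (d : Z) : cis (IZR d * (2 * PI)) = 1%C.
Proof.
assert (H : forall m : nat, cis (INR m * (2 * PI)) = 1%C).
{ intros m; unfold cis; replace (INR m * (2 * PI)) with (0 + 2 * INR m * PI) by ring.
  rewrite cos_period, sin_period, cos_0, sin_0; reflexivity. }
destruct (Z_le_dec 0 d) as [Hd|Hd].
- rewrite <- (Z2Nat.id d Hd), <- INR_IZR_INZ; apply H.
- replace (IZR d) with (- INR (Z.to_nat (- d))).
  + rewrite Ropp_mult_distr_l_reverse, cis_conj, H; apply Cconj_1.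
  + rewrite INR_IZR_INZ, Z2Nat.id, opp_IZR by lia; ring.
Qed.

Definition is_CRInt (f : R -> C) (I : C) : Prop :=
  is_RInt (V := C_R_NormedModule) f 0 (2 * PI) I.

Lemma is_CRInt_cis (c : C) (d : Z) :
  is_CRInt (fun theta => c * cis (IZR d * theta))%C
    (if Z.eqb d 0 then RtoC (2 * PI) * c else 0)%C.
Proof.
destruct (Z.eqb_spec d 0) as [->|Hd].
- apply (is_RInt_ext (V := C_R_NormedModule) (fun _ => c)).
  + intros x _; rewrite Rmult_0_l, cis_0; C_ring.
  + replace (RtoC (2 * PI) * c)%C with (scal (V := C_R_NormedModule) (2 * PI - 0) c).
    * apply (is_RInt_const (V := C_R_NormedModule)).
    * rewrite Rminus_0_r; apply scal_R_Cmult.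
- assert (Hd' : IZR d <> 0) by (intros E; now apply eq_IZR in E).
  (* The primitive [cis (d * theta) / (i * d)] in components; its periodicity makes the integral
     vanish. *)
  set (F := fun theta => (c * (/ IZR d * (sin (IZR d * theta), - cos (IZR d * theta))%R))%C).
  assert (HF : forall t, is_Cderive F t (c * cis (IZR d * t))%C).
  { intros t; split; unfold F, cis; simpl; auto_derive; try exact I; field; exact Hd'. }
  assert (E : F (2 * PI) = F 0).
  { pose proof (cis_period d) as H; unfold cis, RtoC in H; injection H as H1 H2.
    unfold F; now rewrite H1, H2, Rmult_0_r, sin_0, cos_0. }
  replace (RtoC 0) with (Re (F (2 * PI)) - Re (F 0), Im (F (2 * PI)) - Im (F 0))
    by (rewrite E; unfold RtoC; f_equal; ring).
  apply (is_RInt_fct_extend_pair (U := R_NormedModule) (V := R_NormedModule)).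
  + apply (is_RInt_derive (V := R_CompleteNormedModule) (fun t => Re (F t))).
    * intros t _; apply HF.
    * intros t _; apply (ex_derive_continuous (V := R_NormedModule)); unfold cis; simpl.
      auto_derive; exact I.
  + apply (is_RInt_derive (V := R_CompleteNormedModule) (fun t => Im (F t))).
    * intros t _; apply HF.
    * intros t _; apply (ex_derive_continuous (V := R_NormedModule)); unfold cis; simpl.
      auto_derive; exact I.
Qed.

(** The integral over the circle selects the terms with [sh_l = 0], the trace those with trivial
    shift. For a nonzero symbol both agree, since [main] and [sh_j = 0] express the whole
    displacement through [sh_l]. *)
Lemma symbol_nonzero_shift (q : R) (t : term) : good q t -> chirally_symmetric q t ->
  sh_l (t_shift t) = 0%Z -> t_symbol t <> 0%C -> t_shift t = zero_displacement.
Proof.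
intros (g & K & _ & _ & _ & Hm & Hj) [Hflip _] Hl Hf.
destruct Hm as [[M1 M2]|[Hf' _]]; [|contradiction].
destruct Hj as [Hj|Hj]; [contradiction|].
destruct (t_shift t) as [e a b c d]; simpl in *; unfold zero_displacement; f_equal; [assumption|lia..].
Qed.

Lemma is_CRInt_symbol_sum (q : R) (L : list term) :
  (forall t, In t L -> good q t /\ chirally_symmetric q t) ->
  is_CRInt (symbol_sum L) (RtoC (2 * PI) * diagonal_symbol L)%C.
Proof.
induction L as [|t L IH]; intros HL.
- replace (RtoC (2 * PI) * diagonal_symbol nil)%C
    with (scal (V := C_R_NormedModule) (2 * PI - 0) (RtoC 0)).
  + apply (is_RInt_const (V := C_R_NormedModule)).
  + rewrite scal_R_Cmult; simpl; ring.
- assert (HL' : forall t, In t L -> good q t /\ chirally_symmetric q t) by (intros; apply HL; now right).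
  specialize (IH HL'); destruct (HL t (or_introl eq_refl)) as [G S].
  assert (H := is_RInt_plus (V := C_R_NormedModule) _ _ _ _ _ _
                 (is_CRInt_cis (t_symbol t) (sh_l (t_shift t))) IH).
  replace (RtoC (2 * PI) * diagonal_symbol (t :: L))%C
    with ((if Z.eqb (sh_l (t_shift t)) 0 then RtoC (2 * PI) * t_symbol t else 0)
          + RtoC (2 * PI) * diagonal_symbol L)%C.
  + exact H.
  + simpl.
    destruct (excluded_middle_informative (t_shift t = zero_displacement)) as [E|N].
    * rewrite E; simpl; ring.
    * destruct (Z.eqb_spec (sh_l (t_shift t)) 0) as [E0|_]; [|ring].
      destruct (Ceq_dec (t_symbol t) 0) as [->|Nf]; [ring|].
      exfalso; apply N; now apply (symbol_nonzero_shift q).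
Qed.

Lemma RInt_classical_points (q : R) (pi : star_poly -> op) (a : star_poly) (L : list term) :
  algebra_terms q pi a L ->
  RInt (V := C_R_CompleteNormedModule) (classical_points a) 0 (2 * PI)
  = (RtoC (2 * PI) * diagonal_symbol L)%C.
Proof.
intros (_ & H1 & H2); apply (is_RInt_unique (V := C_R_CompleteNormedModule)).
apply (is_RInt_ext (V := C_R_NormedModule) (symbol_sum L)).
- intros x _; symmetry; apply H2.
- exact (is_CRInt_symbol_sum q L H1).
Qed.

Lemma good_terms_diagonal_bounded (q : R) (T : op) (L : list term) : 0 < q < 1 ->
  good_terms q T L -> diagonal_bounded T.
Proof.
intros Hq [HT HL]; destruct (diagonal_expansion q L HL) as (g & K & HK & Hg & HF).
exists (K * (1 + qh q (-1)) + Cmod (diagonal_symbol L) + K * qh q (-1)).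
intros k Hk; rewrite HT by exact Hk.
replace (apply_terms L k k) with ((apply_terms L k k - diagonal_symbol L - g (beta k))
  + diagonal_symbol L + g (beta k))%C by ring.
eapply Rle_trans; [apply Cmod_triangle|].
eapply Rle_trans; [apply Rplus_le_compat_r, Cmod_triangle|].
destruct (admissible_bounds k Hk) as (_ & _ & Hb).
repeat apply Rplus_le_compat.
- eapply Rle_trans; [now apply HF|]; apply Rmult_le_compat_l; [exact HK|now apply weight_le].
- lra.
- eapply Rle_trans; [now apply Hg|]; apply Rmult_le_compat_l; [exact HK|now apply qh_beta_le].
Qed.

Lemma is_trace_ext (T S : op) (t : C) :
  (forall k, T (ket_of k) k = S (ket_of k) k) -> is_trace T t -> is_trace S t.
Proof.
intros H; unfold is_trace.
now replace (fun k => S (ket_of k) k) with (fun k => T (ket_of k) k)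
  by (apply functional_extensionality; exact H).
Qed.

Lemma zeta_fun_extension (T : op) (a3 a2 : C) : lin_op T -> diagonal_bounded T ->
  trace_growth T a3 a2 -> zeta_extension 2 4 T (zeta_fun T a3 a2).
Proof.
intros HT HB HG; split.
- intros p Hp; destruct (zeta_fun_polar T a3 a2 p HG Hp) as (c & Hc & _).
  apply (simple_polar_cases _ _ _ Hc).
- intros s Hs; now apply trace_zeta.
Qed.

Lemma zeta_fun_shift_polar (T : op) (a3 a2 p : C) : trace_growth T a3 a2 -> -2 < Re p ->
  exists c, simple_polar (fun s => zeta_fun T a3 a2 (s + 4)%C) p c /\ (p = 0%C -> c = a3).
Proof.
intros HG Hp.
assert (Hp4 : 2 < Re (p + 4)%C) by (rewrite re_plus, re_RtoC; lra).
destruct (zeta_fun_polar T a3 a2 _ HG Hp4) as (c & (G & HG' & E) & H4 & _).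
exists c; split.
- exists (fun s => G (s + 4)%C); split; [now apply holomorphic_near_shift|].
  intros s; rewrite E; now replace (s + 4 - (p + 4))%C with (s - p)%C by ring.
- intros ->; apply H4; ring.
Qed.

Lemma zeta_fun_shift_extension (T : op) (a3 a2 : C) : lin_op T -> diagonal_bounded T ->
  trace_growth T a3 a2 ->
  zeta_extension (-2) 0 (op_comp T (absD_power (RtoC (-4)))) (fun s => zeta_fun T a3 a2 (s + 4)%C).
Proof.
intros HT HB HG; split.
- intros p Hp; destruct (zeta_fun_shift_polar T a3 a2 p HG Hp) as (c & Hc & _).
  apply (simple_polar_cases _ _ _ Hc).
- intros s Hs.
  assert (Hs4 : 4 < Re (s + 4)%C) by (rewrite re_plus, re_RtoC; lra).
  apply is_trace_ext with (2 := trace_zeta T a3 a2 _ HT HB HG Hs4).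
  intros k; rewrite diagonal_absD_power by exact HT.
  unfold op_comp; rewrite absD_power_ket.
  replace (absD_power (RtoC (-4)) (vscal (cpower (eigenvalue k) (- s)) (ket_of k)))
    with (vscal (cpower (eigenvalue k) (- (s + 4))) (ket_of k)).
  + destruct HT as (_ & _ & H); rewrite H by apply inH_ket; reflexivity.
  + rewrite <- (absD_power_ket (- (s + 4))).
    apply functional_extensionality; intros k'; unfold absD_power, vscal.
    destruct (excluded_middle_informative (k = k')) as [->|N].
    * replace (- (s + 4))%C with (RtoC (-4) + - s)%C; [rewrite cpower_plus; ring|].
      replace (RtoC (-4)) with (- (4))%C by (rewrite <- RtoC_opp; f_equal; ring); ring.
    * rewrite ket_of_other by exact N; ring.
Qed.

Lemma simple_polar_residue (F : C -> C) (p c : C) : simple_polar F p c -> is_residue F p c.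
Proof.
intros (G & HG & E); exists G, O, (fun _ => 0%C); split; [now apply holomorphic_near_at|].
exists (mkposreal 1 Rlt_0_1); intros t _ _; rewrite E, sum_O; unfold Cdiv; ring.
Qed.

Theorem proposition8p3 (q : R) (hq : 0 < q < 1) (pi : star_poly -> op)
    (hpi : spinor_representation q pi) :
  (exists Z : op -> C -> C,
     (forall T, Psi0 pi T -> zeta_extension 2 4 T (Z T)) /\
     (forall p : C,
        dimension_spectrum pi Z 2 p <-> p = RtoC 3 \/ p = RtoC 4) /\
     (forall (T : op) (p : C), Psi0 pi T -> 2 < Re p -> is_pole (Z T) p ->
        pole_of_order (Z T) p 1)) /\
  (forall a : star_poly,
     exists F : C -> C,
       zeta_extension (-2) 0 (op_comp (pi a) (absD_power (RtoC (-4)))) F /\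
       is_residue F (RtoC 0)
         (RtoC (2 / (3 * PI)) *
          RInt (V := C_R_CompleteNormedModule) (classical_points a) 0 (2 * PI))%C).
Proof.
assert (Halg := algebra_terms_exist q pi hq hpi (fun x => algebra_terms_gen q pi x hq hpi)).
assert (HPsi : forall T, Psi0 pi T -> lin_op T /\ diagonal_bounded T /\
                 exists a, trace_growth T (fst a) (snd a)).
{ intros T HT; destruct (Psi0_good_terms q pi hq Halg T HT) as (Hlin & L & HL).
  destruct (good_terms_trace_growth q T L hq HL) as (a2 & Ha).
  split; [exact Hlin|split; [now apply good_terms_diagonal_bounded with q L|]].
  now exists (RtoC (4 / 3) * diagonal_symbol L, a2)%C. }
assert (Hgrowth : forall a L, algebra_terms q pi a L ->
          exists a2, trace_growth (pi a) (RtoC (4 / 3) * diagonal_symbol L)%C a2).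
{ intros a L (H1 & H2 & _); apply (good_terms_trace_growth q); [exact hq|].
  split; [exact H1|intros t Ht; now apply H2]. }
split.
(* [Z] has to be a function of the operator, while growth coefficients are only known to exist; the
   default pair matters only outside Psi^0. *)
- set (gr := fun T => epsilon (inhabits (RtoC 0, RtoC 0))
                        (fun a => trace_growth T (fst a) (snd a))).
  assert (Hgr : forall T, Psi0 pi T -> trace_growth T (fst (gr T)) (snd (gr T))).
  { intros T HT; unfold gr; apply epsilon_spec, HPsi, HT. }
  exists (fun T => zeta_fun T (fst (gr T)) (snd (gr T))); split; [|split].
  + intros T HT; destruct (HPsi T HT) as (H1 & H2 & _); now apply zeta_fun_extension; auto.
  + intros p; split.
    * intros (Hp & T & HT & HP).
      destruct (zeta_fun_polar T _ _ p (Hgr T HT) Hp) as (c & Hc & _ & _ & H34).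
      apply H34, (proj2 (simple_polar_cases _ _ _ Hc)), HP.
    * assert (Hmk : forall T, Psi0 pi T -> 2 < Re p ->
        (forall c, simple_polar (zeta_fun T (fst (gr T)) (snd (gr T))) p c ->
           (p = RtoC 4 -> c = fst (gr T)) -> (p = RtoC 3 -> c = snd (gr T)) -> c <> 0%C) ->
        dimension_spectrum pi (fun T => zeta_fun T (fst (gr T)) (snd (gr T))) 2 p).
      { intros T HT Hp Hc; split; [exact Hp|]; exists T; split; [exact HT|].
        destruct (zeta_fun_polar T _ _ p (Hgr T HT) Hp) as (c & H1 & H2 & H3 & _).
        exists 1%nat; apply simple_polar_pole with c; auto. }
      intros [E3|E4].
      (* The pole at 3 comes from [x1^* x1]: its cubic coefficient vanishes, so the quadratic one
         cannot. *)
      -- assert (HT := Psi0_algebra q pi x1_norm hpi).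
         apply (Hmk _ HT); [rewrite E3, re_RtoC; lra|].
         intros c _ _ H3; rewrite (H3 E3).
         destruct (Halg x1_norm) as (L & HL); destruct (Hgrowth _ _ HL) as (a2 & Ha).
         (* The list [L] is abstract here, so its symbol is recovered from the integral over the
            circle, where [x1] restricts to 0. *)
         assert (HS : diagonal_symbol L = 0%C).
         { assert (HI := RInt_classical_points q pi _ L HL).
           rewrite (RInt_ext (V := C_R_CompleteNormedModule) _ (fun _ => RtoC 0)) in HI
             by (intros x _; simpl; C_ring).
           rewrite (RInt_const (V := C_R_CompleteNormedModule)) in HI.
           assert (H0 : (RtoC (2 * PI) * diagonal_symbol L = 0)%C).
           { rewrite <- HI; rewrite scal_R_Cmult; C_ring. }
           destruct (Ceq_dec (diagonal_symbol L) 0) as [|N]; [assumption|exfalso].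
           revert H0; apply Cmult_neq_0; [|exact N].
           intros E; apply RtoC_inj in E; pose proof PI_RGT_0; lra. }
         assert (Hg := Hgr _ HT).
         destruct (trace_growth_unique _ _ _ _ _ Hg Ha) as [Ef _].
         destruct (x1_norm_trace_growth q pi _ _ hq hpi Hg) as [N|N]; [|exact N].
         exfalso; apply N; rewrite Ef, HS; ring.
      (* The pole at 4 comes from the identity, with residue [4 / 3]. *)
      -- assert (HT := Psi0_algebra q pi (Scalar 1) hpi).
         apply (Hmk _ HT); [rewrite E4, re_RtoC; lra|].
         intros c _ H4 _; rewrite (H4 E4).
         destruct (trace_growth_unique _ _ _ _ _ (Hgr _ HT) (trace_growth_scalar_one q pi hpi))
           as [-> _].
         intros E; apply RtoC_inj in E; lra.
  + intros T p HT Hp HP.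
    destruct (zeta_fun_polar T _ _ p (Hgr T HT) Hp) as (c & Hc & _).
    now apply (proj2 (simple_polar_cases _ _ _ Hc)).
- intros a; destruct (Halg a) as (L & HL); destruct (Hgrowth _ _ HL) as (a2 & Ha).
  destruct (HPsi _ (Psi0_algebra q pi a hpi)) as (H1 & H2 & _).
  exists (fun s => zeta_fun (pi a) (RtoC (4 / 3) * diagonal_symbol L)%C a2 (s + 4)%C); split.
  + now apply zeta_fun_shift_extension.
  + rewrite (RInt_classical_points q pi a L HL).
    destruct (zeta_fun_shift_polar (pi a) _ a2 0 Ha) as (c & Hc & E0);
      [rewrite re_RtoC; lra|].
    replace (RtoC (2 / (3 * PI)) * (RtoC (2 * PI) * diagonal_symbol L))%C with c.
    * now apply simple_polar_residue.
    (* The two expressions for the residue agree because [2 / (3 PI) * (2 PI) = 4 / 3]. *)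
    * rewrite (E0 eq_refl), Cmult_assoc, <- RtoC_mult; do 2 f_equal.
      pose proof PI_RGT_0; field; lra.
Qed.
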